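(* Let $p$ be an odd prime, $K$ a finite extension of $\mathbb{Q}_p$ with valuation ring $R$, $n\ge 2$, $\mathfrak{g}=\mathfrak{sp}_{2n}(\mathbb{Z}_p)$ and $G=\exp(p\,\mathfrak{sp}_{2n}(\mathbb{Z}_p))$. Let $\rho:\widehat{U(\mathfrak{g})}_K\to\widehat{A_n(R)}_K$ be the metaplectic representation. Then its restriction $\rho|_{KG}:KG\to\widehat{A_n(R)}_K$ to the Iwasawa algebra $KG\subseteq\widehat{U(\mathfrak{g})}_K$ is injective.
   Context: $\mathfrak{g}=\mathfrak{sp}_{2n}(\mathbb{Z}_p)=\left\{\begin{bmatrix}A&B\\C&-A^T\end{bmatrix}:A,B,C\in M_n(\mathbb{Z}_p),\,B^T=B,\,C^T=C\right\}$, and $G=\exp(p\,\mathfrak{g})=\mathrm{Sp}_{2n}(\mathbb{Z}_p)\cap(I+pM_{2n}(\mathbb{Z}_p))$, a uniform pro-$p$ group. Iwasawa algebra: $RG=\varprojlim R[G/N]$ over all open normal subgroups $N$ of $G$, and $KG=RG\otimes_RK$. If $(G_1,\dots,G_d)$ is a minimal topological generating set of $G$, each element of $KG$ is uniquely $\sum_{\alpha\in\mathbb{N}_0^d}\lambda_\alpha(G_1-1)^{\alpha_1}\cdots(G_d-1)^{\alpha_d}$ with $\lambda_\alpha\in K$ uniformly bounded. Affinoid enveloping algebra: with $\mathfrak{g}_R=\mathfrak{g}\otimes_{\mathbb{Z}_p}R$, $\widehat{U(\mathfrak{g})}_K=\widehat{U(\mathfrak{g}_R)}\otimes_RK$, where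 $\widehat{U(\mathfrak{g}_R)}$ is the $p$-adic completion of $U(\mathfrak{g}_R)$. For a $\mathbb{Z}_p$-basis $g_1,\dots,g_d$ of $\mathfrak{g}$ its elements are the series $\sum_{\alpha\in\mathbb{N}_0^d}c_\alpha g_1^{\alpha_1}\cdots g_d^{\alpha_d}$ with $c_\alpha\in K$, $c_\alpha\to0$ as $|\alpha|\to\infty$. $KG$ embeds in $\widehat{U(\mathfrak{g})}_K$ by sending the group element $\exp(px)\in G$ ($x\in\mathfrak{g}$) to $e^{px}\in\widehat{U(\mathfrak{g})}_K$. Completed Weyl algebra: $A_n(R)$ is the $n$-th Weyl algebra over $R$ on $x_1,\dots,x_n,\partial_1,\dots,\partial_n$ (with $[\partial_i,x_j]=\delta_{ij}$), and $\widehat{A_n(R)}_K=\widehat{A_n(R)}\otimes_RK$, where $\widehat{A_n(R)}$ is the $p$-adic completion; its elements are the series $\sum_{\alpha,\beta\in\mathbb{N}_0^n}c_{\alpha,\beta}\mathbf{x}^\alpha\partial^\beta$ with $c_{\alpha,\beta}\in K$, $c_{\alpha,\beta}\to0$ as $|\alpha|+|\beta|\to\infty$. Metaplectic representation: $\rho$ is the continuous $K$-algebra homomorphism extending the Lie algebra homomorphism $\mathfrak{sp}_{2n}(\mathbb{Z}_p)\to A_n(\mathbb{Z}_p)$, $$\begin{bmatrix}A&B\\C&-A^T\end{bmatrix}\longmapsto-\tfrac12\mathrm{tr}(A)-\sum_{i,j=1}^nA_{ij}x_j\partial_i+\tfrac12\sum_{i,j=1}^nB_{ij}\partial_i\partial_j-\tfrac12\sum_{i,j=1}^nC_{ij}x_ix_j.$$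 *)

(* Defs.v *)
From HB Require Import structures.
From mathcomp Require Import all_boot all_order all_algebra all_field.
From mathcomp Require Import boolp.
From mathcomp Require Import monalg.

Set Implicit Arguments.
Unset Strict Implicit.
Unset Printing Implicit Defensive.

Import Order.TTheory GRing.Theory Num.Theory.
Local Open Scope ring_scope.
Local Open Scope quotient_scope.

(* The library's [algType] insists on [1 != 0]; for rings given by generators *)
(* and relations that inequality is a theorem, so an algebra is taken to be a *)
(* possibly zero ring with a homomorphism from the scalars to its centre.     *)
Record algebra (S : pzRingType) := MkAlgebra {
  alg_ring :> pzRingType;
  alg_in : {rmorphism S -> alg_ring};
  alg_comm : forall c x, alg_in c * x = x * alg_in c }.
Arguments alg_in {S} _.

Record alg_hom (S : pzRingType) (A B : algebra S) := AlgHom {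
  alg_fun :> {rmorphism A -> B};
  alg_fun_in : forall c, alg_fun (alg_in A c) = alg_in B c }.

Inductive ideal_gen (A : pzRingType) (P : A -> Prop) : A -> Prop :=
| ideal_gen0 : ideal_gen P 0
| ideal_gen_in a : P a -> ideal_gen P a
| ideal_genD a b : ideal_gen P a -> ideal_gen P b -> ideal_gen P (a + b)
| ideal_genMl c a : ideal_gen P a -> ideal_gen P (c * a)
| ideal_genMr a c : ideal_gen P a -> ideal_gen P (a * c).

Section Quotient.
Variables (A : pzRingType) (P : A -> Prop).
Local Notation J := (ideal_gen P).

Lemma ideal_genN a : J a -> J (- a).
Proof. by rewrite -mulN1r; apply: ideal_genMl. Qed.

Lemma ideal_genB a b : J a -> J b -> J (a - b).
Proof. by move=> Ja Jb; apply: ideal_genD => //; apply: ideal_genN. Qed.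

Definition quot_equiv (x y : A) : bool := `[< J (x - y) >].

Lemma quot_equiv_is_equiv : equiv_class_of quot_equiv.
Proof.
split=> [x|x y|y x z].
- by apply/asboolP; rewrite subrr; apply: ideal_gen0.
- by apply/asboolP/asboolP => /ideal_genN; rewrite opprB.
- move=> /asboolP h1 /asboolP h2; apply/asboolP.
  by rewrite -[x](addrNK y) -addrA; apply: ideal_genD.
Qed.

Canonical quot_equivRel := EquivRelPack quot_equiv_is_equiv.
Canonical quot_encModRel := defaultEncModRel quot_equiv.

Definition quot := {eq_quot quot_equiv}.

HB.instance Definition _ : EqQuotient A quot_equiv quot := EqQuotient.on quot.
HB.instance Definition _ := Choice.on quot.

Lemma quot_eqP (x y : A) : \pi_quot x = \pi_quot y <-> J (x - y).
Proof.
split=> [/eqP|h]; first by rewrite piE => /asboolP.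
by apply/eqP; rewrite piE; apply/asboolP.
Qed.

Lemma quot_repr x : J (repr (\pi_quot x) - x).
Proof. by apply/quot_eqP; rewrite reprK. Qed.

Definition quot_zero : quot := lift_cst quot 0.
Definition quot_add := lift_op2 quot +%R.
Definition quot_opp := lift_op1 quot -%R.
Definition quot_one : quot := lift_cst quot 1.
Definition quot_mul := lift_op2 quot *%R.

Canonical pi_quot_zero_morph := PiConst quot_zero.
Canonical pi_quot_one_morph := PiConst quot_one.

Lemma pi_quot_opp : {morph \pi : x / - x >-> quot_opp x}.
Proof.
move=> x; unlock quot_opp; apply/quot_eqP.
by rewrite -opprD; apply/ideal_genN; rewrite -opprB; apply/ideal_genN/quot_repr.
Qed.
Canonical pi_quot_opp_morph := PiMorph1 pi_quot_opp.

Lemma pi_quot_add : {morph \pi : x y / x + y >-> quot_add x y}.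
Proof.
move=> x y; unlock quot_add; apply/esym/quot_eqP.
by rewrite opprD addrACA; apply: ideal_genD; apply: quot_repr.
Qed.
Canonical pi_quot_add_morph := PiMorph2 pi_quot_add.

Lemma pi_quot_mul : {morph \pi : x y / x * y >-> quot_mul x y}.
Proof.
move=> x y; unlock quot_mul; apply/esym/quot_eqP.
rewrite -(addrNK (x * repr (\pi_quot y)) (_ * repr (\pi_quot y))) -mulrBl.
rewrite -addrA -mulrBr; apply: ideal_genD.
  by apply: ideal_genMr; apply: quot_repr.
by apply: ideal_genMl; apply: quot_repr.
Qed.
Canonical pi_quot_mul_morph := PiMorph2 pi_quot_mul.

Lemma quot_addA : associative quot_add.
Proof. by move=> x y z; rewrite -[x]reprK -[y]reprK -[z]reprK !piE addrA. Qed.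
Lemma quot_addC : commutative quot_add.
Proof. by move=> x y; rewrite -[x]reprK -[y]reprK !piE addrC. Qed.
Lemma quot_add0 : left_id quot_zero quot_add.
Proof. by move=> x; rewrite -[x]reprK !piE add0r. Qed.
Lemma quot_addN : left_inverse quot_zero quot_opp quot_add.
Proof. by move=> x; rewrite -[x]reprK !piE addNr. Qed.
HB.instance Definition _ :=
  GRing.isZmodule.Build quot quot_addA quot_addC quot_add0 quot_addN.

Lemma quot_mulA : associative quot_mul.
Proof. by move=> x y z; rewrite -[x]reprK -[y]reprK -[z]reprK !piE mulrA. Qed.
Lemma quot_mul1 : left_id quot_one quot_mul.
Proof. by move=> x; rewrite -[x]reprK !piE mul1r. Qed.
Lemma quot_mulr1 : right_id quot_one quot_mul.
Proof. by move=> x; rewrite -[x]reprK !piE mulr1. Qed.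
Lemma quot_mulDl : left_distributive quot_mul +%R.
Proof.
move=> x y z; rewrite -[x]reprK -[y]reprK -[z]reprK.
by rewrite -[_ + _ in LHS]pi_quot_add -!pi_quot_mul mulrDl pi_quot_add.
Qed.
Lemma quot_mulDr : right_distributive quot_mul +%R.
Proof.
move=> x y z; rewrite -[x]reprK -[y]reprK -[z]reprK.
by rewrite -[_ + _ in LHS]pi_quot_add -!pi_quot_mul mulrDr pi_quot_add.
Qed.
HB.instance Definition _ := GRing.Zmodule_isPzRing.Build quot
  quot_mulA quot_mul1 quot_mulr1 quot_mulDl quot_mulDr.

Definition qpi (a : A) : quot := \pi_quot a.

Lemma qpi_repr x : qpi (repr x) = x.
Proof. exact: reprK. Qed.
Lemma qpi_eqP (x y : A) : qpi x = qpi y <-> J (x - y).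
Proof. exact: quot_eqP. Qed.
Lemma qpi_zmod : zmod_morphism qpi.
Proof. by move=> x y; rewrite /qpi pi_quot_add pi_quot_opp. Qed.
Lemma qpi_monoid : monoid_morphism qpi.
Proof.
split=> [|x y]; last exact: pi_quot_mul.
by rewrite [RHS]/GRing.one /= /quot_one; unlock.
Qed.
HB.instance Definition _ := GRing.isZmodMorphism.Build A quot qpi qpi_zmod.
HB.instance Definition _ := GRing.isMonoidMorphism.Build A quot qpi qpi_monoid.

End Quotient.
Arguments qpi {A} P a.

Section QuotientAlgebra.
Variables (S : pzRingType) (A : algebra S) (P : A -> Prop).

Definition quot_in (c : S) : quot P := qpi P (alg_in A c).

HB.instance Definition _ := GRing.RMorphism.copy quot_in (qpi P \o alg_in A).

Lemma quot_in_comm c (x : quot P) : quot_in c * x = x * quot_in c.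
Proof. by rewrite /quot_in -[x]qpi_repr -!rmorphM alg_comm. Qed.

Definition quot_alg : algebra S := MkAlgebra quot_in_comm.

End QuotientAlgebra.

(* The limit of the quotients of [A] by the ideals generated by the [P i],    *)
(* with a transition map [A/J_i -> A/J_j] whenever [J_i] is contained in      *)
(* [J_j].                                                                     *)
Section Limit.
Variables (A : pzRingType) (I : Type) (P : I -> A -> Prop).

Definition ideal_sub i j := forall a, ideal_gen (P i) a -> ideal_gen (P j) a.

Record ilim := Ilim {
  ilim_val :> forall i, quot (P i);
  ilim_compat : forall i j, ideal_sub i j ->
    forall a, ilim_val i = qpi (P i) a -> ilim_val j = qpi (P j) a }.

Lemma ilimP (x y : ilim) : (forall i, x i = y i) -> x = y.
Proof.
case: x y => [x hx] [y hy] /= h.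
have exy : x = y by apply: functional_extensionality_dep.
by rewrite exy in hx *; congr Ilim; apply: Prop_irrelevance.
Qed.

HB.instance Definition _ := gen_eqMixin ilim.
HB.instance Definition _ := gen_choiceMixin ilim.

Lemma ilim_cst_compat a i j : ideal_sub i j ->
  forall b, qpi (P i) a = qpi (P i) b -> qpi (P j) a = qpi (P j) b.
Proof. by move=> s b /qpi_eqP h; apply/qpi_eqP/s. Qed.
Definition ilim_cst (a : A) : ilim := Ilim (@ilim_cst_compat a).

Lemma ilim_opp_compat (x : ilim) i j : ideal_sub i j ->
  forall a, - x i = qpi (P i) a -> - x j = qpi (P j) a.
Proof.
move=> s a h; have hx : x i = qpi (P i) (- a) by rewrite rmorphN /= -h opprK.
by rewrite (ilim_compat s hx) rmorphN opprK.
Qed.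
Definition ilim_opp x : ilim := Ilim (@ilim_opp_compat x).

Lemma ilim_add_compat (x y : ilim) i j : ideal_sub i j ->
  forall a, x i + y i = qpi (P i) a -> x j + y j = qpi (P j) a.
Proof.
move=> s a; rewrite -[x i]qpi_repr -[y i]qpi_repr -rmorphD => h.
rewrite (ilim_compat s (esym (qpi_repr (x i)))).
rewrite (ilim_compat s (esym (qpi_repr (y i)))) -rmorphD.
exact: ilim_cst_compat s _ h.
Qed.
Definition ilim_add x y : ilim := Ilim (@ilim_add_compat x y).

Lemma ilim_mul_compat (x y : ilim) i j : ideal_sub i j ->
  forall a, x i * y i = qpi (P i) a -> x j * y j = qpi (P j) a.
Proof.
move=> s a; rewrite -[x i]qpi_repr -[y i]qpi_repr -rmorphM => h.
rewrite (ilim_compat s (esym (qpi_repr (x i)))).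
rewrite (ilim_compat s (esym (qpi_repr (y i)))) -rmorphM.
exact: ilim_cst_compat s _ h.
Qed.
Definition ilim_mul x y : ilim := Ilim (@ilim_mul_compat x y).

Lemma ilim_addA : associative ilim_add.
Proof. by move=> x y z; apply: ilimP => i /=; rewrite addrA. Qed.
Lemma ilim_addC : commutative ilim_add.
Proof. by move=> x y; apply: ilimP => i /=; rewrite addrC. Qed.
Lemma ilim_add0 : left_id (ilim_cst 0) ilim_add.
Proof. by move=> x; apply: ilimP => i /=; rewrite rmorph0 add0r. Qed.
Lemma ilim_addN : left_inverse (ilim_cst 0) ilim_opp ilim_add.
Proof. by move=> x; apply: ilimP => i /=; rewrite rmorph0 addNr. Qed.
HB.instance Definition _ :=
  GRing.isZmodule.Build ilim ilim_addA ilim_addC ilim_add0 ilim_addN.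

Lemma ilim_mulA : associative ilim_mul.
Proof. by move=> x y z; apply: ilimP => i /=; rewrite mulrA. Qed.
Lemma ilim_mul1 : left_id (ilim_cst 1) ilim_mul.
Proof. by move=> x; apply: ilimP => i /=; rewrite rmorph1 mul1r. Qed.
Lemma ilim_mulr1 : right_id (ilim_cst 1) ilim_mul.
Proof. by move=> x; apply: ilimP => i /=; rewrite rmorph1 mulr1. Qed.
Lemma ilim_mulDl : left_distributive ilim_mul +%R.
Proof. by move=> x y z; apply: ilimP => i /=; rewrite mulrDl. Qed.
Lemma ilim_mulDr : right_distributive ilim_mul +%R.
Proof. by move=> x y z; apply: ilimP => i /=; rewrite mulrDr. Qed.
HB.instance Definition _ := GRing.Zmodule_isPzRing.Build ilim
  ilim_mulA ilim_mul1 ilim_mulr1 ilim_mulDl ilim_mulDr.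

Lemma ilim_cst_zmod : zmod_morphism ilim_cst.
Proof. by move=> a b; apply: ilimP => i /=; rewrite rmorphB. Qed.
Lemma ilim_cst_monoid : monoid_morphism ilim_cst.
Proof. by split=> [|a b]; apply: ilimP => i /=; rewrite ?rmorphM. Qed.
HB.instance Definition _ :=
  GRing.isZmodMorphism.Build A ilim ilim_cst ilim_cst_zmod.
HB.instance Definition _ :=
  GRing.isMonoidMorphism.Build A ilim ilim_cst ilim_cst_monoid.

End Limit.
Arguments ilim_cst {A I} P a.

Section LimitAlgebra.
Variables (S : pzRingType) (A : algebra S) (I : Type) (P : I -> A -> Prop).

Definition ilim_in (c : S) : ilim P := ilim_cst P (alg_in A c).

HB.instance Definition _ := GRing.RMorphism.copy ilim_in (ilim_cst P \o alg_in A).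

Lemma ilim_in_comm c (x : ilim P) : ilim_in c * x = x * ilim_in c.
Proof. by apply: ilimP => i /=; rewrite -[x i]qpi_repr -!rmorphM alg_comm. Qed.

Definition ilim_alg : algebra S := MkAlgebra ilim_in_comm.

End LimitAlgebra.

Definition padic_ideal (p : nat) (A : pzRingType) (k : nat) (a : A) : Prop :=
  a = p%:R ^+ k.
Arguments padic_ideal p A k a : clear implicits.

Lemma ideal_sub_padic p (A : pzRingType) (k l : nat) : (l <= k)%N ->
  ideal_sub (padic_ideal p A) k l.
Proof.
move=> lk a; elim=> [|b ->|b c _ IHb _ IHc|c b _ IHb|b c _ IHb].
- exact: ideal_gen0.
- by rewrite -(subnK lk) exprD; apply/ideal_genMl/ideal_gen_in.
- exact: ideal_genD.
- exact: ideal_genMl.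
- exact: ideal_genMr.
Qed.

Section PadicIntegers.
Variables (p : nat) (p_pr : prime p).

Definition padic_int of prime p : Type := ilim (padic_ideal p int).
Local Notation Zp := (padic_int p_pr).

HB.instance Definition _ := GRing.PzRing.on Zp.

Lemma padic_idealP k (a : int) :
  ideal_gen (padic_ideal p int k) a <-> (p ^ k %| `|a|)%N.
Proof.
split=> [|h].
  elim=> [|b ->|b c _ hb _ hc|c b _ hb|b c _ hb].
  - by rewrite absz0.
  - by rewrite abszX natz.
  - suff: ((p ^ k)%N %| b + c)%Z by rewrite dvdzE.
    by rewrite rpredD // dvdzE.
  - by rewrite abszM dvdn_mull.
  - by rewrite abszM dvdn_mulr.
have /dvdzP[c ->] : ((p ^ k)%N %| a)%Z by rewrite dvdzE.
apply/ideal_genMl/ideal_gen_in.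
by rewrite /padic_ideal -natz natrX.
Qed.

Lemma padic_int_mulC : commutative (@GRing.mul Zp).
Proof.
move=> x y; apply: ilimP => k /=.
by rewrite -[x k]qpi_repr -[y k]qpi_repr -!rmorphM mulrC.
Qed.
HB.instance Definition _ :=
  GRing.PzRing_hasCommutativeMul.Build Zp padic_int_mulC.

Lemma padic_int_1neq0 : 1 != 0 :> Zp.
Proof.
apply/eqP => /(congr1 (fun x : ilim (padic_ideal p int) => x 1%N)) /= /qpi_eqP.
move/padic_idealP; rewrite subr0 expn1 dvdn1 => /eqP p1.
by move: p_pr; rewrite p1.
Qed.
HB.instance Definition _ := GRing.PzSemiRing_isNonZero.Build Zp padic_int_1neq0.

Definition padic_int_unit : pred Zp := fun x => `[< exists y, y * x = 1 >].
Definition padic_int_inv (x : Zp) : Zp :=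
  if pselect (exists y, y * x = 1) is left h then projT1 (cid h) else x.

Lemma padic_int_mulV : {in padic_int_unit, left_inverse 1 padic_int_inv *%R}.
Proof.
move=> x /asboolP h; rewrite /padic_int_inv; case: pselect => // h'.
exact: projT2 (cid h').
Qed.
Lemma padic_int_unitP (x y : Zp) : y * x = 1 -> padic_int_unit x.
Proof. by move=> h; apply/asboolP; exists y. Qed.
Lemma padic_int_inv_out : {in [predC padic_int_unit], padic_int_inv =1 id}.
Proof.
by move=> x /asboolP h; rewrite /padic_int_inv; case: pselect.
Qed.
HB.instance Definition _ := GRing.ComNzRing_hasMulInverse.Build Zp
  padic_int_mulV padic_int_unitP padic_int_inv_out.

Lemma padic_int_neq0 (x : Zp) : x <> 0 -> exists k : nat, ilim_val x k <> 0.
Proof.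
move=> x0; apply: contrapT => h; apply: x0; apply: ilimP => k /=.
rewrite rmorph0; apply: contrapT => hk; apply: h; by exists k.
Qed.

Lemma padic_int_eq0P (x : Zp) (k l : nat) : (l <= k)%N ->
  ilim_val x l = 0 <-> (p ^ l %| `|repr (ilim_val x k)|)%N.
Proof.
move=> lk; rewrite -padic_idealP.
rewrite (ilim_compat (ideal_sub_padic lk) (esym (qpi_repr (ilim_val x k)))).
rewrite -(rmorph0 (qpi (padic_ideal p int l))).
split=> [/qpi_eqP|h]; first by rewrite subr0.
by apply/qpi_eqP; rewrite subr0.
Qed.

Lemma padic_int_integral (x y : Zp) : x * y = 0 -> (x == 0) || (y == 0).
Proof.
move=> xy0; case: (eqVneq x 0) => //= /eqP/padic_int_neq0 [k xk].
case: (eqVneq y 0) => //= /eqP/padic_int_neq0 [l yl].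
have {}xk := contra_not (padic_int_eq0P x (leq_addr l k)).2 xk.
have {}yl := contra_not (padic_int_eq0P y (leq_addl k l)).2 yl.
move: xk yl; set a := repr _; set b := repr _ => xk yl.
have : qpi (padic_ideal p int (k + l)%N) (a * b) = qpi _ 0.
  rewrite rmorphM /= /a /b !qpi_repr.
  exact: (congr1 (fun z : ilim (padic_ideal p int) => z (k + l)%N) xy0).
move=> /qpi_eqP; rewrite subr0 => /padic_idealP; rewrite abszM.
have a0 : (0 < `|a|)%N by rewrite lt0n; apply: contra_notN xk => /eqP ->.
have b0 : (0 < `|b|)%N by rewrite lt0n; apply: contra_notN yl => /eqP ->.
move: xk yl => /negP; rewrite pfactor_dvdn // -ltnNge => xk /negP.
rewrite pfactor_dvdn // -ltnNge => yl.
by rewrite pfactor_dvdn ?muln_gt0 ?a0 // lognM // leqNgt -addnS leq_add // ltnW.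
Qed.
HB.instance Definition _ :=
  GRing.ComUnitRing_isIntegral.Build Zp padic_int_integral.

End PadicIntegers.

Definition padic_num (p : nat) (p_pr : prime p) := {fraction (padic_int p_pr)}.
HB.instance Definition _ p (p_pr : prime p) := GRing.Field.on (padic_num p_pr).

Definition padic_to_num p (p_pr : prime p) : padic_int p_pr -> padic_num p_pr :=
  @tofrac _.
HB.instance Definition _ p (p_pr : prime p) :=
  GRing.RMorphism.copy (@padic_to_num p p_pr) (@tofrac (padic_int p_pr)).

Section ValuationRing.
Variables (p : nat) (p_pr : prime p) (K : fieldExtType (padic_num p_pr)).

(* [v 0] is irrelevant. The last field says that [v] extends the p-adic       *)
(* valuation: the image of [x] in Z/p^k is zero iff [x] is in [p^k Z_p].      *)
Record padic_valuation := PadicValuation {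
  pval :> K -> rat;
  pvalM : forall x y, x != 0 -> y != 0 -> pval (x * y) = pval x + pval y;
  pvalD : forall x y, x != 0 -> y != 0 -> x + y != 0 ->
    Num.min (pval x) (pval y) <= pval (x + y);
  pval_padic : forall (x : padic_int p_pr) (k : nat),
    ilim_val x k = 0 -> ilim_val x k.+1 <> 0 ->
    pval (padic_to_num x)%:A = k%:R }.

Variable v : padic_valuation.

Definition pval_ge0 : pred K := fun x => (x == 0) || (0 <= v x).

Lemma pval1 : v 1 = 0.
Proof.
have /eqP := pvalM v (oner_neq0 K) (oner_neq0 K).
by rewrite mulr1 -subr_eq subrr eq_sym => /eqP.
Qed.

Lemma pvalN x : x != 0 -> v (- x) = v x.
Proof.
have n1 : -1 != 0 :> K by rewrite oppr_eq0 oner_neq0.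
have vN1 : v (-1) = 0.
  have := pvalM v n1 n1; rewrite mulrNN mulr1 pval1 -mulr2n => /esym/eqP.
  by rewrite mulrn_eq0 => /eqP.
by move=> x0; rewrite -mulN1r pvalM // vN1 add0r.
Qed.

Lemma pval_ge0_subring : subring_closed pval_ge0.
Proof.
split=> [|x y|x y]; rewrite !unfold_in.
- by rewrite pval1 lexx orbT.
- have [->|x0 /= vx] := eqVneq x 0.
    rewrite sub0r oppr_eq0; have [//|y0 /=] := eqVneq y 0.
    by rewrite pvalN.
  have [->|y0 /= vy] := eqVneq y 0; first by rewrite subr0 vx orbT.
  have [//|xy0 /=] := eqVneq (x - y) 0.
  apply: le_trans (pvalD v x0 _ xy0); last by rewrite oppr_eq0.
  by rewrite le_min vx pvalN.
- rewrite mulf_eq0; have [//|x0 /= vx] := eqVneq x 0.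
  have [//|y0 /= vy] := eqVneq y 0.
  by rewrite pvalM // addr_ge0.
Qed.
HB.instance Definition _ := GRing.isSubringClosed.Build K pval_ge0 pval_ge0_subring.

Record valuation_ring := ValuationRing {
  vr_val : K; vr_valP : vr_val \in pval_ge0 }.
HB.instance Definition _ := [isSub for vr_val].
HB.instance Definition _ := [Choice of valuation_ring by <:].
HB.instance Definition _ := [SubChoice_isSubComNzRing of valuation_ring by <:].

Definition padic_to_ext : padic_int p_pr -> K := in_alg K \o @padic_to_num p p_pr.
HB.instance Definition _ :=
  GRing.RMorphism.copy padic_to_ext (in_alg K \o @padic_to_num p p_pr).

Lemma padic_to_ext_ge0 x : padic_to_ext x \in pval_ge0.
Proof.
rewrite unfold_in; have [->|x0] := eqVneq x 0; first by rewrite rmorph0 eqxx.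
have /padic_int_neq0 [j xj] : x <> 0 by apply/eqP.
have ex : exists k, ilim_val x k != 0 by exists j; apply/eqP.
case: (ex_minnP ex) => [[|k]] xk kmin.
  case/eqP: xk; rewrite -[ilim_val x 0%N]qpi_repr -[RHS](rmorph0 (qpi _)).
  by apply/qpi_eqP/padic_idealP; rewrite dvd1n.
rewrite (pval_padic v _ (elimN eqP xk)) ?ler0n ?orbT //.
by apply/eqP; apply: contraTT (ltnSn k) => /kmin; rewrite ltnNge => ->.
Qed.

Definition padic_to_vring (x : padic_int p_pr) : valuation_ring :=
  ValuationRing (padic_to_ext_ge0 x).

Lemma padic_to_vring_zmod : zmod_morphism padic_to_vring.
Proof. by move=> x y; apply: val_inj; rewrite /= !rmorphB. Qed.
Lemma padic_to_vring_monoid : monoid_morphism padic_to_vring.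
Proof.
by split=> [|x y]; apply: val_inj; rewrite /= ?rmorph1 ?rmorphM.
Qed.
HB.instance Definition _ := GRing.isZmodMorphism.Build
  (padic_int p_pr) valuation_ring padic_to_vring padic_to_vring_zmod.
HB.instance Definition _ := GRing.isMonoidMorphism.Build
  (padic_int p_pr) valuation_ring padic_to_vring padic_to_vring_monoid.

End ValuationRing.

Section FreeAlgebra.
Variables (S : comNzRingType) (X : choiceType).

Lemma malgC_comm c (x : {malg S[{fmonom X}]}) : malgC c * x = x * malgC c.
Proof.
rewrite !malgM_def fgmulUg fgmulgU.
by apply: eq_bigr => k _; rewrite mul1m mulm1 mulrC.
Qed.

Definition free_alg : algebra S := MkAlgebra malgC_comm.
Definition free_gen (x : X) : free_alg := mkmalgU (fmu x) 1.

End FreeAlgebra.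
Arguments free_gen S {X} x.

Section EnvelopingAlgebra.
Variables (S : comNzRingType) (L : lmodType S) (br : L -> L -> L).
Local Notation gen := (free_gen S).

Variant env_rel : free_alg S L -> Prop :=
| env_linear c x y :
    env_rel (gen (c *: x + y) - (alg_in (free_alg S L) c * gen x + gen y))
| env_bracket x y : env_rel (gen x * gen y - gen y * gen x - gen (br x y)).

Definition env_alg : algebra S := quot_alg env_rel.
Definition env_in (x : L) : env_alg := qpi env_rel (gen x).

End EnvelopingAlgebra.

Section WeylAlgebra.
Variables (S : comNzRingType) (n : nat).
Local Notation F := (free_alg S ('I_n + 'I_n)%type).
Local Notation X i := (free_gen S (inl i) : F).
Local Notation D i := (free_gen S (inr i) : F).

Variant weyl_rel : F -> Prop :=
| weyl_XX i j : weyl_rel (X i * X j - X j * X i)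
| weyl_DD i j : weyl_rel (D i * D j - D j * D i)
| weyl_DX i j : weyl_rel (D i * X j - X j * D i - (i == j)%:R).

Definition weyl_alg : algebra S := quot_alg weyl_rel.
Definition weyl_X i : weyl_alg := qpi weyl_rel (X i).
Definition weyl_D i : weyl_alg := qpi weyl_rel (D i).

End WeylAlgebra.

(* A ring homomorphism out of [group_alg] is a group homomorphism into the    *)
(* units of the target; this is the usual group ring [S[G]].                  *)
Section GroupAlgebra.
Variables (S : comNzRingType) (G : groupType).
Local Notation gen := (free_gen S).

Variant group_rel : free_alg S G -> Prop :=
| group_rel1 : group_rel (gen 1%g - 1)
| group_relM g h : group_rel (gen (g * h)%g - gen g * gen h).

Definition group_alg : algebra S := quot_alg group_rel.
Definition group_in (g : G) : group_alg := qpi group_rel (gen g).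

End GroupAlgebra.

(* [A] tensored with [K] over [S]: the universal [K]-algebra under [A].       *)
Section BaseChange.
Variables (S : pzRingType) (K : comNzRingType) (f : {rmorphism S -> K}).
Variable A : algebra S.
Local Notation gen := (free_gen K).

Variant base_change_rel : free_alg K A -> Prop :=
| base_changeD x y : base_change_rel (gen (x + y) - (gen x + gen y))
| base_changeM x y : base_change_rel (gen (x * y) - gen x * gen y)
| base_change_scalar c :
    base_change_rel (gen (alg_in A c) - alg_in (free_alg K A) (f c)).

Definition base_change : algebra K := quot_alg base_change_rel.
Definition base_change_in (x : A) : base_change :=
  qpi base_change_rel (gen x).

End BaseChange.

Definition padic_completion p (S : pzRingType) (A : algebra S) : algebra S :=
  ilim_alg (padic_ideal p A).

Section Exponential.
Variables (p : nat) (F : fieldType) (A : algebra F) (L : A -> Prop).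

(* Convergence for the topology with basis [p^k L] of neighbourhoods of 0.    *)
Definition padic_cvg (u : nat -> A) (l : A) : Prop :=
  forall k : nat, exists m0 : nat, forall m : nat, (m0 <= m)%N ->
    exists2 b, L b & u m - l = p%:R ^+ k * b.

Definition is_exp (x e : A) : Prop :=
  padic_cvg (fun m => \sum_(j < m) alg_in A (j`!%:R)^-1 * x ^+ j) e.

End Exponential.

Section MatrixAlgebra.
Variables (S : comNzRingType) (m : nat).

Lemma scalar_mx_comm c (X : 'M[S]_m) : c%:M * X = X * c%:M.
Proof. by have := comm_scalar_mx c X. Qed.

Definition mx_alg : algebra S := MkAlgebra scalar_mx_comm.

End MatrixAlgebra.

Section SymplecticLie.
Variables (S : comNzRingType) (n : nat).

Definition sp_mem : pred 'M[S]_(n + n) := fun X =>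
  [&& drsubmx X == - (ulsubmx X)^T, (ursubmx X)^T == ursubmx X
    & (dlsubmx X)^T == dlsubmx X].

Lemma sp_submod : submod_closed sp_mem.
Proof.
split=> [|c X Y]; rewrite !unfold_in.
  by rewrite -block_mx0 block_mxKul block_mxKur block_mxKdl block_mxKdr
             !trmx0 oppr0 !eqxx.
case/and3P=> /eqP hX1 /eqP hX2 /eqP hX3 /and3P[/eqP hY1 /eqP hY2 /eqP hY3].
apply/and3P; split; apply/eqP/matrixP => i j; rewrite !mxE.
- move/matrixP/(_ i j): hX1; move/matrixP/(_ i j): hY1; rewrite !mxE => -> ->.
  by rewrite mulrN opprD.
- by move/matrixP/(_ i j): hX2; move/matrixP/(_ i j): hY2; rewrite !mxE => -> ->.
- by move/matrixP/(_ i j): hX3; move/matrixP/(_ i j): hY3; rewrite !mxE => -> ->.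
Qed.
HB.instance Definition _ :=
  GRing.isSubmodClosed.Build S 'M[S]_(n + n) sp_mem sp_submod.

Record sp := Sp { sp_val :> 'M[S]_(n + n); sp_valP : sp_val \in sp_mem }.
HB.instance Definition _ := [isSub for sp_val].
HB.instance Definition _ := [Choice of sp by <:].
HB.instance Definition _ := [SubChoice_isSubLmodule of sp by <:].

Lemma sp_bracket_mem (X Y : sp) :
  sp_val X *m sp_val Y - sp_val Y *m sp_val X \in sp_mem.
Proof.
move: (sp_val X) (sp_val Y) (sp_valP X) (sp_valP Y) => {}X {}Y.
case/and3P=> /eqP hX1 /eqP hX2 /eqP hX3 /and3P[/eqP hY1 /eqP hY2 /eqP hY3].
rewrite -(submxK X) -(submxK Y) hX1 hY1 !mulmx_block opp_block_mx add_block_mx.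
rewrite unfold_in block_mxKul block_mxKur block_mxKdl block_mxKdr.
apply/and3P; split; apply/eqP;
  rewrite !(linearB, linearD) /= !trmx_mul ?linearN /= ?trmxK
    ?hX2 ?hX3 ?hY2 ?hY3 !(mulmxN, mulNmx) ?opprK ?opprD ?opprK;
  by rewrite addrC; congr (_ + _); exact: addrC.
Qed.
Definition sp_bracket (X Y : sp) : sp := Sp (sp_bracket_mem X Y).

End SymplecticLie.

Definition symp_form (S : comNzRingType) (n : nat) : 'M[S]_(n + n) :=
  block_mx 0 1%:M (- 1%:M) 0.

Section CongruenceGroup.
Variables (p : nat) (p_pr : prime p) (n : nat).
Local Notation Zp := (padic_int p_pr).
Local Notation M := 'M[Zp]_(n + n).
Local Notation J := (symp_form Zp n).

Definition congr1_mx (k : nat) (g : M) : Prop :=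
  exists X : M, g = 1%:M + p%:R ^+ k *: X.

Definition congr_sp_mem : pred M := fun g =>
  (g^T *m J *m g == J) && `[< congr1_mx 1 g >].

(* [exp (p sp_2n(Z_p))], as the intersection of Sp_2n(Z_p) and I + p M_2n(Z_p). *)
Record congr_sp := CongrSp { cs_val :> M; cs_valP : cs_val \in congr_sp_mem }.
HB.instance Definition _ := [isSub for cs_val].
HB.instance Definition _ := [Choice of congr_sp by <:].

Lemma symp_formJJ : J *m J = - 1%:M.
Proof.
rewrite mulmx_block !mul0mx !mulmx0 !mulmxN !mulmx1 !addr0 !add0r.
by rewrite scalar_mx_block opp_block_mx !oppr0.
Qed.

Lemma congr_sp1_mem : 1%:M \in congr_sp_mem.
Proof.
rewrite unfold_in trmx1 mul1mx mulmx1 eqxx /=; apply/asboolP; exists 0.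
by rewrite scaler0 addr0.
Qed.

Lemma congr_spM_mem (g h : congr_sp) : cs_val g *m cs_val h \in congr_sp_mem.
Proof.
case: g => g /= /andP[/eqP gJ /asboolP[X gX]].
case: h => h /= /andP[/eqP hJ /asboolP[Y hY]].
rewrite unfold_in; apply/andP; split.
  have -> : (g *m h)^T *m J *m (g *m h) = h^T *m (g^T *m J *m g) *m h.
    by rewrite trmx_mul !mulmxA.
  by rewrite gJ hJ.
apply/asboolP; exists (X + Y + p%:R *: (X *m Y)).
rewrite gX hY !expr1 mulmxDl mul1mx mulmxDr mulmx1.
rewrite -scalemxAl -scalemxAr !scalerDr -!addrA; congr (_ + _).
by rewrite addrCA.
Qed.

Definition congr_sp_invmx (g : M) : M := - (J *m g^T *m J).

Lemma congr_sp_invmxl (g : congr_sp) : congr_sp_invmx g *m g = 1%:M.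
Proof.
case: g => g /= /andP[/eqP gJ _].
have -> : congr_sp_invmx g *m g = - (J *m (g^T *m J *m g)).
  by rewrite /congr_sp_invmx mulNmx !mulmxA.
by rewrite gJ symp_formJJ opprK.
Qed.

Lemma congr_spV_mem (g : congr_sp) : congr_sp_invmx g \in congr_sp_mem.
Proof.
have gV := congr_sp_invmxl g; have gV' := mulmx1C gV.
move: gV gV'; case: g => g /= /andP[/eqP gJ /asboolP[X gX]] gV gV'.
rewrite unfold_in; apply/andP; split.
  set h := congr_sp_invmx g in gV gV' *.
  have -> : h^T *m J *m h = (g *m h)^T *m J *m (g *m h).
    by rewrite -{1}gJ trmx_mul !mulmxA.
  by rewrite gV' trmx1 mul1mx mulmx1.
apply/asboolP; exists (- (J *m X^T *m J)).
rewrite /congr_sp_invmx gX linearD /= trmx1 mulmxDr mulmx1 mulmxDl symp_formJJ.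
by rewrite linearZ /= -scalemxAr -scalemxAl opprD opprK scalerN.
Qed.

Definition congr_sp_one : congr_sp := CongrSp congr_sp1_mem.
Definition congr_sp_mul (g h : congr_sp) : congr_sp := CongrSp (congr_spM_mem g h).
Definition congr_sp_inv (g : congr_sp) : congr_sp := CongrSp (congr_spV_mem g).

Lemma congr_sp_mulA : associative congr_sp_mul.
Proof. by move=> x y z; apply: val_inj; apply: mulmxA. Qed.
Lemma congr_sp_mul1 : left_id congr_sp_one congr_sp_mul.
Proof. by move=> x; apply: val_inj; apply: mul1mx. Qed.
Lemma congr_sp_mulr1 : right_id congr_sp_one congr_sp_mul.
Proof. by move=> x; apply: val_inj; apply: mulmx1. Qed.
Lemma congr_sp_mulV : left_inverse congr_sp_one congr_sp_inv congr_sp_mul.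
Proof. by move=> x; apply: val_inj; apply: congr_sp_invmxl. Qed.
Lemma congr_sp_mulrV : right_inverse congr_sp_one congr_sp_inv congr_sp_mul.
Proof. by move=> x; apply: val_inj; apply/mulmx1C/congr_sp_invmxl. Qed.
HB.instance Definition _ := isGroup.Build congr_sp congr_sp_mulA congr_sp_mul1
  congr_sp_mulr1 congr_sp_mulV congr_sp_mulrV.

(* The topology of [G] is the p-adic one: a subgroup is open iff it contains  *)
(* a principal congruence subgroup.                                           *)
Record open_normal := OpenNormal {
  on_set :> congr_sp -> Prop;
  on1 : on_set 1%g;
  onM : forall g h, on_set g -> on_set h -> on_set (g * h)%g;
  onV : forall g, on_set g -> on_set (g^-1)%g;
  onJ : forall g h, on_set g -> on_set (h^-1 * g * h)%g;
  on_open : exists k : nat, forall g : congr_sp, congr1_mx k g -> on_set g }.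

(* [g = exp (p x)]; the series is summed in M_2n(Q_p), for the topology given *)
(* by the lattice M_2n(Z_p).                                                  *)
Definition exp_mx (x g : M) : Prop :=
  @is_exp p (padic_num p_pr) (mx_alg (padic_num p_pr) (n + n))
    (fun X => exists Y : M, X = map_mx (@padic_to_num p p_pr) Y)
    (map_mx (@padic_to_num p p_pr) (p%:R *: x))
    (map_mx (@padic_to_num p p_pr) g).

End CongruenceGroup.

Section Main.
Variables (p : nat) (p_pr : prime p) (K : fieldExtType (padic_num p_pr)).
Variables (v : padic_valuation K) (n : nat).
Local Notation Zp := (padic_int p_pr).
Local Notation R := (valuation_ring v).
Local Notation G := (congr_sp p_pr n).

Definition ext_scalars (A : algebra R) : algebra K :=
  base_change (val : {rmorphism R -> K}) A.
Definition ext_in (A : algebra R) (x : A) : ext_scalars A :=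
  base_change_in (val : {rmorphism R -> K}) x.

Definition in_padic_ball (A : algebra R) (k : nat) (y : ext_scalars A) : Prop :=
  exists x : A, y = ext_in (p%:R ^+ k * x).

(* [R[G/N]] is [R[G]] modulo the ideal generated by the [g - 1], [g] in [N].  *)
Definition iwasawa_RG : algebra R :=
  ilim_alg (fun (N : open_normal p_pr n) (a : group_alg R G) =>
    exists2 g, N g & a = group_in R g - 1).
Definition iwasawa_alg : algebra K := ext_scalars iwasawa_RG.

Definition iwasawa_in (g : G) : iwasawa_alg :=
  ext_in (ilim_cst _ (group_in R g) : iwasawa_RG).

(* sp_2n(R) is sp_2n(Z_p) tensored with R over Z_p.                           *)
Definition U_R : algebra R := env_alg (@sp_bracket R n).
Definition U_R_hat : algebra R := padic_completion p U_R.
Definition affinoid_env : algebra K := ext_scalars U_R_hat.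

Lemma sp_base_change_mem (x : sp Zp n) :
  map_mx (padic_to_vring v) x \in @sp_mem R n.
Proof.
case: x => x /= /and3P[/eqP h1 /eqP h2 /eqP h3].
apply/and3P; split; apply/eqP/matrixP => i j.
- by move/matrixP/(_ i j): h1; rewrite !mxE => ->; rewrite rmorphN.
- by move/matrixP/(_ i j): h2; rewrite !mxE => ->.
- by move/matrixP/(_ i j): h3; rewrite !mxE => ->.
Qed.
Definition sp_base_change (x : sp Zp n) : sp R n := Sp (sp_base_change_mem x).

Definition affinoid_in (x : sp Zp n) : affinoid_env :=
  ext_in (ilim_cst _ (env_in (@sp_bracket R n) (sp_base_change x)) : U_R_hat).

Definition weyl_hat : algebra R := padic_completion p (weyl_alg R n).
Definition completed_weyl : algebra K := ext_scalars weyl_hat.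

Definition cweyl_X (i : 'I_n) : completed_weyl :=
  ext_in (ilim_cst _ (weyl_X R i) : weyl_hat).
Definition cweyl_D (i : 'I_n) : completed_weyl :=
  ext_in (ilim_cst _ (weyl_D R i) : weyl_hat).

(* The second field is continuity of the restriction to [RG], the inverse     *)
(* limit of the [R[G/N]] with their p-adic topologies.                        *)
Record is_iwasawa_embedding (iota : alg_hom iwasawa_alg affinoid_env) : Prop := {
  iwasawa_embedding_exp : forall (x : sp Zp n) (g : G), exp_mx x g ->
    is_exp p (@in_padic_ball U_R_hat 0) (p%:R * affinoid_in x)
      (iota (iwasawa_in g));
  iwasawa_embedding_continuous : forall k : nat,
    exists (j : nat) (N : open_normal p_pr n), forall s : iwasawa_RG,
      (exists t, ilim_val s N = p%:R ^+ j * t) ->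
      in_padic_ball k (iota (ext_in s)) }.

Definition metaplectic_formula (X : sp Zp n) : completed_weyl :=
  let c (a : Zp) := alg_in completed_weyl (padic_to_ext K a) in
  let half := alg_in completed_weyl 2%:R^-1 in
  let A := ulsubmx (sp_val X) in
  let B := ursubmx (sp_val X) in
  let C := dlsubmx (sp_val X) in
  - (half * c (\tr A))
  - (\sum_i \sum_j c (A i j) * (cweyl_X j * cweyl_D i))
  + half * (\sum_i \sum_j c (B i j) * (cweyl_D i * cweyl_D j))
  - half * (\sum_i \sum_j c (C i j) * (cweyl_X i * cweyl_X j)).

Record is_metaplectic (rho : alg_hom affinoid_env completed_weyl) : Prop := {
  metaplectic_lie : forall X : sp Zp n,
    rho (affinoid_in X) = metaplectic_formula X;
  metaplectic_continuous : forall k : nat, exists j : nat,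
    forall y, in_padic_ball j y -> in_padic_ball k (rho y) }.

End Main.

(* Main.v *)
(* Let phi be the composite. An element g = [[a, b], [c, d]] of G factors as    *)
(* lower unipotent * Levi * upper unipotent; applying the three exponentials to *)
(* e^(u.X) and evaluating at x gives                                            *)
(*   phi(g) e^(u.X) |_x = gamma(g) e^(q_g(x, u)),   gamma(g) = det(a)^(-1/2),   *)
(*   q_g(x, u) = x^T h^T u - x^T (c h) x / 2 + u^T (h b) u / 2,   h = a^(-1).   *)
(* If [s] in RG is in the kernel then, viewing [s] as a measure on G, all the   *)
(* integrals of gamma(g) q_g(x, u)^d against [s] vanish. Replacing (x, u) by    *)
(* (x0, u0) + t (x, u) with t small, and approximating the indicator function   *)
(* of a ball by polynomials in q_g, one sees that they still vanish after       *)
(* restriction to the set of g with q_g(x0, u0) in a given class mod p^k, and   *)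
(* then for any finite number of such constraints. Finitely many values of q_g  *)
(* mod p^k determine g mod p^k, so [s] is zero on each coset of each open       *)
(* normal subgroup.                                                             *)
Require Import Defs.
From HB Require Import structures.
From mathcomp Require Import all_boot all_order all_algebra all_field.
From mathcomp Require Import cyclic.
From mathcomp Require Import boolp functions finmap monalg mpoly.
From mathcomp Require Import ring lra zify.

Set Implicit Arguments.
Unset Strict Implicit.
Unset Printing Implicit Defensive.

Import Order.TTheory GRing.Theory Num.Theory.
Local Open Scope ring_scope.

(** * Universal properties of the algebras given by generators and relations *)

(** Acting on e^(u.x), the image of g has the symbol gamma(g) e^(q_g(x, u)), where gamma(g) is a
    unit and the quadratic form q_g remembers all of g. If s in RG is killed, then, s being seen as
    a measure on G, every moment of gamma(g) q_g(x, u)^d vanishes. This is [null_gauss]; it rests on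
    [weyl_approx], which computes the symbol from the factorization [bigcell]. Since e^(u.x) is not
    a polynomial, the symbol is read degree by degree: [theta] is (2d)! times the part of degree 2d,
    and the trinomial identity [theta_sumE] recognizes it as a power of q_g. [weyl_ext_ball] shows
    that R-valued functionals such as [theta] respect divisibility in the completed algebra.

    The moments at one point (x, u) only see the distribution of the single number q_g(x, u). The
    argument therefore localizes. The indicator function of a + p^k Z_p is a limit of polynomials
    with p-power denominators ([padic_indicator_poly]), so moments at (x0, u0) still vanish when
    restricted to the g with q_g(x0, u0) in a given class ([null_on_same]). To retain the moments at
    another point (x, u), one evaluates at (x0, u0) + t (x, u) with t divisible by p^k: the class
    does not change, and the d-th power is a polynomial in t with coefficient q_g(x, u)^d in degree
    2d. A polynomial in t that is null for t = p^k, p^(k+1), ... has null coefficients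
    ([null_poly]). This gives [null_restrict], which can be iterated over any finite set of points
    ([null_classes]).

    Finitely many points determine g modulo p^k ([gauss_points_congr]). On the resulting small
    classes gamma is constant modulo p^M and can be cancelled, so indicators of cosets have integral
    zero modulo every p^M ([kernel_coset_sum]), and s vanishes in every R[G/N] ([coset_sums_ideal],
    [kernel_integral]). The passage from RG to KG is a matter of clearing denominators. *)

Section FreeAlgebraEval.
Variables (S : comNzRingType) (X : choiceType) (A : algebra S) (h : X -> A).

Definition fev (g : free_alg S X) : A :=
  \sum_(k <- monalg.msupp g) alg_in A (monalg.mcoeff k g) * \prod_(x <- (k : seq X)) h x.

Lemma fevEw (d : {fset {fmonom X}}) (g : free_alg S X) : (monalg.msupp g `<=` d)%fset ->
  fev g = \sum_(k <- d) alg_in A (monalg.mcoeff k g) * \prod_(x <- (k : seq X)) h x.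
Proof.
move=> le; rewrite /fev [LHS](big_fset_incl _ le) => //= x xd /monalg.mcoeff_outdom ->.
by rewrite rmorph0 mul0r.
Qed.

Lemma fevU c (k : {fmonom X}) :
  fev (mkmalgU k c : free_alg S X) = alg_in A c * \prod_(x <- (k : seq X)) h x.
Proof. by rewrite (fevEw (d := [fset k]%fset)) ?monalg.msuppU_le // big_seq_fset1 monalg.mcoeffUU. Qed.

Lemma fev_zmod : zmod_morphism fev.
Proof.
move=> g1 g2.
rewrite (fevEw (d := (monalg.msupp g1 `|` monalg.msupp g2)%fset)) ?monalg.msuppB_le //.
rewrite (@fevEw (monalg.msupp g1 `|` monalg.msupp g2)%fset g1) ?fsubsetUl //.
rewrite (@fevEw (monalg.msupp g1 `|` monalg.msupp g2)%fset g2) ?fsubsetUr //.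
by rewrite -sumrB; apply/eq_bigr=> k _; rewrite monalg.mcoeffB rmorphB mulrBl.
Qed.
HB.instance Definition _ := GRing.isZmodMorphism.Build _ _ fev fev_zmod.

Lemma fev_gen x : fev (free_gen S x) = h x.
Proof. by rewrite fevU rmorph1 mul1r fmU big_seq1. Qed.

Lemma fev_in c : fev (alg_in (free_alg S X) c) = alg_in A c.
Proof. by rewrite fevU fm1 big_nil mulr1. Qed.

Lemma fev_monoid : monoid_morphism fev.
Proof.
split; first by rewrite -[1](rmorph1 (alg_in (free_alg S X))) fev_in rmorph1.
move=> g1 g2; rewrite [in LHS]malgME raddf_sum [in RHS]/fev mulr_suml.
apply: eq_bigr=> i _; rewrite raddf_sum mulr_sumr; apply: eq_bigr=> j _.
rewrite /= fevU fmM big_cat /= rmorphM /= -!mulrA; congr (_ * _).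
by rewrite !mulrA alg_comm.
Qed.
HB.instance Definition _ := GRing.isMonoidMorphism.Build _ _ fev fev_monoid.

End FreeAlgebraEval.

Lemma free_alg_ind (S : comNzRingType) (X : choiceType) (P : free_alg S X -> Prop) :
  P 0 -> (forall a b, P a -> P b -> P (a + b)) ->
  (forall c, P (alg_in _ c)) -> (forall x a, P a -> P (free_gen S x * a)) ->
  (forall c a, P a -> P (alg_in _ c * a)) ->
  forall a, P a.
Proof.
move=> P0 PD Pin Pgen Psc a; rewrite [a]monalgE.
apply: big_ind => // k _; set c := monalg.mcoeff k a.
have -> : (mkmalgU k c : free_alg S X) = alg_in (free_alg S X) c * mkmalgU k 1.
  by rewrite malgM_def fgmulUU mul1m mulr1.
apply: Psc; case: k @c => s _; elim: s => [|x s IHs].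
  have -> : (FMonom [::] : {fmonom X}) = mone by apply/eqP; rewrite fmP fm1.
  exact: Pin.
have -> : (FMonom (x :: s) : {fmonom X}) = (mmul (fmu x) (FMonom s)).
  by apply/eqP; rewrite fmP fmM fmU.
have -> : mkmalgU (mmul (fmu x) (FMonom s)) 1 = free_gen S x * mkmalgU (FMonom s) 1 :> free_alg S X.
  by rewrite [RHS]malgM_def fgmulUU mulr1.
exact: Pgen.
Qed.

Lemma quot_ind (A : pzRingType) (P : A -> Prop) (Q : quot P -> Prop) :
  (forall a, Q (qpi P a)) -> forall x, Q x.
Proof. by move=> h x; rewrite -[x]qpi_repr. Qed.

Section QuotientLift.
Variables (A B : pzRingType) (P : A -> Prop) (f : {rmorphism A -> B}).
Hypothesis fP : forall a, P a -> f a = 0.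

Lemma ideal_gen_ker a : ideal_gen P a -> f a = 0.
Proof.
elim=> [|b /fP//|b c _ hb _ hc|c b _ hb|b c _ hb]; first exact: rmorph0.
- by rewrite rmorphD hb hc addr0.
- by rewrite rmorphM hb mulr0.
- by rewrite rmorphM hb mul0r.
Qed.

Definition quot_lift (x : quot P) : B := f (generic_quotient.repr x).

Lemma quot_liftE a : quot_lift (qpi P a) = f a.
Proof.
apply/eqP; rewrite -subr_eq0 -rmorphB; apply/eqP/ideal_gen_ker.
by apply/qpi_eqP; rewrite qpi_repr.
Qed.

Lemma quot_lift_zmod : zmod_morphism quot_lift.
Proof.
elim/quot_ind=> a; elim/quot_ind=> b.
by rewrite -rmorphB !quot_liftE rmorphB.
Qed.
Lemma quot_lift_monoid : monoid_morphism quot_lift.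
Proof.
split; first by rewrite -[1](rmorph1 (qpi P)) quot_liftE rmorph1.
elim/quot_ind=> a; elim/quot_ind=> b.
by rewrite -rmorphM !quot_liftE rmorphM.
Qed.

End QuotientLift.

(** * Linear endomorphisms as an algebra over the scalars *)

Section Endomorphisms.
Variables (S : comNzRingType) (V : lmodType S).

Record endo := Endo { endo_fun :> V -> V; endo_linear : linear endo_fun }.

Lemma endoP (f g : endo) : (forall x, f x = g x) -> f = g.
Proof.
case: f g => [f hf] [g hg] /= h; have e : f = g by apply: functional_extensionality_dep.
by rewrite e in hf *; congr Endo; apply: Prop_irrelevance.
Qed.
HB.instance Definition _ := gen_eqMixin endo.
HB.instance Definition _ := gen_choiceMixin endo.

Lemma endo_is_linear (f : endo) : linear f. Proof. exact: endo_linear. Qed.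
HB.instance Definition _ (f : endo) := GRing.isLinear.Build S V V *:%R f (@endo_is_linear f).

Lemma endo0_linear : linear (fun _ : V => 0 : V).
Proof. by move=> c x y; rewrite scaler0 addr0. Qed.
Lemma endo1_linear : linear (id : V -> V).
Proof. by []. Qed.
Lemma endoN_linear (f : endo) : linear (fun x => - f x).
Proof. by move=> c x y; rewrite linearP opprD scalerN. Qed.
Lemma endoD_linear (f g : endo) : linear (fun x => f x + g x).
Proof. by move=> c x y; rewrite !linearP scalerDr addrACA. Qed.
Lemma endoM_linear (f g : endo) : linear (fun x => f (g x)).
Proof. by move=> c x y; rewrite !linearP. Qed.

Lemma endo_addA : associative (fun f g => Endo (endoD_linear f g)).
Proof. by move=> f g h; apply: endoP => x /=; rewrite addrA. Qed.
Lemma endo_addC : commutative (fun f g => Endo (endoD_linear f g)).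
Proof. by move=> f g; apply: endoP => x /=; rewrite addrC. Qed.
Lemma endo_add0 : left_id (Endo endo0_linear) (fun f g => Endo (endoD_linear f g)).
Proof. by move=> f; apply: endoP => x /=; rewrite add0r. Qed.
Lemma endo_addN : left_inverse (Endo endo0_linear) (fun f => Endo (endoN_linear f))
  (fun f g => Endo (endoD_linear f g)).
Proof. by move=> f; apply: endoP => x /=; rewrite addNr. Qed.
HB.instance Definition _ :=
  GRing.isZmodule.Build endo endo_addA endo_addC endo_add0 endo_addN.

Lemma endo_mulA : associative (fun f g => Endo (endoM_linear f g)).
Proof. by move=> f g h; apply: endoP. Qed.
Lemma endo_mul1 : left_id (Endo endo1_linear) (fun f g => Endo (endoM_linear f g)).
Proof. by move=> f; apply: endoP. Qed.
Lemma endo_mulr1 : right_id (Endo endo1_linear) (fun f g => Endo (endoM_linear f g)).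
Proof. by move=> f; apply: endoP. Qed.
Lemma endo_mulDl : left_distributive (fun f g => Endo (endoM_linear f g)) +%R.
Proof. by move=> f g h; apply: endoP. Qed.
Lemma endo_mulDr : right_distributive (fun f g => Endo (endoM_linear f g)) +%R.
Proof. by move=> f g h; apply: endoP => x /=; rewrite raddfD. Qed.
HB.instance Definition _ := GRing.Zmodule_isPzRing.Build endo
  endo_mulA endo_mul1 endo_mulr1 endo_mulDl endo_mulDr.

Lemma endo_addE (f g : endo) x : (f + g) x = f x + g x. Proof. by []. Qed.
Lemma endo_oppE (f : endo) x : (- f) x = - f x. Proof. by []. Qed.
Lemma endo_mulE (f g : endo) x : (f * g) x = f (g x). Proof. by []. Qed.
Lemma endo_oneE x : (1 : endo) x = x. Proof. by []. Qed.
Lemma endo_sumE I (r : seq I) (Q : pred I) (F : I -> endo) x :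
  (\sum_(i <- r | Q i) F i) x = \sum_(i <- r | Q i) F i x.
Proof. exact: (big_morph (fun f : endo => f x)). Qed.

Lemma scale_linear (c : S) : linear (fun x : V => c *: x).
Proof. by move=> d x y; rewrite scalerDr !scalerA mulrC. Qed.
Definition endo_scale c := Endo (scale_linear c).
Lemma endo_scale_zmod : zmod_morphism endo_scale.
Proof. by move=> c d; apply: endoP => x /=; rewrite scalerBl. Qed.
Lemma endo_scale_monoid : monoid_morphism endo_scale.
Proof.
split; first by apply: endoP => x /=; rewrite scale1r.
by move=> c d; apply: endoP => x /=; rewrite scalerA.
Qed.
HB.instance Definition _ := GRing.isZmodMorphism.Build _ _ endo_scale endo_scale_zmod.
HB.instance Definition _ := GRing.isMonoidMorphism.Build _ _ endo_scale endo_scale_monoid.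
Lemma endo_scale_comm c (f : endo) : endo_scale c * f = f * endo_scale c.
Proof. by apply: endoP => x /=; rewrite linearZ. Qed.
Definition endo_alg : algebra S := MkAlgebra endo_scale_comm.

End Endomorphisms.

Lemma prod_free_gen (S : comNzRingType) (X : choiceType) (k : {fmonom X}) :
  \prod_(x <- (k : seq X)) free_gen S x = mkmalgU k 1 :> free_alg S X.
Proof.
case: k => s; elim: s => [|x s IHs] /=.
  rewrite big_nil; have -> : (FMonom [::] : {fmonom X}) = mone by apply/eqP; rewrite fmP fm1.
  by [].
have -> : (FMonom (x :: s) : {fmonom X}) = (mmul (fmu x) (FMonom s)).
  by apply/eqP; rewrite fmP fmM fmU.
by rewrite big_cons IHs [LHS]malgM_def fgmulUU mulr1.
Qed.

(** * Extension of scalars: denominators and p-power torsion *)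

Section BaseChangeTheory.
Variables (S : comNzRingType) (K : fieldType) (f : {rmorphism S -> K}) (A : algebra S).
Local Notation BC := (base_change f A).
Local Notation bc := (@base_change_in S K f A).

Lemma base_change_inD x y : bc (x + y) = bc x + bc y.
Proof.
rewrite /base_change_in -rmorphD /=; apply/qpi_eqP/ideal_gen_in.
exact: base_changeD.
Qed.
Lemma base_change_in_zmod : zmod_morphism bc.
Proof. by move=> x y; apply: (addIr (bc y)); rewrite -base_change_inD !addrNK. Qed.
HB.instance Definition _ := GRing.isZmodMorphism.Build _ _ bc base_change_in_zmod.

Lemma base_change_in_scalar c : bc (alg_in A c) = alg_in BC (f c).
Proof. by apply/qpi_eqP/ideal_gen_in; apply: base_change_scalar. Qed.

Lemma base_change_in_monoid : monoid_morphism bc.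
Proof.
split; first by rewrite -[1](rmorph1 (alg_in A)) base_change_in_scalar !rmorph1.
move=> x y; rewrite /base_change_in -rmorphM /=; apply/qpi_eqP/ideal_gen_in.
exact: base_changeM.
Qed.
HB.instance Definition _ := GRing.isMonoidMorphism.Build _ _ bc base_change_in_monoid.

Lemma res_alg_comm (B : algebra K) c (x : B) : (alg_in B \o f) c * x = x * (alg_in B \o f) c.
Proof. exact: alg_comm. Qed.
(** Restriction of scalars, so that evaluation of the free algebra over [S] can take values in a
    [K]-algebra. *)
Definition res_alg (B : algebra K) : algebra S := MkAlgebra (res_alg_comm (B := B)).

Variable p : nat.
Hypothesis p_neq0 : (p%:R : K) != 0.
Hypothesis f_inj : injective f.
Hypothesis f_den : forall x : K, exists N s, x *+ p ^ N = f s.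

Lemma base_change_tf (y : BC) N : y *+ p ^ N = 0 -> y = 0.
Proof.
move=> y0; have: alg_in BC (p%:R ^+ N)^-1 * (y *+ p ^ N) = 0 by rewrite y0 mulr0.
rewrite -[y *+ _]mulr_natr mulrA alg_comm -mulrA.
have -> : (p ^ N)%:R = alg_in BC (p%:R ^+ N) by rewrite rmorphXn rmorph_nat natrX.
by rewrite -rmorphM mulVf ?expf_neq0 // rmorph1 mulr1.
Qed.

Lemma base_change_den (y : BC) : exists N s, y *+ p ^ N = bc s.
Proof.
elim/quot_ind: y; apply: free_alg_ind => [|a b [N1 [s1 e1]] [N2 [s2 e2]]|c|x a [N [s e]]|c a [N [s e]]].
- by exists 0%N, 0; rewrite !rmorph0 mul0rn.
- exists (N1 + N2)%N, (s1 *+ p ^ N2 + s2 *+ p ^ N1).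
  by rewrite !rmorphD mulrnDl !rmorphMn /= -e1 -e2 -!mulrnA -!expnD [(N2 + _)%N]addnC.
- have [N [s e]] := f_den c; exists N, (alg_in A s).
  by rewrite base_change_in_scalar -e rmorphMn.
- by exists N, (x * s); rewrite !rmorphM /= -mulrnAr e.
- have [N' [s' e']] := f_den c; exists (N' + N)%N, (alg_in A s' * s).
  rewrite !rmorphM /= base_change_in_scalar -e -e' rmorphMn.
  by rewrite mulrnAl mulrnAr -mulrnA -expnD addnC.
Qed.

(** Coefficientwise extension of scalars between free algebras. It is injective because [f] is,
    which allows elements over [K] to be compared with elements over [S]. *)
Let fmap : {rmorphism free_alg S A -> free_alg K A} :=
  (@fev S A (res_alg (free_alg K A)) (free_gen K) : {rmorphism _ -> res_alg (free_alg K A)}).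
Let fmap_gen x : fmap (free_gen S x) = free_gen K x.
Proof. exact: (@fev_gen S A (res_alg (free_alg K A)) (free_gen K)). Qed.
Let fmap_in c : fmap (alg_in _ c) = alg_in _ (f c).
Proof. exact: (@fev_in S A (res_alg (free_alg K A)) (free_gen K)). Qed.

Let mcoeff_fmap k (h : free_alg S A) : monalg.mcoeff k (fmap h) = f (monalg.mcoeff k h).
Proof.
rewrite [h in RHS]monalgE /fmap /fev !raddf_sum; apply: eq_bigr => k' _ /=.
rewrite prod_free_gen malgM_def fgmulUU mul1m mulr1 !monalg.mcoeffU.
by rewrite rmorphMn.
Qed.

Let ev : {rmorphism free_alg S A -> A} := @fev S A A id.
Let ev_gen x : ev (free_gen S x) = x. Proof. exact: fev_gen. Qed.
Let ev_in c : ev (alg_in _ c) = alg_in _ c. Proof. exact: fev_in. Qed.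

Let fmap_den (c : free_alg K A) : exists N h, c *+ p ^ N = fmap h.
Proof.
move: c; apply: free_alg_ind => [|a b [N1 [s1 e1]] [N2 [s2 e2]]|c|x a [N [s e]]|c a [N [s e]]].
- by exists 0%N, 0; rewrite !rmorph0 mul0rn.
- exists (N1 + N2)%N, (s1 *+ p ^ N2 + s2 *+ p ^ N1).
  rewrite !rmorphD mulrnDl !rmorphMn .
  by rewrite -e1 -e2 -!mulrnA -!expnD [(N2 + _)%N]addnC.
- have [N [s e]] := f_den c; exists N, (alg_in _ s).
  by rewrite fmap_in /= -e -raddfMn.
- exists N, (free_gen S x * s); rewrite rmorphM fmap_gen -e.
  by rewrite -mulrnAr.
- have [N' [s' e']] := f_den c; exists (N' + N)%N, (alg_in _ s' * s).
  rewrite rmorphM fmap_in -e /= -e' [mkmalgU _ (_ *+ _)]raddfMn.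
  by rewrite mulrnAl mulrnAr -mulrnA -expnD addnC.
Qed.

(** After multiplication by a power of [p], every element of the relation ideal over [K] is [fmap h]
    for some [h] whose value in [A] is p-power torsion; this property passes through all the ideal
    operations. When the element is the generator attached to [x], injectivity of [fmap] forces [h]
    to be a multiple of that generator. *)
Lemma base_change_in_eq0 x : bc x = 0 -> exists N, x *+ p ^ N = 0.
Proof.
rewrite -[0](rmorph0 (qpi (base_change_rel f (A := A)))) => /qpi_eqP; rewrite subr0.
suff H a : ideal_gen (base_change_rel f (A := A)) a ->
    exists N h, a *+ p ^ N = fmap h /\ ev h *+ p ^ N = 0.
  case/H=> N [h [e1 e2]]; exists (N + N)%N; rewrite expnD mulrnA -e2; congr (_ *+ _).
  suff -> : h = free_gen S x *+ p ^ N by rewrite rmorphMn /= ev_gen.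
  apply/malgP => k; apply: f_inj; rewrite -mcoeff_fmap -e1 !monalg.mcoeffMn !monalg.mcoeffU.
  by rewrite !rmorphMn rmorph1.
elim=> [|b r|b c _ [N1 [s1 [e1 z1]]] _ [N2 [s2 [e2 z2]]]|c b _ [N [s [e z]]]|b c _ [N [s [e z]]]].
- by exists 0%N, 0; rewrite !rmorph0 mul0rn.
- exists 0%N; rewrite expn0 mulr1n; case: r => [u v|u v|c].
  + exists (free_gen S (u + v) - (free_gen S u + free_gen S v)).
    by rewrite !(rmorphB, rmorphD) !fmap_gen !ev_gen subrr.
  + exists (free_gen S (u * v) - free_gen S u * free_gen S v).
    by rewrite !(rmorphB, rmorphM) !fmap_gen !ev_gen subrr.
  + exists (free_gen S (alg_in A c) - alg_in (free_alg S A) c).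
    split; first by rewrite rmorphB fmap_gen fmap_in.
    by rewrite rmorphB ev_gen ev_in subrr.
- exists (N1 + N2)%N, (s1 *+ p ^ N2 + s2 *+ p ^ N1); split.
    rewrite !rmorphD mulrnDl !rmorphMn .
    by rewrite -e1 -e2 -!mulrnA -!expnD [(N2 + _)%N]addnC.
  rewrite rmorphD !rmorphMn mulrnDl -!mulrnA expnD.
  have -> : (p ^ N2 * (p ^ N1 * p ^ N2) = p ^ N1 * (p ^ N2 * p ^ N2))%N by lia.
  have -> : (p ^ N1 * (p ^ N1 * p ^ N2) = p ^ N2 * (p ^ N1 * p ^ N1))%N by lia.
  by rewrite [X in X + _]mulrnA [X in _ + X]mulrnA z1 z2 !mul0rn addr0.
- have [N' [h e']] := fmap_den c; exists (N' + N)%N, (h * s); split.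
    rewrite rmorphM -e' -e.
    by rewrite mulrnAl mulrnAr -mulrnA -expnD addnC.
  by rewrite rmorphM addnC expnD mulrnA -mulrnAr z mulr0 mul0rn.
- have [N' [h e']] := fmap_den c; exists (N + N')%N, (s * h); split.
    rewrite rmorphM -e' -e.
    by rewrite mulrnAr mulrnAl -mulrnA -expnD addnC.
  by rewrite rmorphM expnD mulrnA -mulrnAl z mul0r mul0rn.
Qed.

End BaseChangeTheory.

(** * Divisibility by powers of p and the exponential series *)

Section PowerDivisibility.
Variable p : nat.

(** Multiples are taken with [*+], so that the relation applies alike to scalars, matrices,
    polynomials and noncommutative algebras. *)
Definition pdvd (V : zmodType) (k : nat) (x : V) : Prop := exists y, x = y *+ p ^ k.

Section Zmodules.
Variable V : zmodType.
Implicit Types x y : V.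

Lemma pdvd0 k : pdvd k (0 : V). Proof. by exists 0; rewrite mul0rn. Qed.
Lemma pdvd00 x : pdvd 0 x. Proof. by exists x; rewrite expn0. Qed.
Lemma pdvdD k x y : pdvd k x -> pdvd k y -> pdvd k (x + y).
Proof. by move=> [a ->] [b ->]; exists (a + b); rewrite mulrnDl. Qed.
Lemma pdvdN k x : pdvd k x -> pdvd k (- x).
Proof. by move=> [a ->]; exists (- a); rewrite mulNrn. Qed.
Lemma pdvdB k x y : pdvd k x -> pdvd k y -> pdvd k (x - y).
Proof. by move=> hx hy; apply/pdvdD/pdvdN. Qed.
Lemma pdvdBC k x y : pdvd k (x - y) -> pdvd k (y - x).
Proof. by move=> /pdvdN; rewrite opprB. Qed.
Lemma pdvd_trans k x y z : pdvd k (x - y) -> pdvd k (y - z) -> pdvd k (x - z).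
Proof. by move=> h1 h2; have := pdvdD h1 h2; rewrite addrA addrNK. Qed.
Lemma pdvdW k l x : (l <= k)%N -> pdvd k x -> pdvd l x.
Proof.
move=> lk [a ->]; exists (a *+ p ^ (k - l)).
by rewrite -mulrnA -expnD subnK.
Qed.
Lemma pdvd_muln k l x : pdvd k x -> pdvd (k + l) (x *+ p ^ l).
Proof. by move=> [a ->]; exists a; rewrite -mulrnA expnD. Qed.
Lemma pdvd_sum k I (r : seq I) (P : pred I) (F : I -> V) :
  (forall i, P i -> pdvd k (F i)) -> pdvd k (\sum_(i <- r | P i) F i).
Proof. by move=> h; apply: big_ind => //; [apply: pdvd0 | move=> x y; apply: pdvdD]. Qed.
Lemma pdvd_transr k x y : pdvd k (x - y) -> pdvd k y -> pdvd k x.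
Proof. by move=> h1 h2; have := pdvdD h1 h2; rewrite addrNK. Qed.
End Zmodules.

Lemma pdvd_additive (V W : zmodType) (f : {additive V -> W}) k x :
  pdvd k x -> pdvd k (f x).
Proof. by move=> [a ->]; exists (f a); rewrite raddfMn. Qed.

Section Rings.
Variable A : pzRingType.
Implicit Types x y : A.

Lemma pdvdMl k x y : pdvd k x -> pdvd k (y * x).
Proof. by move=> [a ->]; exists (y * a); rewrite mulrnAr. Qed.
Lemma pdvdMr k x y : pdvd k x -> pdvd k (x * y).
Proof. by move=> [a ->]; exists (a * y); rewrite mulrnAl. Qed.
Lemma pdvdM k l x y : pdvd k x -> pdvd l y -> pdvd (k + l) (x * y).
Proof.
by move=> [a ->] [b ->]; exists (a * b); rewrite mulrnAl mulrnAr -mulrnA expnD mulnC.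
Qed.
Lemma pdvd_subM k x x' y y' :
  pdvd k (x - x') -> pdvd k (y - y') -> pdvd k (x * y - x' * y').
Proof.
move=> h1 h2; apply: (@pdvd_trans _ _ _ (x' * y)).
  by rewrite -mulrBl; apply: pdvdMr.
by rewrite -mulrBr; apply: pdvdMl.
Qed.
Lemma pdvd_subX k x y j : pdvd k (x - y) -> pdvd k (x ^+ j - y ^+ j).
Proof.
move=> h; elim: j => [|j IHj]; first by rewrite subrr; apply: pdvd0.
by rewrite !exprS; apply: pdvd_subM.
Qed.
Lemma pdvd_natX k : pdvd k ((p ^ k)%:R : A).
Proof. by exists 1. Qed.
Lemma pdvdX k x j : pdvd k x -> pdvd (k * j) (x ^+ j).
Proof.
move=> h; elim: j => [|j IHj]; first by rewrite muln0; apply: pdvd00.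
by rewrite mulnS exprS; apply: pdvdM.
Qed.

Lemma padic_idealE k x : ideal_gen (padic_ideal p A k) x <-> pdvd k x.
Proof.
split=> [|[y ->]].
  elim=> [|b ->|b c _ hb _ hc|c b _ hb|b c _ hb].
  - exact: pdvd0.
  - by rewrite -natrX; apply: pdvd_natX.
  - exact: pdvdD.
  - exact: pdvdMl.
  - exact: pdvdMr.
by rewrite -mulr_natr; apply/ideal_genMl/ideal_gen_in; rewrite /padic_ideal natrX.
Qed.

Definition tends (u : nat -> A) (l : A) : Prop :=
  forall k, exists m0, forall m, (m0 <= m)%N -> pdvd k (u m - l).

Lemma tends_unique u l l' : (forall x : A, (forall k, pdvd k x) -> x = 0) ->
  tends u l -> tends u l' -> l = l'.
Proof.
move=> sep h h'; apply/eqP; rewrite -subr_eq0; apply/eqP/sep => k.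
have [m hm] := h k; have [m' hm'] := h' k.
apply: (@pdvd_trans _ _ _ (u (maxn m m'))).
  by apply/pdvdBC/hm; rewrite leq_maxl.
by apply: hm'; rewrite leq_maxr.
Qed.

Lemma tends_ext u v l : (forall m, u m = v m) -> tends u l -> tends v l.
Proof. by move=> e h k; have [m hm] := h k; exists m => i /hm; rewrite e. Qed.

Lemma tendsM u v l l' : tends u l -> tends v l' -> tends (fun m => u m * v m) (l * l').
Proof.
move=> h h' k; have [m hm] := h k; have [m' hm'] := h' k.
exists (maxn m m') => i; rewrite geq_max => /andP[/hm a /hm' b].
exact: pdvd_subM.
Qed.

Lemma tends_cst l : tends (fun=> l) l.
Proof. by move=> k; exists 0%N => m _; rewrite subrr; apply: pdvd0. Qed.

(* A sequence behaving like [p^j / j!] for an odd prime [p]. *)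
Record dpow (e : nat -> A) : Prop := Dpow {
  dpow_comm : forall j x, e j * x = x * e j;
  dpow0 : e 0%N = 1;
  dpow1 : e 1%N = p%:R;
  dpowM : forall i j, e i * e j = e (i + j)%N *+ 'C(i + j, i);
  dpow_dvd : forall j, (0 < j)%N -> pdvd (j./2).+1 (e j) }.

Definition exps (e u : nat -> A) (m : nat) : A := \sum_(j < m) e j * u j.

Lemma dpow_uphalf e j : dpow e -> pdvd (uphalf j) (e j).
Proof.
move=> he; case: j => [|j]; first exact: pdvd00.
by apply: pdvdW (dpow_dvd he (ltn0Sn j)); rewrite uphalfE; lia.
Qed.

Lemma exps_cauchy e u m m' : dpow e -> (m <= m')%N ->
  pdvd (uphalf m) (exps e u m' - exps e u m).
Proof.
move=> he le; rewrite /exps -(subnKC le) big_split_ord /= addrAC subrr add0r.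
apply: pdvd_sum => i _; apply/pdvdMr/(pdvdW _ (dpow_uphalf _ he)).
by rewrite /=; lia.
Qed.

Lemma triangular_sum (F : nat -> nat -> A) m :
  \sum_(i < m) \sum_(j < m - i) F i j = \sum_(k < m) \sum_(i < k.+1) F i (k - i)%N.
Proof.
elim: m => [|m IHm]; first by rewrite !big_ord0.
rewrite [RHS]big_ord_recr /= -IHm [LHS]big_ord_recr [X in _ = _ + X]big_ord_recr /=.
rewrite subSnn big_ord1 subnn addrA; congr (_ + _).
rewrite -big_split /=; apply: eq_bigr => i _.
by rewrite subSn ?big_ord_recr //= ltnW.
Qed.

(** Both sides sum [e i * e j * (u i * v j)], one over a square and the other over the triangle i +
    j < m. Where they differ, i + j >= m, so [e i * e j] is divisible by p^(ceil(m/2)). The binomial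
    convolution covers powers of a sum of commuting elements as well as iterated Leibniz rules. *)
Lemma exps_mul (e u v w : nat -> A) m : dpow e ->
  (forall k, w k = \sum_(i < k.+1) u i * v (k - i)%N *+ 'C(k, i)) ->
  pdvd (uphalf m) (exps e u m * exps e v m - exps e w m).
Proof.
move=> he hw; pose F i j := e i * u i * (e j * v j).
have FE i j : F i j = e i * e j * (u i * v j).
  by rewrite /F -!mulrA [u i * (e j * _)]mulrA -(dpow_comm he) !mulrA.
have -> : exps e w m = \sum_(i < m) \sum_(j < m - i) F i j.
  rewrite triangular_sum; apply: eq_bigr => k _; rewrite hw mulr_sumr.
  apply: eq_bigr => i _; rewrite /F.
  have ik : (i <= k)%N by rewrite -ltnS.
  rewrite -/(F i (k - i)%N) FE (dpowM he) subnKC // mulrnAl mulrnAr.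
  by [].
rewrite /exps mulr_suml -sumrB; apply: pdvd_sum => i _.
rewrite mulr_sumr -(big_mkord xpredT (F i)) -(big_mkord xpredT (F i)).
rewrite (big_cat_nat _ (n := (m - i)%N)) ?leq_subr //= addrAC subrr add0r.
rewrite big_nat; apply: pdvd_sum => j /andP[j1 j2]; rewrite FE.
apply/pdvdMr/(pdvdW _ (pdvdM (dpow_uphalf i he) (dpow_uphalf j he))).
by rewrite !uphalfE; lia.
Qed.

Lemma exps_tendsM (e u v w : nat -> A) a b : dpow e ->
  (forall k, w k = \sum_(i < k.+1) u i * v (k - i)%N *+ 'C(k, i)) ->
  tends (exps e u) a -> tends (exps e v) b -> tends (exps e w) (a * b).
Proof.
move=> he hw ha hb k; have [m hm] := tendsM ha hb k.
exists (maxn m k.*2) => i; rewrite geq_max => /andP[/hm h ik].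
apply: pdvd_trans h; apply/pdvdBC/(pdvdW _ (exps_mul i he hw)).
by rewrite uphalfE; lia.
Qed.

Lemma exps_expM e (x y : A) a b : dpow e -> x * y = y * x ->
  tends (exps e (fun j => x ^+ j)) a -> tends (exps e (fun j => y ^+ j)) b ->
  tends (exps e (fun j => (x + y) ^+ j)) (a * b).
Proof.
move=> he xy; apply: exps_tendsM => // k; rewrite exprDn_comm; last first.
  exact: commr_sym.
rewrite (reindex_inj rev_ord_inj) /=; apply: eq_bigr => i _.
by rewrite subSS subKn ?bin_sub // -ltnS.
Qed.

Lemma exps_sq0 e (x : A) : dpow e -> x * x = 0 ->
  tends (exps e (fun j => x ^+ j)) (1 + x *+ p).
Proof.
move=> he x2 k; exists 2%N => -[|[|m]] // _; rewrite /exps !big_ord_recl big1 => [|i _].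
  rewrite (dpow0 he) (dpow1 he) expr0 expr1 !mul1r addr0 mulr_natl subrr.
  exact: pdvd0.
by rewrite !lift0 !exprS [x * (x * _)]mulrA x2 mul0r mulr0.
Qed.

(* The terms beyond the linear one only contribute multiples of [p ^ 2]. *)
Lemma exps_sub e x y a b r : dpow e -> pdvd r (x - y) ->
  tends (exps e (fun j => x ^+ j)) a -> tends (exps e (fun j => y ^+ j)) b ->
  pdvd (r + 2) ((a - b) - (x - y) *+ p).
Proof.
move=> he xy ha hb; have [m hm] := ha (r + 2)%N; have [m' hm'] := hb (r + 2)%N.
pose N := (maxn m m').+2.
have {}hm := hm N (leqW (leqW (leq_maxl m m'))).
have {}hm' := hm' N (leqW (leqW (leq_maxr m m'))).
apply: (@pdvd_trans _ _ _ (exps e (fun j => x ^+ j) N - exps e (fun j => y ^+ j) N)).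
  have := pdvdB hm' hm.
  by rewrite !opprB addrACA [X in _ -> pdvd _ X]addrACA [in X in _ -> pdvd _ X](addrC a).
rewrite /exps -sumrB !big_ord_recl (dpow0 he) (dpow1 he) !expr0 subrr add0r !expr1.
rewrite -mulrBr mulr_natl addrAC subrr add0r; apply: pdvd_sum => i _.
rewrite -mulrBr addnC; apply: pdvdM; last exact: pdvd_subX.
by apply: pdvdW (dpow_dvd he _).
Qed.

End Rings.

Lemma tends_morph (A B : pzRingType) (f : {rmorphism A -> B}) u l :
  tends u l -> tends (fun m => f (u m)) (f l).
Proof.
move=> h k; have [m0 hm] := h k; exists m0 => m /hm.
by rewrite -rmorphB => /pdvd_additive; apply.
Qed.

Lemma rmorph_exps (A B : pzRingType) (f : {rmorphism A -> B}) (e : nat -> A) u m :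
  f (exps e u m) = exps (fun j => f (e j)) (fun j => f (u j)) m.
Proof. by rewrite /exps rmorph_sum; apply: eq_bigr => j _; rewrite rmorphM. Qed.

Lemma dpow_alg (S : pzRingType) (B : algebra S) (e : nat -> S) :
  dpow e -> dpow (fun j => alg_in B (e j)).
Proof.
move=> he; split=> [j x||||].
- exact: alg_comm.
- by rewrite (dpow0 he) rmorph1.
- by rewrite (dpow1 he) rmorph_nat.
- by move=> i j; rewrite -rmorphM (dpowM he) rmorphMn.
- by move=> j j0; apply/pdvd_additive/(dpow_dvd he).
Qed.

End PowerDivisibility.

(** * Exponential and logarithm in a complete torsion-free ring *)

Section CompleteRings.
Variables (p : nat) (A : pzRingType).
Local Notation pdvd := (@pdvd p _).

Definition psep := forall x : A, (forall k, pdvd k x) -> x = 0.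
Definition ptf := forall (x : A), x *+ p = 0 -> x = 0.
Definition pcomplete := forall u : nat -> A,
  (forall m, pdvd m (u m.+1 - u m)) -> exists l, forall m, pdvd m (u m - l).

Lemma ptf_inj (x y : A) : ptf -> x *+ p = y *+ p -> x = y.
Proof.
by move=> tf h; apply/eqP; rewrite -subr_eq0; apply/eqP/tf; rewrite mulrnBl h subrr.
Qed.

Lemma ptf_pdvd k (x : A) : ptf -> pdvd k.+1 (x *+ p) -> pdvd k x.
Proof. by move=> tf [y h]; exists y; apply: ptf_inj => //; rewrite h expnSr mulrnA. Qed.

Hypotheses (sep : psep) (tf : ptf) (compl : pcomplete).
Variable e : nat -> A.
Hypothesis he : dpow p e.
Local Notation tends := (@tends p A).

Lemma exps_cvg (u : nat -> A) : exists l, tends (exps e u) l.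
Proof.
(* The bound on the tails grows like half the index, so the partial sums are sampled at even
   indices. *)
have [|l hl] := @compl (fun m => exps e u m.*2).
  move=> m; apply: pdvdW (exps_cauchy u he (_ : (m.*2 <= m.+1.*2)%N)) => //.
    by rewrite uphalf_double.
  by rewrite leq_double.
exists l => k; exists k.*2 => m km; apply: pdvd_trans (hl k).
by apply: pdvdW (exps_cauchy u he km); rewrite uphalf_double.
Qed.

(** With [e j] in the role of p^j / j!, this is e^(p x), defined on the whole ring. *)
Definition pexp (x : A) : A := projT1 (cid (exps_cvg (fun j => x ^+ j))).
Lemma pexpP x : tends (exps e (fun j => x ^+ j)) (pexp x).
Proof. exact: projT2 (cid (exps_cvg (fun j => x ^+ j))). Qed.

Lemma pexp_unique x l : tends (exps e (fun j => x ^+ j)) l -> pexp x = l.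
Proof. by move=> h; apply: tends_unique (pexpP x) h. Qed.

Lemma pexp_sub r x y : pdvd r (x - y) -> pdvd (r + 2) ((pexp x - pexp y) - (x - y) *+ p).
Proof. by move=> h; apply: exps_sub he h (pexpP x) (pexpP y). Qed.

Lemma pexp_cont r x y : pdvd r (x - y) -> pdvd r.+1 (pexp x - pexp y).
Proof.
move=> h; apply: (pdvd_transr (y := (x - y) *+ p)).
  by apply: pdvdW (pexp_sub h); rewrite addn2.
by have := @pdvd_muln p _ r 1 _ h; rewrite addn1 expn1.
Qed.

(** Induction on the precision r: modulo p^(r+2) the difference of the exponentials is p (x - y), so
    its divisibility passes to p (x - y), and p cancels. *)
Lemma pexp_cont_inv k x y : pdvd k.+1 (pexp x - pexp y) -> pdvd k (x - y).
Proof.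
move=> h; suff H r : (r <= k)%N -> pdvd r (x - y) by exact: H.
elim: r => [|r IHr] rk; first exact: pdvd00.
apply: ptf_pdvd => //; have h2 := pexp_sub (IHr (ltnW rk)).
apply: (pdvd_transr (y := pexp x - pexp y)); last by apply: pdvdW h.
by rewrite addn2 in h2; apply: pdvdBC.
Qed.

Lemma pexp0 : pexp 0 = 1.
Proof.
by apply: pexp_unique; have := exps_sq0 he (mul0r 0); rewrite mul0rn addr0.
Qed.

Lemma pexpD x y : x * y = y * x -> pexp (x + y) = pexp x * pexp y.
Proof.
by move=> xy; apply: pexp_unique; apply: exps_expM he xy (pexpP x) (pexpP y).
Qed.

Lemma pexpN x : pexp x * pexp (- x) = 1.
Proof. by rewrite -pexpD ?subrr ?pexp0 // mulrN mulNr. Qed.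

(* Newton iteration: an error [p ^ k.+1 y] is removed by adding [p ^ k y]. *)
Lemma pexp_surj x0 : exists x, pexp x = 1 + x0 *+ p.
Proof.
set a := 1 + _.
(* The error divided by p^(k+1). The default 0 is never met along the iteration, by [inv]. *)
pose D k x : A := if pselect (exists y, a - pexp x = y *+ p ^ k.+1) is left h
  then projT1 (cid h) else 0.
pose fix X k : A := if k is k'.+1 then X k' + D k' (X k') *+ p ^ k' else 0.
have inv k : pdvd k.+1 (a - pexp (X k)).
  elim: k => [|k IHk]; first by rewrite /= pexp0 /a addrC addKr; exists x0.
  have DE : a - pexp (X k) = D k (X k) *+ p ^ k.+1.
    by rewrite /D; case: pselect => [h|//]; case: (cid h).
  have hd : pdvd k (X k.+1 - X k) by exists (D k (X k)); rewrite /= addrC addKr.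
  have h2 := pexp_sub hd.
  have -> : a - pexp (X k.+1) = - (pexp (X k.+1) - pexp (X k) - (X k.+1 - X k) *+ p).
    rewrite [X k.+1 - _]addrC addKr -mulrnA -expnSr -DE.
    by rewrite !opprB addrA addrNK.
  by apply: pdvdN; rewrite addn2 in h2.
have [|x hx] := @compl X; first by move=> m; exists (D m (X m)); rewrite /= addrC addKr.
exists x; apply/eqP; rewrite -subr_eq0; apply/eqP/sep => k.
apply: (@pdvd_trans p _ k _ (pexp (X k))).
  by apply: pdvdW (pexp_cont (pdvdBC (hx k))).
by apply/pdvdBC/(pdvdW _ (inv k)).
Qed.

(** The inverse is the geometric series in [1 - x]. *)
Lemma pone_unit (x : A) : pdvd 1 (x - 1) -> exists y, x * y = 1.
Proof.
move=> h; have hz : pdvd 1 (1 - x) by apply: pdvdBC.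
have [|y hy] := @compl (fun m => \sum_(j < m) (1 - x) ^+ j).
  move=> m; rewrite big_ord_recr /= addrAC subrr add0r.
  by have := pdvdX m hz; rewrite mul1n.
exists y; apply/eqP; rewrite -subr_eq0; apply/eqP/sep => k.
apply: (@pdvd_trans p _ k _ (x * \sum_(j < k) (1 - x) ^+ j)).
  by rewrite -mulrBr; apply/pdvdMl/pdvdBC.
have := pdvdX k hz; rewrite mul1n => /pdvdN; congr (pdvd _ _).
have := subrX1 (1 - x) k; rewrite addrAC subrr sub0r mulNr => e1.
by rewrite -[x * _]opprK -e1 opprB addrAC subrr sub0r.
Qed.

End CompleteRings.

Section MatrixPower.
Variables (p : nat) (A : pzRingType) (m n : nat).

Lemma pdvd_mx k (M : 'M[A]_(m, n)) : (forall i j, pdvd p k (M i j)) -> pdvd p k M.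
Proof.
move=> h; have [N hN] := choice (fun ij : 'I_m * 'I_n => h ij.1 ij.2).
exists (\matrix_(i, j) N (i, j)); apply/matrixP => i j.
by rewrite mulmxnE mxE -(hN (i, j)).
Qed.

Lemma pdvd_mxE k (M : 'M[A]_(m, n)) i j : pdvd p k M -> pdvd p k (M i j).
Proof. by move=> [N ->]; exists (N i j); rewrite mulmxnE. Qed.

End MatrixPower.

Section MatrixComplete.
Variables (p : nat) (A : pzRingType) (n : nat).

Lemma psep_mx : psep p A -> psep p 'M[A]_n.
Proof.
move=> h M hM; apply/matrixP => i j; rewrite mxE; apply: h => k.
exact: pdvd_mxE.
Qed.

Lemma ptf_mx : ptf p A -> ptf p 'M[A]_n.
Proof.
move=> h M /matrixP hM; apply/matrixP => i j; rewrite mxE; apply: h.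
by have := hM i j; rewrite mulmxnE mxE.
Qed.

Lemma pcomplete_mx : pcomplete p A -> pcomplete p 'M[A]_n.
Proof.
move=> h u hu.
have H (ij : 'I_n * 'I_n) : exists l, forall m, pdvd p m (u m ij.1 ij.2 - l).
  apply: h => m; have := pdvd_mxE ij.1 ij.2 (hu m); by rewrite !mxE.
have [L hL] := choice H; exists (\matrix_(i, j) L (i, j)) => m.
by apply: pdvd_mx => i j; rewrite !mxE; apply: (hL (i, j)).
Qed.

End MatrixComplete.

(** * The p-adic integers and the valuation ring *)

(** Legendre's formula gives v(j!) = j' + v(j'!) with j' = j %/ p. If j' > 0, induction yields 2
    v(j!) < 3 j' <= p j' <= j. The variable [N] bounds the number of terms of the formula. *)
Lemma logn_fact_lt p j : prime p -> odd p -> (0 < j)%N -> (2 * logn p j`! < j)%N.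
Proof.
move=> p_pr p_odd; rewrite logn_fact //.
have p3 : (2 < p)%N by rewrite odd_prime_gt2.
move: j.+1 => N; elim: N j => [|N IHN] j j0; first by rewrite big_geq.
have [->|N0] := posnP N; first by rewrite big_geq.
rewrite big_ltn ?ltnS // expn1 big_add1 /=.
have -> : (\sum_(1 <= i < N) j %/ p ^ i.+1 = \sum_(1 <= i < N) (j %/ p) %/ p ^ i)%N.
  by apply: eq_bigr => i _; rewrite expnS divnMA.
have [->|jp] := posnP (j %/ p).
  by rewrite big1 // => i _; rewrite div0n.
have := IHN _ jp; have := leq_divM j p; set s := (\sum_(_ <= _ < _) _)%N.
by nia.
Qed.

Section PadicIntegers.
Variables (p : nat) (p_pr : prime p).
Local Notation Zp := (padic_int p_pr).
Local Notation comp k x := (ilim_val (x : Zp) k).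
Local Notation pi k := (qpi (padic_ideal p int k)).

Let p1 : (1 < p)%N := prime_gt1 p_pr.

(** Compatibility in the limit is indexed by inclusions of ideals; testing on p^k turns an inclusion
    back into an inequality of exponents. *)
Lemma padic_ideal_subE k l : ideal_sub (padic_ideal p int) k l -> (l <= k)%N.
Proof.
move=> /(_ (p%:R ^+ k)); rewrite -(@leq_exp2l p) //.
have h : ideal_gen (padic_ideal p int k) (p%:R ^+ k) by apply: ideal_gen_in.
move/(_ h)/padic_idealP; rewrite abszX natz => /dvdn_leq.
by apply; rewrite expn_gt0 prime_gt0.
Qed.

Lemma padic_compW (x : Zp) k l a : (l <= k)%N -> comp k x = pi k a -> comp l x = pi l a.
Proof. by move=> lk; apply: ilim_compat; apply: ideal_sub_padic. Qed.

Lemma padic_compMn k (x : Zp) d : comp k (x *+ d) = comp k x *+ d.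
Proof. by elim: d => [|d IHd]; rewrite ?mulr0n //= ?rmorph0 // !mulrS -IHd. Qed.

Lemma padic_comp_nat k d : comp k (d%:R : Zp) = pi k d%:R.
Proof. by rewrite padic_compMn rmorph_nat; congr (_ *+ d); rewrite -(rmorph1 (pi k)). Qed.

Lemma pi_eqP k (a b : int) : pi k a = pi k b <-> ((p ^ k)%:Z %| a - b)%Z.
Proof. by rewrite qpi_eqP padic_idealP dvdzE. Qed.

Lemma padic_lim_int (b : nat -> int) : (forall m, ((p ^ m)%:Z %| b m.+1 - b m)%Z) ->
  exists y : Zp, forall m, comp m y = pi m (b m).
Proof.
move=> hb.
have hb2 i j : (j <= i)%N -> ((p ^ j)%:Z %| b i - b j)%Z.
  move/subnK <-; elim: (i - j)%N => [|d IHd]; first by rewrite subrr dvdz0.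
  rewrite addSn -(subrK (b (d + j)%N) (b (d + j).+1)) -addrA rpredD //.
  by apply: dvdz_trans (hb _); rewrite dvdzE /= dvdn_exp2l // leq_addl.
suff hc i j : ideal_sub (padic_ideal p int) i j -> forall a, pi i (b i) = pi i a -> pi j (b j) = pi j a.
  by exists (Ilim hc).
move=> s; have ij := padic_ideal_subE s => a /pi_eqP ha; apply/pi_eqP.
rewrite -(subrK (b i) (b j)) -addrA rpredD //.
  by rewrite -opprB rpredN hb2.
by apply: dvdz_trans ha; rewrite dvdzE /= dvdn_exp2l.
Qed.

(** If the component at level k vanishes, the representatives at the levels m + k are divisible by
    p^k, and their quotients are a compatible system defining x / p^k. *)
Lemma padic_comp_pdvd (x : Zp) k : comp k x = 0 <-> pdvd p k x.
Proof.
split=> [xk|[y ->]]; last first.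
  rewrite padic_compMn -[comp k y]qpi_repr -rmorphMn -[0](rmorph0 (pi k)); apply/pi_eqP.
  by rewrite subr0 -mulr_natr natz dvdz_mull.
pose a m := generic_quotient.repr (comp m x); have aE m : comp m x = pi m (a m) by rewrite qpi_repr.
have ha m : (k <= m)%N -> ((p ^ k)%:Z %| a m)%Z.
  by move=> km; rewrite dvdzE; apply/(padic_int_eq0P x km).
pose b m := (a (m + k)%N %/ (p ^ k)%:Z)%Z.
have bE m : a (m + k)%N = b m * (p ^ k)%:Z by rewrite divzK // ha // leq_addl.
have pk0 : (p ^ k)%:Z != 0 by rewrite eqz_nat -lt0n expn_gt0 prime_gt0.
have [|y hy] := @padic_lim_int b.
  move=> m; rewrite -(@dvdz_mul2r (p ^ k)%:Z) // mulrBl -!bE -PoszM -expnD addSn.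
  by apply/pi_eqP; rewrite -aE; apply/esym/(padic_compW _ (aE _)).
exists y; apply: ilimP => m.
rewrite padic_compMn hy -rmorphMn -mulr_natr natz -bE.
by apply: padic_compW (aE _); rewrite leq_addr.
Qed.

Lemma padic_sep : psep p Zp.
Proof. by move=> x hx; apply: ilimP => k /=; rewrite rmorph0; apply/padic_comp_pdvd. Qed.

Lemma padic_natr_inj (a : nat) : (a%:R : Zp) = 0 -> a = 0%N.
Proof.
move=> a0; apply/eqP; apply: contraT; rewrite -lt0n => a1.
have : comp a (a%:R : Zp) = 0 by rewrite a0 /= rmorph0.
rewrite padic_comp_nat -[0](rmorph0 (pi a)) => /pi_eqP; rewrite subr0 natz dvdzE /= => /dvdn_leq -/(_ a1).
by rewrite leqNgt ltn_expl.
Qed.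

Lemma padic_mulrn_inj (x : Zp) a : (0 < a)%N -> x *+ a = 0 -> x = 0.
Proof.
move=> a0 /eqP; rewrite -mulr_natr mulf_eq0 => /orP[/eqP//|/eqP /padic_natr_inj a1].
by rewrite a1 in a0.
Qed.

Lemma padic_tf : ptf p Zp.
Proof. by move=> x; apply: padic_mulrn_inj; apply: prime_gt0. Qed.

Lemma padic_complete : pcomplete p Zp.
Proof.
move=> u hu; pose b m := generic_quotient.repr (comp m (u m)).
have bE m : comp m (u m) = pi m (b m) by rewrite qpi_repr.
have [|l hl] := @padic_lim_int b.
  move=> m; apply/pi_eqP; rewrite -(padic_compW (leqnSn m) (bE _)) -bE.
  have /padic_comp_pdvd h := hu m; apply/eqP; rewrite -subr_eq0; apply/eqP.
  by rewrite -h.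
by exists l => m; apply/padic_comp_pdvd; rewrite /= bE hl subrr.
Qed.

Lemma padic_residue (x : Zp) k : exists2 a, (a < p ^ k)%N & pdvd p k (x - a%:R).
Proof.
have pk0 : (0 < p ^ k)%N by rewrite expn_gt0 prime_gt0.
pose a := (generic_quotient.repr (comp k x) %% (p ^ k)%:Z)%Z.
have a0 : 0 <= a by rewrite modz_ge0 // eqz_nat -lt0n.
exists `|a|%N.
  by rewrite -ltz_nat gez0_abs // ltz_pmod.
apply/padic_comp_pdvd.
rewrite [LHS]/= padic_comp_nat -[comp k x]qpi_repr natz gez0_abs //.
apply/eqP; rewrite subr_eq0; apply/eqP/pi_eqP.
by rewrite /a -eqz_mod_dvd modz_mod.
Qed.

Lemma padic_residue_unique (x : Zp) k a b : (a < p ^ k)%N -> (b < p ^ k)%N ->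
  pdvd p k (x - a%:R) -> pdvd p k (x - b%:R) -> a = b.
Proof.
wlog ab : a b / (a <= b)%N.
  by case: (leqP a b) => [|/ltnW] h H *; [|apply/esym]; apply: H.
move=> ha hb h1 h2; apply/eqP; rewrite eqn_leq ab /=.
have : pdvd p k ((b - a)%:R : Zp).
  by rewrite natrB // -[X in pdvd _ _ X](subrKA x); apply: pdvdD => //; apply: pdvdBC.
move/padic_comp_pdvd.
rewrite padic_comp_nat -[0](rmorph0 (pi k)) => /pi_eqP; rewrite subr0 natz dvdzE /=.
by case: (posnP (b - a)) => [|d0 /dvdn_leq -/(_ d0)]; lia.
Qed.

Lemma padic_coprime_unit u : coprime u p -> exists y : Zp, u%:R * y = 1.
Proof.
move=> cup; have [u0|u0] := posnP u.
  by move: cup; rewrite u0 /coprime gcd0n => /eqP; lia.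
have [a b e _] := egcdnP p u0; rewrite (eqP cup) in e.
have [|y hy] := @pone_unit p Zp padic_sep padic_complete (a * u)%:R.
  by rewrite e natrD addrK natrM; apply/pdvdMl; exists 1; rewrite expn1.
by exists (a%:R * y); rewrite mulrA -natrM mulnC.
Qed.

Hypothesis p_odd : odd p.

(** Write j! = p^v u with u prime to p and take p^(j - v) / u; its divisibility is the bound on v.
    The product rule is checked after multiplication by i! j!, the ring being torsion-free. *)
Lemma padic_dpow_exists : exists e : nat -> Zp, (forall j, e j *+ j`! = p%:R ^+ j) /\ dpow p e.
Proof.
have H j : exists x : Zp, x *+ j`! = p%:R ^+ j /\ ((0 < j)%N -> pdvd p (j./2).+1 x).
  pose v := logn p j`!; have f0 : (0 < j`!)%N := fact_gt0 j.
  have [u pu fE] : exists2 u, coprime u p & j`! = (p ^ v * u)%N.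
    have [u pu fE] := pfactor_coprime p_pr f0.
    by exists u; rewrite 1?coprime_sym // mulnC.
  have vj : (v <= j)%N.
    by case: (posnP j) => [j0|/(logn_fact_lt p_pr p_odd)]; rewrite /v ?j0 ?logn1 //; lia.
  have [y hy] := padic_coprime_unit pu.
  exists (y *+ p ^ (j - v)); split.
    rewrite -mulrnA fE mulnA -expnD subnK // mulnC mulrnA -[y *+ u]mulr_natl hy.
    by rewrite natrX.
  move=> j0; have := logn_fact_lt p_pr p_odd j0; rewrite -/v => lt.
  by apply: (@pdvdW _ _ (j - v)); [lia | exists y].
have [e he] := choice H; exists e; split=> [j|]; first by case: (he j).
have eE j : e j *+ j`! = p%:R ^+ j by case: (he j).
split=> [j x||||j]; last by case: (he j).
- exact: mulrC.
- by have := eE 0%N; rewrite expr0 fact0 mulr1n.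
- by have := eE 1%N; rewrite expr1 mulr1n.
- move=> i j; apply/eqP; rewrite -subr_eq0; apply/eqP.
  apply: (@padic_mulrn_inj _ (i`! * j`!)); first by rewrite muln_gt0 !fact_gt0.
  have fE : ('C(i + j, i) * (i`! * j`!) = (i + j)`!)%N.
    by rewrite -[in RHS](@bin_fact (i + j) i) ?leq_addr // addKn.
  by rewrite mulrnBl -mulrnA fE eE mulrnA -mulrnAl -mulrnAr !eE -exprD subrr.
Qed.

End PadicIntegers.

(** * The valuation ring: separatedness, denominators, division by integers *)

Section ValuationRingTheory.
Variables (p : nat) (p_pr : prime p) (K : fieldExtType (padic_num p_pr)).
Variable v : padic_valuation K.
Local Notation Zp := (padic_int p_pr).
Local Notation R := (valuation_ring v).
Local Notation iota := (padic_to_vring v).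

Lemma padic_to_ext_inj : injective (@padic_to_ext p p_pr K).
Proof. by move=> x y /= /fmorph_inj /eqP; rewrite tofrac_eq => /eqP. Qed.

Lemma ext_natr_neq0 a : (0 < a)%N -> a%:R != 0 :> K.
Proof.
move=> a0; apply/eqP; rewrite -(rmorph_nat (@padic_to_ext p p_pr K)).
rewrite -(rmorph0 (@padic_to_ext p p_pr K)) => /padic_to_ext_inj /padic_natr_inj.
by lia.
Qed.

Lemma pval_p : v (p%:R) = 1.
Proof.
rewrite -(rmorph_nat (@padic_to_ext p p_pr K)) /padic_to_ext /=.
rewrite (pval_padic v (k := 1)) //.
  by apply/padic_comp_pdvd; exists 1.
move/padic_comp_pdvd => [y /eqP]; rewrite -subr_eq0 => /eqP h.
have {}h : (1 - y *+ p) *+ p = 0 by rewrite mulrnBl -mulrnA mulnn.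
have /eqP := padic_tf h; rewrite subr_eq0 => /eqP h1.
have : pdvd p 1 (1 : Zp) by exists y; rewrite expn1.
move/padic_comp_pdvd; rewrite /= -[0](rmorph0 (qpi (padic_ideal p int 1))).
move/pi_eqP; rewrite subr0 dvdzE /= expn1 dvdn1 => /eqP p1.
by have := prime_gt1 p_pr; lia.
Qed.

Lemma pval_pX k : v (p%:R ^+ k) = k%:R.
Proof.
elim: k => [|k IHk]; first by rewrite expr0 pval1.
by rewrite exprS pvalM ?expf_neq0 ?ext_natr_neq0 ?prime_gt0 // pval_p IHk -natr1 addrC.
Qed.

Lemma pval_bound (x : K) : exists k : nat, `|v x| < k%:R.
Proof. by exists (Num.bound `|v x|); apply: archi_boundP; apply: normr_ge0. Qed.

Lemma vring_sep : psep p R.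
Proof.
move=> x hx; apply/val_inj/eqP; apply: contraT => /= x0.
have [k hk] := pval_bound (val x); have [y xE] := hx k.
have {}xE : val x = val y * p%:R ^+ k by rewrite xE -natrX mulr_natr rmorphMn.
have y0 : val y != 0 by apply: contraNneq x0 => y0; rewrite xE y0 mul0r.
have := valP y; rewrite unfold_in (negPf y0) /= => vy.
move: hk; rewrite xE pvalM ?expf_neq0 ?ext_natr_neq0 ?prime_gt0 // pval_pX.
by rewrite ger0_norm ?addr_ge0 // gtrDr ltNge vy.
Qed.

Lemma vring_mulrn_inj (x : R) a : (0 < a)%N -> x *+ a = 0 -> x = 0.
Proof.
move=> a0 /(congr1 val); rewrite rmorphMn rmorph0 -mulr_natr => /eqP.
rewrite mulf_eq0 (negPf (ext_natr_neq0 a0)) orbF => /eqP h.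
exact: val_inj.
Qed.

Lemma vring_tf : ptf p R.
Proof. by move=> x; apply: vring_mulrn_inj; apply: prime_gt0. Qed.

Lemma ext_den (x : K) : exists N (s : R), x *+ p ^ N = val s.
Proof.
have [N hN] := pval_bound x; exists N.
suff h : x *+ p ^ N \in pval_ge0 v by exists (ValuationRing h).
rewrite unfold_in -mulr_natr natrX; have [->|x0] := eqVneq x 0; first by rewrite mul0r eqxx.
rewrite pvalM ?expf_neq0 ?ext_natr_neq0 ?prime_gt0 // pval_pX.
by apply/orP; right; move: hN; rewrite ltr_norml => /andP[]; lra.
Qed.

Lemma vring_pdvd_muln_inj k l (x : R) : pdvd p (k + l) (x *+ p ^ l) -> pdvd p k x.
Proof.
elim: l => [|l IHl]; first by rewrite addn0 expn0.
by rewrite addnS expnSr mulrnA => h; apply: IHl; apply: ptf_pdvd h; apply: vring_tf.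
Qed.

Lemma vring_coprime_unit u : coprime u p -> exists y : R, u%:R * y = 1.
Proof.
move=> /(padic_coprime_unit p_pr) [y hy]; exists (iota y).
by rewrite -(rmorph_nat iota) -rmorphM hy rmorph1.
Qed.

(** The loss [l] is the p-adic valuation of [a], since the prime-to-p part of [a] is a unit. This
    serves to divide by factorials at a bounded cost in precision. *)
Lemma vring_pdvd_saturated a : (0 < a)%N ->
  exists l, forall k (x : R), pdvd p (k + l) (x *+ a) -> pdvd p k x.
Proof.
move=> a0; have [u pu aE] := pfactor_coprime p_pr a0.
exists (logn p a) => k x h.
have [y hy] : exists y : R, u%:R * y = 1 by apply: vring_coprime_unit; rewrite coprime_sym.
apply: vring_pdvd_muln_inj (logn p a) _ _; have := pdvdMr y h.
by rewrite {2}aE mulrnA mulrnAl -[x *+ u]mulr_natr -mulrA hy mulr1.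
Qed.

Lemma base_change_val_inj : injective (val : {rmorphism R -> K}).
Proof. exact: val_inj. Qed.

End ValuationRingTheory.

(** * The Weyl algebra acting on polynomials *)

Lemma rmorph_comm (A B : pzRingType) (f : {rmorphism A -> B}) x y :
  f (x * y - y * x) = f x * f y - f y * f x.
Proof. by rewrite rmorphB !rmorphM. Qed.

Section WeylAction.
Variables (S : comNzRingType) (n : nat).
Local Notation V := {mpoly S[n]}.
Local Notation W := (weyl_alg S n).

Lemma mpolyX_mul_linear i : linear (fun f : V => 'X_i * f).
Proof. by move=> c f g; rewrite mulrDr scalerAr. Qed.

Definition weyl_gen_act (g : 'I_n + 'I_n) : endo_alg V :=
  match g with
  | inl i => Endo (mpolyX_mul_linear i)
  | inr i => Endo (@mderiv_is_linear n S i : linear (mderiv i))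
  end.

Lemma weyl_gen_act_rel (F : {rmorphism free_alg S ('I_n + 'I_n)%type -> endo_alg V}) a :
  (forall g, F (free_gen S g) = weyl_gen_act g) -> weyl_rel a -> F a = 0.
Proof.
move=> FE; case=> i j; apply: endoP => f.
- by rewrite rmorph_comm !FE endo_addE endo_oppE !endo_mulE /= mulrCA subrr.
- by rewrite rmorph_comm !FE endo_addE endo_oppE !endo_mulE /= mderiv_comm subrr.
rewrite rmorphB rmorph_comm !FE rmorph_nat !endo_addE !endo_oppE !endo_mulE /= mderivM addrK mderivX mnm1E.
have -> : ((i == j)%:R : endo V) f = (i == j)%:R * f.
  by case: (i == j); rewrite ?mul1r ?mul0r.
rewrite eq_sym; case: eqP => [->|_]; last by rewrite scale0r mul0r subrr.
by rewrite -{1}[U_(j)%MM]add0m addmK mpolyX0 scale1r mul1r subrr.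
Qed.

Lemma weyl_gen_actP a : weyl_rel a -> fev weyl_gen_act a = 0.
Proof. by apply: weyl_gen_act_rel => g; apply: fev_gen. Qed.

Definition weyl_act : W -> endo_alg V := quot_lift (fev weyl_gen_act).
Lemma weyl_act_zmod : zmod_morphism weyl_act.
Proof. exact: quot_lift_zmod weyl_gen_actP. Qed.
Lemma weyl_act_monoid : monoid_morphism weyl_act.
Proof. exact: quot_lift_monoid weyl_gen_actP. Qed.
HB.instance Definition _ := GRing.isZmodMorphism.Build _ _ weyl_act weyl_act_zmod.
HB.instance Definition _ := GRing.isMonoidMorphism.Build _ _ weyl_act weyl_act_monoid.

Lemma weyl_act_X i f : weyl_act (weyl_X S i) f = 'X_i * f.
Proof. by rewrite /weyl_act /weyl_X (quot_liftE weyl_gen_actP) /= fev_gen. Qed.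
Lemma weyl_act_D i f : weyl_act (weyl_D S i) f = f^`M(i).
Proof. by rewrite /weyl_act /weyl_D (quot_liftE weyl_gen_actP) /= fev_gen. Qed.
Lemma weyl_act_in c : weyl_act (alg_in W c) = alg_in (endo_alg V) c.
Proof. exact: (etrans (quot_liftE weyl_gen_actP (alg_in _ c)) (fev_in _ c)). Qed.
End WeylAction.

(** Three operators are allowed because a scalar plus a derivation satisfies such a rule with the
    scalar charged to the first factor only. *)
Lemma leibniz_iter (A : pzRingType) (D1 D2 D3 : {additive A -> A}) (f g : A) k :
  (forall f g, D3 (f * g) = D1 f * g + f * D2 g) ->
  iter k D3 (f * g) = \sum_(i < k.+1) iter i D1 f * iter (k - i) D2 g *+ 'C(k, i).
Proof.
move=> h; elim: k => [|k IHk]; first by rewrite big_ord1.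
rewrite iterS IHk raddf_sum /=.
under eq_bigr do rewrite raddfMn h mulrnDl /=.
have -> : \sum_(i < k.+2) iter i D1 f * iter (k.+1 - i) D2 g *+ 'C(k.+1, i) =
   f * iter k.+1 D2 g +
   (\sum_(i < k.+1) iter i.+1 D1 f * iter (k - i) D2 g *+ 'C(k, i.+1) +
    \sum_(i < k.+1) iter i.+1 D1 f * iter (k - i) D2 g *+ 'C(k, i)).
  rewrite big_ord_recl bin0 -big_split mulr1n; congr (_ + _).
  by apply: eq_bigr => i _; rewrite !lift0 subSS binS mulrnDr.
rewrite big_split [LHS]addrC [X in X + _ = _]big_ord_recl /= bin0 subn0 -addrA.
congr (_ + (_ + _)); rewrite [RHS]big_ord_recr /= bin_small // mulr0n addr0.
by apply: eq_bigr => i _; rewrite /bump /= add1n -[D2 (iter _ _ _)]iterS subnSK.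
Qed.

Section WeylModule.
Variables (S : comNzRingType) (n : nat) (B : algebra S).
Local Notation V := {mpoly S[n]}.
Variables (F : {rmorphism B -> endo_alg V}) (X D : 'I_n -> B).
Hypothesis FX : forall i f, F (X i) f = 'X_i * f.
Hypothesis FD : forall i f, F (D i) f = f^`M(i).
Hypothesis Fin : forall c, F (alg_in B c) = alg_in (endo_alg V) c.
Variable half : S.

(** [meta_l], [meta_u] and [meta_d] are the contributions of the blocks A (Levi), B (upper) and C
    (lower) to the metaplectic formula. *)
Definition meta_l (M : 'M[S]_n) : B :=
  - alg_in B (half * \tr M) - \sum_i \sum_j alg_in B (M i j) * (X j * D i).
Definition meta_u (M : 'M[S]_n) : B :=
  alg_in B half * (\sum_i \sum_j alg_in B (M i j) * (D i * D j)).
Definition meta_d (M : 'M[S]_n) : B :=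
  - (alg_in B half * (\sum_i \sum_j alg_in B (M i j) * (X i * X j))).

Let FinE c f : F (alg_in B c) f = c *: f.
Proof. by rewrite Fin. Qed.
Let FM a b f : F (a * b) f = F a (F b f).
Proof. by rewrite rmorphM endo_mulE. Qed.
Let FN a f : F (- a) f = - F a f.
Proof. by rewrite rmorphN endo_oppE. Qed.
Let FDd a b f : F (a + b) f = F a f + F b f.
Proof. by rewrite rmorphD endo_addE. Qed.
Let Fsum (I : Type) (r : seq I) (P : pred I) (G : I -> B) f :
  F (\sum_(i <- r | P i) G i) f = \sum_(i <- r | P i) F (G i) f.
Proof. by rewrite rmorph_sum endo_sumE. Qed.
Let FXn a k f : F (a ^+ k) f = iter k (F a) f.
Proof. by elim: k => [|k IHk]; rewrite ?rmorph1 // exprS FM IHk. Qed.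

Definition linform (u : 'cV[S]_n) : V := \sum_i u i 0 *: 'X_i.
Definition quadval (M : 'M[S]_n) (u : 'cV[S]_n) : S := (u^T *m M *m u) 0 0.
Definition quadform (M : 'M[S]_n) : V := \sum_i \sum_j M i j *: ('X_i * 'X_j).

Lemma quadvalE M u : quadval M u = \sum_i \sum_j M i j * (u i 0 * u j 0).
Proof.
rewrite /quadval mxE exchange_big; apply: eq_bigr => j _.
rewrite mxE mulr_suml; apply: eq_bigr => i _; rewrite !mxE; ring.
Qed.

Lemma mderiv_linform i u : (linform u)^`M(i) = (u i 0)%:MP.
Proof.
rewrite /linform raddf_sum (bigD1 i) //= big1 => [|j ji].
  rewrite mderivZ mderivX mnm1E eqxx -{1}[U_(i)%MM]add0m addmK mpolyX0 scale1r addr0.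
  by rewrite -mul_mpolyC mulr1.
by rewrite mderivZ mderivX mnm1E (negPf ji) scale0r scaler0.
Qed.

Lemma mderiv_linformX i u b :
  (linform u ^+ b)^`M(i) = (u i 0 *+ b) *: linform u ^+ b.-1.
Proof.
elim: b => [|b IHb]; first by rewrite expr0 mulr0n scale0r -mpolyC1 mderivC.
rewrite exprS mderivM mderiv_linform IHb -scalerAr mul_mpolyC mulrS scalerDl /=.
by case: b {IHb} => [|b] /=; rewrite ?mulr0n ?scale0r // -exprS.
Qed.

Lemma meta_u_act M u b :
  F (meta_u M) (linform u ^+ b) =
  ((b ^_ 2)%:R * (half * quadval M u)) *: linform u ^+ (b - 2).
Proof.
rewrite FM FinE Fsum quadvalE.
rewrite [RHS](_ : _ = half *: \sum_i (\sum_j (M i j * (u i 0 * u j 0)) *+ b ^_ 2) *: linform u ^+ (b - 2)).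
  congr (_ *: _); apply: eq_bigr => i _; rewrite Fsum scaler_suml; apply: eq_bigr => j _.
  rewrite FM FinE FM !FD mderiv_linformX linearZ /= mderiv_linformX !scalerA.
  have -> : b.-1.-1 = (b - 2)%N by lia.
  congr (_ *: _); rewrite ffactnS ffactn1 !(mulrnAr, mulrnAl) -mulrnA.
  by rewrite -mulrA [u j 0 * _]mulrC.
rewrite -scaler_suml scalerA; congr (_ *: _).
under [in RHS]eq_bigr do rewrite sumrMnl.
by rewrite sumrMnl mulrnAr mulr_natl.
Qed.

Lemma meta_u_actX M u b k :
  F (meta_u M ^+ k) (linform u ^+ b) =
  ((b ^_ k.*2)%:R * (half * quadval M u) ^+ k) *: linform u ^+ (b - k.*2).
Proof.
elim: k b => [|k IHk] b; first by rewrite FXn subn0 ffactn0 expr0 mulr1 scale1r.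
rewrite exprSr FM meta_u_act linearZ /= IHk scalerA -subnDA add2n doubleS.
congr (_ *: _); have -> : (b ^_ k.*2.+2 = b ^_ 2 * (b - 2) ^_ k.*2)%N.
  by rewrite !ffactnS ffactn0 muln1 mulnA; congr (_ * _ ^_ _)%N; lia.
by rewrite natrM exprS; ring.
Qed.

Lemma meta_d_actX M k f : F (meta_d M ^+ k) f = (- half *: quadform M) ^+ k * f.
Proof.
have h g : F (meta_d M) g = (- half *: quadform M) * g.
  rewrite FN FM FinE Fsum scaleNr mulNr -scalerAl /quadform mulr_suml.
  congr (- (_ *: _)); apply: eq_bigr => i _; rewrite Fsum mulr_suml.
  by apply: eq_bigr => j _; rewrite FM FinE FM !FX mulrA scalerAl.
elim: k => [|k IHk]; first by rewrite FXn expr0 mul1r.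
by rewrite exprS FM IHk h exprS mulrA.
Qed.

(** The linear vector field inside [meta_l]; what remains of [meta_l] is the scalar
    [- (half * \tr M)]. *)
Definition lin_deriv (M : 'M[S]_n) : endo V := F (- \sum_i \sum_j alg_in B (M i j) * (X j * D i)).

Lemma lin_derivE M f : lin_deriv M f = - \sum_i \sum_j M i j *: ('X_j * f^`M(i)).
Proof.
rewrite /lin_deriv FN Fsum; congr (- _); apply: eq_bigr => i _; rewrite Fsum.
by apply: eq_bigr => j _; rewrite FM FinE FM FX FD.
Qed.

Lemma lin_derivM M f g : lin_deriv M (f * g) = lin_deriv M f * g + f * lin_deriv M g.
Proof.
rewrite !lin_derivE mulNr mulrN -opprD; congr (- _).
rewrite mulr_suml mulr_sumr -big_split; apply: eq_bigr => i _ /=.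
rewrite mulr_suml mulr_sumr -big_split; apply: eq_bigr => j _ /=.
by rewrite mderivM -scalerAl -scalerAr -scalerDr; congr (_ *: _); ring.
Qed.

Lemma lin_deriv1 M : lin_deriv M 1 = 0.
Proof.
rewrite lin_derivE big1 ?oppr0 // => i _; rewrite big1 // => j _.
by rewrite -mpolyC1 mderivC mulr0 scaler0.
Qed.

Lemma lin_deriv_linform M u : lin_deriv M (linform u) = linform (- M^T *m u).
Proof.
rewrite lin_derivE /linform exchange_big -sumrN; apply: eq_bigr => j _ /=.
rewrite mulNmx mxE scaleNr; congr (- _); rewrite mxE scaler_suml.
apply: eq_bigr => i _; rewrite -/(linform u) mderiv_linform mulrC mul_mpolyC scalerA.
by rewrite mxE.
Qed.

Lemma meta_l_act M f : F (meta_l M) f = (- (half * \tr M)) *: f + lin_deriv M f.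
Proof. by rewrite FDd FN FinE scaleNr. Qed.

End WeylModule.

(** * The symbol of a product of three exponentials *)

Lemma big_nat_eq0 (A : nmodType) (f : nat -> A) a b :
  (forall j, (a <= j < b)%N -> f j = 0) -> \sum_(a <= j < b) f j = 0.
Proof. by move=> h; rewrite big_nat big1. Qed.

Lemma big_ord_nat_trim (A : nmodType) (f : nat -> A) a b N : (b <= N)%N ->
  (forall j, ~~ (a <= j < b)%N -> f j = 0) -> \sum_(j < N) f j = \sum_(a <= j < b) f j.
Proof.
move=> bN hf; rewrite -(big_mkord xpredT) (big_cat_nat _ bN) //=.
rewrite [X in _ + X]big_nat_eq0 ?addr0 => [|j h]; last by apply: hf; lia.
case: (leqP a b) => [ab|ba]; last first.
  by rewrite [RHS]big_geq ?(ltnW ba) // big_nat_eq0 // => j h; apply: hf; lia.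
by rewrite (big_cat_nat _ ab) //= [X in X + _]big_nat_eq0 ?add0r // => j h; apply: hf; lia.
Qed.

(** Here b is the power of x.u, k the order taken from the upper exponential, and i = d + k - b
    turns out to be the order taken from the lower one. *)
Lemma degree_reindex (A : nmodType) (T : nat -> nat -> A) d :
  (forall b k, ~~ (k.*2 <= b <= d + k)%N -> T b k = 0) ->
  \sum_(b < d.*2.+1) \sum_(k < b.+1) T b k =
  \sum_(k < d.+1) \sum_(i < (d - k).+1) T (d + k - i)%N k.
Proof.
move=> T0.
transitivity (\sum_(b < d.*2.+1) \sum_(k < d.+1) T b k).
  apply: eq_bigr => b _; have lb := ltn_ord b.
  rewrite (@big_ord_nat_trim _ _ 0 (minn b.+1 d.+1)) ?geq_minl //; last first.
    by move=> k hk; apply: T0; lia.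
  rewrite (@big_ord_nat_trim _ _ 0 (minn b.+1 d.+1)) ?geq_minr // => k hk.
  by apply: T0; lia.
rewrite exchange_big; apply: eq_bigr => k _ /=; have lk := ltn_ord k.
rewrite (@big_ord_nat_trim _ (T^~ k) k.*2 (d + k).+1) => [||b hb]; [|lia|by apply: T0; lia].
rewrite -{1}[k.*2]add0n big_addn (_ : (d + k).+1 - k.*2 = (d - k).+1)%N; last by lia.
rewrite big_nat_rev big_mkord; apply: eq_bigr => i _; have li := ltn_ord i.
by congr (T _ _); lia.
Qed.

Section TrinomialIdentity.
Variables (p : nat) (S : comNzRingType) (e : nat -> S).
Hypothesis eE : forall j, e j *+ j`! = p%:R ^+ j.

(** Contribution of (x.u)^b through the k-th term of the upper exponential: that term leaves a power
    of degree l = b - 2k in x, the Levi factor turns it into lambda^l, and the lower exponential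
    must supply the missing degree N - l, hence the parity condition. *)
Definition theta_coef (beta gamma lambda : S) (d b k : nat) : S :=
  let l := (b - k.*2)%N in let N := (d.*2 - b)%N in
  (d.*2 ^_ N)%:R * ((e k * ((b ^_ k.*2)%:R * beta ^+ k)) *
   (lambda ^+ l * (if (l <= N)%N && ~~ odd (N - l) then e (N - l)./2 * gamma ^+ (N - l)./2 else 0))).

Lemma theta_coef_small beta gamma lambda d b k : (b <= d.*2)%N ->
  ~~ (k.*2 <= b <= d + k)%N -> theta_coef beta gamma lambda d b k = 0.
Proof.
move=> bd; rewrite negb_and -!ltnNge /theta_coef => /orP[h|h].
  by rewrite [b ^_ _]ffact_small // mul0r mulr0 mul0r mulr0.
case: (leqP k.*2 b) => [kb|/ffact_small ->]; last by rewrite mul0r mulr0 mul0r mulr0.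
by rewrite leqNgt (_ : (_ < _)%N) /= ?mulr0 //; lia.
Qed.

(** With l = d - k - i, the two binomials give the trinomial coefficient d! / (i! l! k!), while the
    falling factorials multiplied by l! make up (2d)!. *)
Lemma theta_coefE beta gamma lambda d k i : (k <= d)%N -> (i <= d - k)%N ->
  d`!%:R * theta_coef beta gamma lambda d (d + k - i) k =
  (d.*2)`!%:R * ((lambda ^+ (d - k - i) * (p%:R * gamma) ^+ i *+ 'C(d - k, i)) *
     (p%:R * beta) ^+ k *+ 'C(d, k)).
Proof.
move=> kd ik; rewrite /theta_coef.
have -> : (d + k - i - k.*2 = d - k - i)%N by lia.
have -> : (d.*2 - (d + k - i) - (d - k - i) = i.*2)%N by lia.
rewrite (_ : (_ <= _)%N) ?odd_double ?doubleK /=; last by lia.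
set l := (d - k - i)%N; set b := (d + k - i)%N.
have d_fact : d`! = ('C(d - k, i) * 'C(d, k) * (i`! * l`! * k`!))%N.
  by rewrite -(bin_fact kd) -(bin_fact ik) -/l; ring.
have d2_fact : ((d.*2) ^_ (d.*2 - b) * b ^_ (k.*2) * l`! = (d.*2)`!)%N.
  rewrite -[RHS](@ffact_fact _ (d.*2 - b)) ?leq_subr // -mulnA; congr (_ * _)%N.
  have -> : (d.*2 - (d.*2 - b) = b)%N by rewrite /b; lia.
  have -> : (l = b - k.*2)%N by rewrite /l /b; lia.
  by rewrite ffact_fact // /b; lia.
have pE j : p%:R ^+ j = e j * j`!%:R by rewrite -eE mulr_natr.
rewrite d_fact -d2_fact !exprMn !pE -[_ *+ 'C(d - k, i)]mulr_natr -[_ *+ 'C(d, k)]mulr_natr.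
rewrite !natrM; move: ('C(d, k)%:R) ('C(d - k, i)%:R) (i`!%:R) (k`!%:R) (l`!%:R) => c1 c2 f1 f2 f3.
move: ((_ ^_ _)%:R) => F1; move: ((_ ^_ _)%:R) => F2.
move: (e k) (e i) (beta ^+ k) (gamma ^+ i) (lambda ^+ l) => *; ring.
Qed.

(** Free of denominators, this says that (2d)! times the d-th term of e^(lambda + p gamma + p beta)
    is the sum of all contributions. *)
Lemma theta_sumE beta gamma lambda d :
  d`!%:R * (\sum_(b < d.*2.+1) \sum_(k < b.+1) theta_coef beta gamma lambda d b k) =
  (d.*2)`!%:R * (lambda + p%:R * gamma + p%:R * beta) ^+ d.
Proof.
pose T b k := if (b <= d.*2)%N then theta_coef beta gamma lambda d b k else 0.
rewrite (_ : \sum_(b < _) _ = \sum_(b < d.*2.+1) \sum_(k < b.+1) T b k); last first.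
  by apply: eq_bigr => b _; apply: eq_bigr => k _; rewrite /T -ltnS ltn_ord.
rewrite degree_reindex => [|b k h]; last first.
  by rewrite /T; case: ifP => // /theta_coef_small; apply.
rewrite exprDn !mulr_sumr; apply: eq_bigr => k _; have lk := ltn_ord k.
rewrite exprDn mulr_suml -sumrMnl !mulr_sumr; apply: eq_bigr => i _; have li := ltn_ord i.
by rewrite /T ifT; [apply: theta_coefE; lia | lia].
Qed.

End TrinomialIdentity.

Section TendsSums.
Variables (p : nat) (A : pzRingType).
Lemma tends_sum I (r : seq I) (u : I -> nat -> A) (l : I -> A) :
  (forall i, tends p (u i) (l i)) ->
  tends p (fun m => \sum_(i <- r) u i m) (\sum_(i <- r) l i).
Proof.
move=> h; elim: r => [|i r IHr].
  apply: (@tends_ext _ _ (fun=> 0)) => [m|]; rewrite big_nil //; exact: tends_cst.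
move=> k; have [m hm] := h i k; have [m' hm'] := IHr k.
exists (maxn m m') => j; rewrite geq_max => /andP[/hm h1 /hm' h2].
by rewrite !big_cons opprD addrACA; apply: pdvdD.
Qed.
Lemma tends_eventually u v (l : A) m0 : (forall m, (m0 <= m)%N -> u m = v m) ->
  tends p v l -> tends p u l.
Proof.
move=> e h k; have [m1 hm] := h k; exists (maxn m0 m1) => m.
by rewrite geq_max => /andP[/e -> /hm].
Qed.
Lemma tendsMl (a : A) u l : tends p u l -> tends p (fun m => a * u m) (a * l).
Proof. by apply: tendsM; apply: tends_cst. Qed.
End TendsSums.

Section WeylLimit.
Variables (p : nat) (S : comNzRingType) (n : nat) (B : algebra S).
Local Notation V := {mpoly S[n]}.
Variables (F : {rmorphism B -> endo_alg V}) (X D : 'I_n -> B).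
Hypothesis FX : forall i f, F (X i) f = 'X_i * f.
Hypothesis FD : forall i f, F (D i) f = f^`M(i).
Hypothesis Fin : forall c, F (alg_in B c) = alg_in (endo_alg V) c.
Variable half : S.
Variable e : nat -> S.
Hypothesis he : dpow p e.

Let be j : B := alg_in B (e j).
Let ve j : V := (e j)%:MP.
Let me j : 'M[S]_n := (e j)%:M.

Lemma dpow_mpolyC : dpow p ve.
Proof.
rewrite /ve; split=> [j f||||].
- exact: mulrC.
- by rewrite (dpow0 he).
- by rewrite (dpow1 he) mpolyC_nat.
- by move=> i j; rewrite -mpolyCM (dpowM he) mpolyCMn.
- by move=> j j0; apply/(@pdvd_additive p _ _ (@mpolyC n S))/(dpow_dvd he).
Qed.

Lemma exps_act a m f : F (exps be (fun j => a ^+ j) m) f = exps ve (fun j => F (a ^+ j) f) m.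
Proof.
rewrite /exps rmorph_sum endo_sumE; apply: eq_bigr => j _.
by rewrite rmorphM endo_mulE Fin /= mul_mpolyC.
Qed.

Variables (MA MB MC h : 'M[S]_n) (c : S).
Hypothesis h_lim : tends p (exps me (fun j => (- MA) ^+ j)) h.
Hypothesis c_lim : tends p (exps e (fun j => (- (half * \tr MA)) ^+ j)) c.

Let delta := lin_deriv F X D MA.
Let ell := meta_l X D half MA.

Lemma linform_zmod : zmod_morphism (@linform S n).
Proof.
by move=> u v; rewrite /linform -sumrB; apply: eq_bigr => i _; rewrite !mxE scalerBl.
Qed.

Lemma linformZ a u : linform (a *: u) = a%:MP * linform u :> V.
Proof.
by rewrite mul_mpolyC /linform scaler_sumr; apply: eq_bigr => i _; rewrite !mxE scalerA.
Qed.

HB.instance Definition _ := GRing.isZmodMorphism.Build _ _ (@linform S n) linform_zmod.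

Lemma lin_deriv_iter u j : iter j delta (linform u) = linform (((- MA) ^+ j)^T *m u).
Proof.
elim: j => [|j IHj]; first by rewrite expr0 trmx1 mul1mx.
by rewrite iterS IHj lin_deriv_linform // exprSr trmx_mul mulmxA linearN.
Qed.

Lemma lin_deriv_tends u :
  tends p (exps ve (fun j => iter j delta (linform u))) (linform (h^T *m u)).
Proof.
move=> k; have [m0 hm] := h_lim k; exists m0 => m /hm.
have -> : exps ve (fun j => iter j delta (linform u)) m =
   linform ((exps me (fun j => (- MA) ^+ j) m)^T *m u).
  rewrite /exps raddf_sum mulmx_suml raddf_sum; apply: eq_bigr => j _ /=.
  rewrite lin_deriv_iter -linformZ; congr linform.
  by rewrite [_ * _]mul_scalar_mx linearZ /= scalemxAl.
rewrite -raddfB -mulmxBl -[_^T - _]linearB => -[y ->].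
have -> : (y *+ p ^ k)^T *m u = (y^T *m u) *+ p ^ k.
  by rewrite linearMn -[X in X *m u]scaler_nat -scalemxAl scaler_nat.
by rewrite raddfMn; exists (linform (y^T *m u)).
Qed.

(** The exponential of a derivation is multiplicative, by the iterated Leibniz rule; so its effect
    on linear forms determines its effect on their powers. *)
Lemma lin_derivX_tends u b :
  tends p (exps ve (fun j => iter j delta (linform u ^+ b))) (linform (h^T *m u) ^+ b).
Proof.
elim: b => [|b IHb].
  rewrite expr0; apply: (@tends_eventually _ _ _ (fun=> 1) _ 1); last exact: tends_cst.
  move=> [|m] // _; rewrite /exps big_ord_recl big1 ?addr0 => [|i _].
    by rewrite /= /ve (dpow0 he) mul1r.
  by rewrite lift0 iterSr /delta lin_deriv1 // iter_fix ?mulr0 //; apply: raddf0.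
rewrite !exprS; apply: (exps_tendsM dpow_mpolyC _ (lin_deriv_tends u) IHb) => k.
exact: (@leibniz_iter V delta delta delta) (lin_derivM FX FD Fin MA).
Qed.

(** Write the power of the linear form as 1 times itself. In the twisted Leibniz rule the full
    operator acts on the factor 1, where it exponentiates to [c], and the derivation acts on the
    other factor as a linear substitution. *)
Lemma meta_l_tends u b :
  tends p (exps ve (fun j => F (ell ^+ j) (linform u ^+ b))) (c%:MP * linform (h^T *m u) ^+ b).
Proof.
have FXn a k f : F (a ^+ k) f = iter k (F a) f.
  by elim: k => [|k IHk]; rewrite ?rmorph1 // exprS rmorphM endo_mulE IHk.
have hc : tends p (exps ve (fun j => iter j (F ell) 1)) c%:MP.
  have := @tends_morph p _ _ (@mpolyC n S) _ _ c_lim.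
  apply: tends_ext => m; rewrite rmorph_exps; apply: eq_bigr => j _; congr (_ * _).
  elim: (nat_of_ord j) => [|k IHk] /=; first by rewrite expr0.
  rewrite -IHk exprS mpolyCM /ell (meta_l_act _ _ Fin) [LHS]/= !mul_mpolyC.
  have -> : lin_deriv F X D MA (((- (half * \tr MA)) ^+ k)%:MP) = 0.
    by rewrite -[_%:MP]mulr1 mul_mpolyC linearZ /= lin_deriv1 // scaler0.
  by rewrite addr0.
have hT : tends p (exps ve (fun j => iter j (F ell) (linform u ^+ b)))
    (c%:MP * linform (h^T *m u) ^+ b).
  apply: (exps_tendsM dpow_mpolyC _ hc (lin_derivX_tends u b)) => k.
  rewrite -[linform u ^+ b in LHS]mul1r.
  apply: (@leibniz_iter V (F ell) delta (F ell)) => f g.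
  by rewrite /ell /= !(meta_l_act _ _ Fin) mulrDl (lin_derivM FX FD Fin) // scalerAl addrA.
by apply: tends_ext hT => m; apply: eq_bigr => j _; rewrite FXn.
Qed.

(** Restriction to the line through x: the homogeneous part of degree N, evaluated at x, becomes the
    coefficient of 'X^N. *)
Definition ray_eval (x : 'cV[S]_n) (f : V) : {poly S} := mmap (@polyC S) (fun i => x i 0 *: 'X) f.
HB.instance Definition _ x := GRing.RMorphism.copy (ray_eval x) (mmap (@polyC S) (fun i => x i 0 *: 'X)).

Lemma ray_evalC x a : ray_eval x a%:MP = a%:P.
Proof. by rewrite /ray_eval mmapC. Qed.

Lemma ray_evalX x i : ray_eval x 'X_i = x i 0 *: 'X.
Proof. by rewrite /ray_eval mmapX mmap1U. Qed.

Lemma ray_evalZ x a f : ray_eval x (a *: f) = a *: ray_eval x f.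
Proof. by rewrite -mul_mpolyC rmorphM /= ray_evalC mul_polyC. Qed.

Lemma ray_eval_linform x u : ray_eval x (linform u) = (x^T *m u) 0 0 *: 'X.
Proof.
rewrite raddf_sum mxE scaler_suml; apply: eq_bigr => i _ /=.
by rewrite ray_evalZ ray_evalX scalerA mxE mulrC.
Qed.

Lemma ray_eval_quadform x M : ray_eval x (quadform M) = quadval M x *: 'X^2.
Proof.
rewrite quadvalE raddf_sum scaler_suml; apply: eq_bigr => i _ /=.
rewrite raddf_sum scaler_suml; apply: eq_bigr => j _ /=.
rewrite ray_evalZ rmorphM /= !ray_evalX -scalerAl -scalerAr !scalerA.
by rewrite expr2 mulrA.
Qed.

(* Up to the factor (2 d)!, the homogeneous part of degree [2 d] in (x, u) of *)
(* [b (exp (x . u))]. *)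
Definition theta d (x u : 'cV[S]_n) (b : B) : S :=
  \sum_(k < d.*2.+1) (d.*2 ^_ (d.*2 - k))%:R * (ray_eval x (F b (linform u ^+ k)))`_(d.*2 - k).

Lemma theta_zmod d x u : zmod_morphism (theta d x u).
Proof.
move=> a b; rewrite /theta -sumrB; apply: eq_bigr => k _.
by rewrite rmorphB endo_addE endo_oppE raddfB coefB mulrBr.
Qed.
HB.instance Definition _ d x u := GRing.isZmodMorphism.Build _ _ (theta d x u) (theta_zmod d x u).

Lemma thetaZ d x u a b : theta d x u (alg_in B a * b) = a * theta d x u b.
Proof.
rewrite /theta mulr_sumr; apply: eq_bigr => k _.
by rewrite rmorphM endo_mulE Fin /= ray_evalZ coefZ; ring.
Qed.

Let beta (u : 'cV[S]_n) : S := half * quadval MB u.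
Let gamma (x : 'cV[S]_n) : S := - half * quadval MC x.
Let lambda (x u : 'cV[S]_n) : S := (x^T *m (h^T *m u)) 0 0.

Lemma ray_coef_tends x u l N :
  tends p (fun m => (ray_eval x (F (exps be (fun j => meta_d X half MC ^+ j) m)
      (exps ve (fun j => F (ell ^+ j) (linform u ^+ l)) m)))`_N)
    (c * (lambda x u ^+ l * (if (l <= N)%N && ~~ odd (N - l) then
       e (N - l)./2 * gamma x ^+ (N - l)./2 else 0))).
Proof.
set w := - half *: quadform MC.
have FE m f : F (exps be (fun j => meta_d X half MC ^+ j) m) f = exps ve (fun j => w ^+ j) m * f.
  rewrite exps_act /exps mulr_suml; apply: eq_bigr => j _.
  by rewrite (meta_d_actX FX Fin) mulrA.
have evW m : ray_eval x (exps ve (fun j => w ^+ j) m) =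
    \sum_(i < m) (e i * gamma x ^+ i) *: 'X^(i.*2).
  rewrite rmorph_sum; apply: eq_bigr => i _ /=.
  rewrite rmorphM rmorphXn /= ray_evalC /w ray_evalZ ray_eval_quadform scalerA.
  by rewrite exprZn -exprM mul2n mul_polyC scalerA.
move=> k; have [m0 hm] := meta_l_tends u l k.
(* Once m > N, the truncated lower exponential already has its exact coefficients up to degree N;
   only the Levi factor is approximated. *)
exists (maxn m0 N.+1) => m; rewrite geq_max => /andP[/hm hm1 hm2].
set f := exps ve _ m in hm1 *; rewrite FE.
apply: (@pdvd_trans p _ k _ (ray_eval x (exps ve (fun j => w ^+ j) m *
    (c%:MP * linform (h^T *m u) ^+ l)))`_N).
  rewrite -coefB -raddfB -mulrBr.
  by have := pdvdMl (exps ve (fun j => w ^+ j) m) hm1 =>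
    /(@pdvd_additive p _ _ (ray_eval x)) /(@pdvd_additive p _ _ (coefp N)).
set val := (c * _); suff -> : (ray_eval x (exps ve (fun j => w ^+ j) m *
    (c%:MP * linform (h^T *m u) ^+ l)))`_N = val by rewrite subrr; apply: pdvd0.
rewrite rmorphM /= evW rmorphM rmorphXn /= ray_evalC ray_eval_linform.
rewrite exprZn mulr_suml coef_sum.
rewrite (eq_bigr (fun i : 'I_m => c * (lambda x u ^+ l * (e i * gamma x ^+ i * (N == i.*2 + l)%N%:R)))).
  rewrite -mulr_sumr; congr (_ * _); rewrite -mulr_sumr; congr (_ * _).
  case: ifP => [/andP[lN ev]|h0].
    have li : ((N - l)./2 < m)%N by lia.
    rewrite (bigD1 (Ordinal li)) //= big1 ?addr0 => [|i /eqP ni].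
      by rewrite (_ : (N == _)) ?mulr1 //; lia.
    rewrite (_ : (N == _) = false) ?mulr0 //; apply/negP => /eqP Ni; apply: ni.
    by apply: val_inj => /=; lia.
  by rewrite big1 // => i _; rewrite (_ : (N == _) = false) ?mulr0 //; lia.
move=> i _; rewrite -scalerAl -/(lambda x u) mul_polyC scalerA -scalerAr scalerA -exprD.
by rewrite coefZ coefXn; ring.
Qed.

(** On (x.u)^b the upper exponential stops after finitely many terms, each a multiple of a lower
    power of x.u; the other two factors are then treated power by power. *)
Lemma theta_tends d x u :
  tends p (fun m => theta d x u (exps be (fun j => meta_d X half MC ^+ j) m *
      exps be (fun j => ell ^+ j) m * exps be (fun j => meta_u D half MB ^+ j) m))
    (c * \sum_(b < d.*2.+1) \sum_(k < b.+1) theta_coef e (beta u) (gamma x) (lambda x u) d b k).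
Proof.
rewrite mulr_sumr; apply: tends_sum => b.
rewrite (_ : c * _ = (d.*2 ^_ (d.*2 - b))%:R * \sum_(k < b.+1) (e k * ((b ^_ k.*2)%:R * beta u ^+ k)) *
   (c * (lambda x u ^+ (b - k.*2) * (if (b - k.*2 <= d.*2 - b)%N && ~~ odd (d.*2 - b - (b - k.*2)) then
       e (d.*2 - b - (b - k.*2))./2 * gamma x ^+ (d.*2 - b - (b - k.*2))./2 else 0)))); last first.
  by rewrite !mulr_sumr; apply: eq_bigr => k _; rewrite /theta_coef; ring.
apply: tendsMl; pose u_ k m := (e k * ((b ^_ k.*2)%:R * beta u ^+ k)) * (ray_eval x (F (exps be (fun j => meta_d X half MC ^+ j) m)
      (exps ve (fun j => F (ell ^+ j) (linform u ^+ (b - k.*2))) m)))`_(d.*2 - b).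
apply: (@tends_eventually _ _ _ (fun m => \sum_(k < b.+1) u_ k m) _ b.+1); last first.
  by apply: tends_sum => k; apply: tendsMl; apply: ray_coef_tends.
move=> m bm.
have E3 : F (exps be (fun j => meta_u D half MB ^+ j) m) (linform u ^+ b) =
    \sum_(k < b.+1) (e k * ((b ^_ k.*2)%:R * beta u ^+ k)) *: linform u ^+ (b - k.*2).
  rewrite exps_act /exps.
  transitivity (\sum_(0 <= j < b.+1) ve j * F (meta_u D half MB ^+ j) (linform u ^+ b)).
    apply: (@big_ord_nat_trim _ (fun j => ve j * F (meta_u D half MB ^+ j) (linform u ^+ b)) 0 b.+1) => // j hj.
    by rewrite (meta_u_actX FD Fin) ffact_small ?mul0r ?scale0r ?mulr0 //; lia.
  rewrite big_mkord; apply: eq_bigr => k _.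
  by rewrite (meta_u_actX FD Fin) mul_mpolyC scalerA.
rewrite rmorphM rmorphM !endo_mulE E3.
rewrite !linear_sum /= raddf_sum coef_sum; apply: eq_bigr => k _.
rewrite !linearZ /= ray_evalZ coefZ /u_; congr (_ * (ray_eval x (F _ _))`_ _).
exact: exps_act.
Qed.

End WeylLimit.

(** * The big cell of the congruence subgroup *)

Lemma pdvd1P p (V : zmodType) (x : V) : pdvd p 1 x <-> exists y, x = y *+ p.
Proof. by split=> -[y ->]; exists y; rewrite expn1. Qed.

Section MatrixExponential.
Variables (p : nat) (p_pr : prime p).
Local Notation Zp := (padic_int p_pr).
Variable e : nat -> Zp.
Hypothesis eE : forall j, e j *+ j`! = p%:R ^+ j.
Hypothesis he : dpow p e.

Lemma dpow_mx r : dpow p (fun j => (e j)%:M : 'M[Zp]_r).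
Proof. exact: (dpow_alg (mx_alg Zp r) he). Qed.

(** The map x -> e^(p x) on square matrices over Z_p. *)
Definition mexp r : 'M[Zp]_r -> 'M[Zp]_r :=
  pexp (@pcomplete_mx p Zp r (@padic_complete p p_pr)) (dpow_mx r).

Lemma mexpP r (x : 'M[Zp]_r) :
  tends p (exps (fun j => (e j)%:M) (fun j => x ^+ j)) (mexp x).
Proof. exact: pexpP. Qed.

Let sep r : psep p 'M[Zp]_r := psep_mx (@padic_sep p p_pr) (n := r).
Let tf r : ptf p 'M[Zp]_r := ptf_mx (@padic_tf p p_pr) (n := r).

Lemma mexpN r (x : 'M[Zp]_r) : mexp x *m mexp (- x) = 1%:M.
Proof. exact: (pexpN (@sep r)). Qed.

Lemma mexp_surj r (x0 : 'M[Zp]_r) : exists x, mexp x = 1%:M + x0 *+ p.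
Proof. exact: (pexp_surj (@sep r)). Qed.

Lemma mexp_cont r k (x y : 'M[Zp]_r) : pdvd p k (x - y) -> pdvd p k.+1 (mexp x - mexp y).
Proof. exact: pexp_cont. Qed.

Lemma mexp_cont_inv r k (x y : 'M[Zp]_r) : pdvd p k.+1 (mexp x - mexp y) -> pdvd p k (x - y).
Proof. exact: (pexp_cont_inv (@tf r)). Qed.

Lemma mexp0 r : mexp (0 : 'M[Zp]_r) = 1%:M.
Proof. exact: (pexp0 (@sep r)). Qed.

(** Termwise, the integral coefficients [e j] times x^j agree over Q_p with (p x)^j / j!, so
    convergence over Z_p suffices. *)
Lemma exp_mxP n (x g : 'M[Zp]_(n + n)) :
  tends p (exps (fun j => (e j)%:M) (fun j => x ^+ j)) g -> exp_mx x g.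
Proof.
pose f : {additive 'M[Zp]_(n + n) -> 'M[padic_num p_pr]_(n + n)} := map_mx (@padic_to_num p p_pr).
have fM y z : f (y * z) = f y * f z by exact: map_mxM.
have fX y j : f (y ^+ j) = f y ^+ j.
  elim: j => [|j IHj]; first exact: map_mx1.
  by rewrite !exprS fM IHj.
have j0 j : (padic_to_num j`!%:R : padic_num p_pr) != 0.
  by rewrite tofrac_eq0; apply/eqP => /padic_natr_inj; move: (fact_gt0 j); lia.
have fZ (a : Zp) y : f (a *: y) = padic_to_num a *: f y by exact: map_mxZ.
have sM (a b : Zp) (y z : 'M[Zp]_(n + n)) : (a *: y) * (b *: z) = (a * b) *: (y * z).
  by rewrite -[LHS]/((a *: y) *m (b *: z)) -scalemxAl -scalemxAr scalerA.
move=> h k; have [m0 hm] := h k; exists m0 => m /hm [y hy].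
exists (f y); first by exists y.
have -> : \sum_(j < m) alg_in (mx_alg (padic_num p_pr) (n + n)) j`!%:R^-1 *
    f (p%:R *: x) ^+ j =
    f (exps (fun j => (e j)%:M) (fun j => x ^+ j) m).
  rewrite /exps raddf_sum; apply: eq_bigr => j _.
  rewrite [X in _ = f X]mul_scalar_mx [LHS]mul_scalar_mx -fX.
  have -> : (p%:R *: x) ^+ j = p%:R ^+ j *: x ^+ j.
    elim: (nat_of_ord j) => [|i IHi]; first by rewrite !expr0 scale1r.
    by rewrite !exprS IHi sM.
  rewrite !fZ scalerA -eE; congr (_ *: _).
  rewrite rmorphMn -[X in _ * X]mulr_natl mulrA mulVf ?mul1r //.
  by rewrite -(rmorph_nat (@padic_to_num p p_pr)); apply: j0.
have -> : f (exps (fun j => (e j)%:M) (fun j => x ^+ j) m) - map_mx (@padic_to_num p p_pr) g = f (y *+ p ^ k).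
  by rewrite -hy raddfB.
by rewrite -natrX mulr_natl raddfMn.
Qed.

(** * Lower unipotent, Levi and upper unipotent factors *)

Section Factorization.
Variable n : nat.
Local Notation M := 'M[Zp]_n.
Local Notation G := (congr_sp p_pr n).

Lemma symplectic_block (a b c d : M) :
  a^T *m c = c^T *m a -> b^T *m d = d^T *m b -> a^T *m d - c^T *m b = 1%:M ->
  congr1_mx 1 (block_mx a b c d) -> block_mx a b c d \in @congr_sp_mem p p_pr n.
Proof.
move=> h1 h2 h3 hc; rewrite unfold_in; apply/andP; split; last exact/asboolP.
have h3' : b^T *m c - d^T *m a = - 1%:M.
  have := congr1 trmx h3; rewrite trmx1 linearB /= !trmx_mul !trmxK => h.
  by rewrite -h opprB.
rewrite tr_block_mx !mulmx_block !mulmx0 !mulmx1 !mulmxN !mulmx1 !add0r !addr0 !mulNmx.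
by rewrite h1 h2 addNr addNr [- _ + _ *m d]addrC h3 [- _ + _ *m c]addrC h3'.
Qed.

(** The relation between a and b comes from g J g^T = J, which holds because the left inverse - J
    g^T J of g is also a right inverse. *)
Lemma symplectic_blockE (g : G) : let a := ulsubmx (g : 'M_(n + n)) in let b := ursubmx (g : 'M_(n + n)) in
  let c := dlsubmx (g : 'M_(n + n)) in let d := drsubmx (g : 'M_(n + n)) in
  [/\ a^T *m c = c^T *m a, a *m b^T = b *m a^T & a^T *m d - c^T *m b = 1%:M].
Proof.
move=> a b c d; have gE : cs_val g = block_mx a b c d by rewrite submxK.
have h1 : (cs_val g)^T *m symp_form Zp n *m cs_val g = symp_form Zp n.
  by case: g @a @b @c @d gE => g /= /andP[/eqP].
have h2 : cs_val g *m symp_form Zp n *m (cs_val g)^T = symp_form Zp n.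
  have := mulmx1C (congr_sp_invmxl g); rewrite /congr_sp_invmx mulmxN !mulmxA => h.
  have := congr1 (fun A => A *m symp_form Zp n) h.
  by rewrite /= mul1mx mulNmx -[X in - X]mulmxA symp_formJJ mulmxN mulmx1 opprK.
move: h1 h2; rewrite gE tr_block_mx !mulmx_block !mulmx0 !mulmx1 !mulmxN !mulmx1 !add0r !addr0 !mulNmx.
move=> /eq_block_mx [h1 h2 _ _] /eq_block_mx [h3 _ _ _]; split.
- by apply/eqP; rewrite -subr_eq0 addrC h1.
- by apply/eqP; rewrite -subr_eq0 addrC h3.
- by rewrite addrC.
Qed.

Lemma congr1_mxP k (g : 'M[Zp]_(n + n)) : congr1_mx k g <-> pdvd p k (g - 1%:M).
Proof.
split=> [[x ->]|[x h]].
  by exists x; rewrite addrC addKr -natrX scaler_nat.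
by exists x; rewrite -natrX scaler_nat -h addrC subrK.
Qed.

Lemma pdvd_block k (a b c d : M) : pdvd p k a -> pdvd p k b -> pdvd p k c -> pdvd p k d ->
  pdvd p k (block_mx a b c d).
Proof.
move=> [a' ->] [b' ->] [c' ->] [d' ->]; exists (block_mx a' b' c' d').
by rewrite -!scaler_nat scale_block_mx.
Qed.

Lemma pdvd_tr r s k (a : 'M[Zp]_(r, s)) : pdvd p k a -> pdvd p k a^T.
Proof. by move=> [a' ->]; exists a'^T; rewrite linearMn. Qed.

Lemma congr1_block (a b c d : M) : pdvd p 1 (a - 1%:M) -> pdvd p 1 b -> pdvd p 1 c ->
  pdvd p 1 (d - 1%:M) -> congr1_mx 1 (block_mx a b c d).
Proof.
move=> ha hb hc hd; apply/congr1_mxP.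
rewrite (@scalar_mx_block _ n n 1) opp_block_mx add_block_mx !subr0.
exact: pdvd_block.
Qed.

Lemma congr_sp_val_pdvd (g : G) : pdvd p 1 ((g : 'M_(n + n)) - 1%:M).
Proof. by apply/congr1_mxP; case: g => g /= /andP[_ /asboolP]. Qed.

Lemma congr_sp_blocks (g : G) : let a := ulsubmx (g : 'M_(n + n)) in let b := ursubmx (g : 'M_(n + n)) in
  let c := dlsubmx (g : 'M_(n + n)) in
  [/\ pdvd p 1 (a - 1%:M), pdvd p 1 b & pdvd p 1 c].
Proof.
move=> a b c; have /pdvd1P[x gx] := congr_sp_val_pdvd g.
have gE : cs_val g = 1%:M + x *+ p by rewrite -gx addrC subrK.
rewrite /a /b /c gE (@scalar_mx_block _ n n 1) -(@submxK _ n n n n x) -scaler_nat.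
rewrite scale_block_mx add_block_mx block_mxKul block_mxKur block_mxKdl addrC addKr !add0r !scaler_nat.
by split; apply/pdvd1P; [exists (ulsubmx x) | exists (ursubmx x) | exists (dlsubmx x)].
Qed.

Lemma log_exists (g : G) : exists x : M, mexp x = ulsubmx (g : 'M_(n + n)).
Proof.
have [/pdvd1P[y ay] _ _] := congr_sp_blocks g; have [x hx] := mexp_surj y; exists x.
by rewrite hx -ay addrC subrK.
Qed.

Definition lev_log (g : G) : M := projT1 (cid (log_exists g)).
(** The inverse h of the block a, given as an exponential because it arises as the limit of the Levi
    operators on linear forms. *)
Definition lev_inv (g : G) : M := mexp (- lev_log g).

Lemma lev_logE (g : G) : mexp (lev_log g) = ulsubmx (g : 'M_(n + n)).
Proof. exact: projT2 (cid (log_exists g)). Qed.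

Lemma mul_lev_inv (g : G) : ulsubmx (g : 'M_(n + n)) *m lev_inv g = 1%:M.
Proof. by rewrite -lev_logE mexpN. Qed.

Lemma lev_invM (g : G) : lev_inv g *m ulsubmx (g : 'M_(n + n)) = 1%:M.
Proof. exact/mulmx1C/mul_lev_inv. Qed.

Lemma mexp_pdvd1 r (x : 'M[Zp]_r) : pdvd p 1 (mexp x - 1%:M).
Proof. by rewrite -(mexp0 r); apply/mexp_cont/pdvd00. Qed.

Lemma symmetric_quotient (y : M) (x : M) : x = y *+ p -> x^T = x -> y^T = y.
Proof. by move=> -> h; apply: (ptf_inj (@tf n)); rewrite -linearMn. Qed.

Lemma nup_sym (g : G) : (lev_inv g *m ursubmx (g : 'M_(n + n)))^T = lev_inv g *m ursubmx (g : 'M_(n + n)).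
Proof.
have [_ h _] := symplectic_blockE g; have := congr1 (fun x => lev_inv g *m x *m (lev_inv g)^T) h.
by rewrite /= !mulmxA lev_invM mul1mx -mulmxA -!trmx_mul lev_invM trmx1 mulmx1.
Qed.

Lemma nlow_sym (g : G) : (dlsubmx (g : 'M_(n + n)) *m lev_inv g)^T = dlsubmx (g : 'M_(n + n)) *m lev_inv g.
Proof.
have [h _ _] := symplectic_blockE g; have := congr1 (fun x => (lev_inv g)^T *m x *m lev_inv g) h.
by rewrite /= !mulmxA -!trmx_mul mul_lev_inv trmx1 mul1mx -mulmxA mul_lev_inv mulmx1.
Qed.

(** Multiply a^T d - c^T b = 1 by h^T and use the symmetry of c h. The last block is thus determined
    by the other three. *)
Lemma drsubmx_lev (g : G) : drsubmx (g : 'M_(n + n)) =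
  (lev_inv g)^T + dlsubmx (g : 'M_(n + n)) *m lev_inv g *m ursubmx (g : 'M_(n + n)).
Proof.
have [_ _ h] := symplectic_blockE g; have := congr1 (fun x => (lev_inv g)^T *m x) h.
rewrite /= mulmxBr !mulmxA -trmx_mul mul_lev_inv trmx1 mul1mx mulmx1 -trmx_mul nlow_sym.
by move=> <-; rewrite subrK.
Qed.

Lemma nup_mem (b : M) : b^T = b -> block_mx 1%:M (b *+ p) 0 1%:M \in @congr_sp_mem p p_pr n.
Proof.
move=> hb; apply: symplectic_block.
- by rewrite mulmx0 trmx0 mul0mx.
- by rewrite mulmx1 trmx1 mul1mx linearMn /= hb.
- by rewrite trmx1 mul1mx trmx0 mul0mx subr0.
- apply: congr1_block; rewrite ?subrr; try exact: pdvd0.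
  by apply/pdvd1P; exists b.
Qed.

Lemma nlow_mem (c : M) : c^T = c -> block_mx 1%:M 0 (c *+ p) 1%:M \in @congr_sp_mem p p_pr n.
Proof.
move=> hc; apply: symplectic_block.
- by rewrite mulmx1 trmx1 mul1mx linearMn /= hc.
- by rewrite mulmx0 trmx0 mul0mx.
- by rewrite trmx1 mul1mx mulmx0 subr0.
- apply: congr1_block; rewrite ?subrr; try exact: pdvd0.
  by apply/pdvd1P; exists c.
Qed.

Lemma lev_mem (a : M) : block_mx (mexp a) 0 0 (mexp (- a))^T \in @congr_sp_mem p p_pr n.
Proof.
apply: symplectic_block.
- by rewrite mulmx0 trmx0 mul0mx.
- by rewrite mulmx0 trmx0 mul0mx.
- by rewrite trmx0 mul0mx subr0 -trmx_mul -{2}[a]opprK mexpN trmx1.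
- apply: congr1_block; try exact: pdvd0; first exact: mexp_pdvd1.
  by rewrite -[1%:M]trmx1 -linearB; apply/pdvd_tr/mexp_pdvd1.
Qed.

Lemma exps_sp_nup (b : M) : exp_mx (block_mx 0 b 0 0) (block_mx 1%:M (b *+ p) 0 1%:M).
Proof.
apply: exp_mxP; have h : block_mx 0 b 0 0 * block_mx 0 b 0 0 = 0 :> 'M[Zp]_(n + n).
  by rewrite [LHS]mulmx_block !mul0mx !mulmx0 !addr0 block_mx0.
have := exps_sq0 (dpow_mx _) h; rewrite -[1]/(1%:M) (@scalar_mx_block _ n n 1) -scaler_nat.
by rewrite scale_block_mx add_block_mx !scaler0 !addr0 !add0r scaler_nat.
Qed.

Lemma exps_sp_nlow (c : M) : exp_mx (block_mx 0 0 c 0) (block_mx 1%:M 0 (c *+ p) 1%:M).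
Proof.
apply: exp_mxP; have h : block_mx 0 0 c 0 * block_mx 0 0 c 0 = 0 :> 'M[Zp]_(n + n).
  by rewrite [LHS]mulmx_block !mul0mx !mulmx0 !addr0 block_mx0.
have := exps_sq0 (dpow_mx _) h; rewrite -[1]/(1%:M) (@scalar_mx_block _ n n 1) -scaler_nat.
by rewrite scale_block_mx add_block_mx !scaler0 !addr0 !add0r scaler_nat.
Qed.

Lemma exps_sp_lev (a : M) :
  exp_mx (block_mx a 0 0 (- a^T)) (block_mx (mexp a) 0 0 (mexp (- a))^T).
Proof.
apply: exp_mxP => k; have [m0 hm] := mexpP a k; have [m1 hm'] := mexpP (- a) k.
exists (maxn m0 m1) => m; rewrite geq_max => /andP[/hm h1 /hm' h2].
have aX j : (block_mx a 0 0 (- a^T) : 'M_(n + n)) ^+ j = block_mx (a ^+ j) 0 0 ((- a) ^+ j)^T.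
  elim: j => [|j IHj]; first by rewrite !expr0 trmx1 -scalar_mx_block.
  rewrite exprSr IHj [LHS]mulmx_block !mul0mx !mulmx0 !addr0 !add0r.
  congr block_mx; first by rewrite exprSr.
  by rewrite exprS trmx_mul; congr (_ *m _); rewrite linearN.
have -> : exps (fun j => (e j)%:M) (fun j => (block_mx a 0 0 (- a^T) : 'M_(n + n)) ^+ j) m =
   block_mx (exps (fun j => (e j)%:M) (fun j => a ^+ j) m) 0 0
            (exps (fun j => (e j)%:M) (fun j => (- a) ^+ j) m)^T.
  rewrite /exps; elim: {h1 h2}m => [|m IHm]; first by rewrite !big_ord0 trmx0 block_mx0.
  rewrite !big_ord_recr /= IHm aX [in LHS](_ : (e m)%:M * _ = block_mx ((e m)%:M * a ^+ m) 0 0 ((e m)%:M * (- a) ^+ m)^T).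
    by rewrite add_block_mx !addr0 linearD.
  rewrite [LHS]mul_scalar_mx scale_block_mx !scaler0; congr block_mx.
    by rewrite [RHS]mul_scalar_mx.
  by rewrite [X in _ = X^T]mul_scalar_mx linearZ.
rewrite opp_block_mx add_block_mx; apply: pdvd_block; first exact: h1.
- exact: pdvdB (pdvd0 _ _ _) (pdvd0 _ _ _).
- exact: pdvdB (pdvd0 _ _ _) (pdvd0 _ _ _).
by move/pdvd_tr: h2; rewrite linearB.
Qed.

End Factorization.
End MatrixExponential.

(** * The image of the congruence subgroup in the completed Weyl algebra *)

(** Transport of the metaplectic formula along a ring map, here from the Weyl algebra over R to its
    completion over K. *)
Lemma meta_morph (S : comNzRingType) (n : nat) (B : algebra S) (T : pzRingType)
    (J : {rmorphism B -> T}) (X D : 'I_n -> B) half (MA MB MC : 'M[S]_n)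
    (X' D' : 'I_n -> T) half' tr' (A' B' C' : 'I_n -> 'I_n -> T) :
  (forall i, J (X i) = X' i) -> (forall i, J (D i) = D' i) ->
  J (alg_in B half) = half' -> J (alg_in B (\tr MA)) = tr' ->
  (forall i j, J (alg_in B (MA i j)) = A' i j) ->
  (forall i j, J (alg_in B (MB i j)) = B' i j) ->
  (forall i j, J (alg_in B (MC i j)) = C' i j) ->
  J (meta_l X D half MA + meta_u D half MB + meta_d X half MC) =
  - (half' * tr') - (\sum_i \sum_j A' i j * (X' j * D' i))
  + half' * (\sum_i \sum_j B' i j * (D' i * D' j))
  - half' * (\sum_i \sum_j C' i j * (X' i * X' j)).
Proof.
move=> hX hD <- <- hA hB hC.
have H (Y Z : 'I_n -> 'I_n -> B) (Y' Z' : 'I_n -> 'I_n -> T) (M : 'M[S]_n) M' :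
    (forall i j, J (Y i j) = Y' i j) -> (forall i j, J (Z i j) = Z' i j) ->
    (forall i j, J (alg_in B (M i j)) = M' i j) ->
    J (\sum_i \sum_j alg_in B (M i j) * (Y i j * Z i j)) =
    \sum_i \sum_j M' i j * (Y' i j * Z' i j).
  move=> hY hZ hM; rewrite rmorph_sum; apply: eq_bigr => i _; rewrite rmorph_sum.
  by apply: eq_bigr => j _; rewrite !rmorphM hY hZ hM.
rewrite !rmorphD !rmorphN !rmorphM.
rewrite (H _ _ (fun i j => X' j) (fun i j => D' i) _ A') //.
rewrite (H _ _ (fun i j => D' i) (fun i j => D' j) _ B') //.
by rewrite (H _ _ (fun i j => X' i) (fun i j => X' j) _ C').
Qed.

Lemma meta_u0 (S : comNzRingType) (n : nat) (B : algebra S) (D : 'I_n -> B) half :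
  meta_u D half 0 = 0.
Proof.
rewrite /meta_u big1 ?mulr0 // => i _; rewrite big1 // => j _.
by rewrite mxE rmorph0 mul0r.
Qed.

Lemma meta_d0 (S : comNzRingType) (n : nat) (B : algebra S) (X : 'I_n -> B) half :
  meta_d X half 0 = 0.
Proof.
rewrite /meta_d big1 ?mulr0 ?oppr0 // => i _; rewrite big1 // => j _.
by rewrite mxE rmorph0 mul0r.
Qed.

Lemma meta_l0 (S : comNzRingType) (n : nat) (B : algebra S) (X D : 'I_n -> B) half :
  meta_l X D half 0 = 0.
Proof.
rewrite /meta_l mxtrace0 mulr0 rmorph0 oppr0 add0r big1 ?oppr0 // => i _.
by rewrite big1 // => j _; rewrite mxE rmorph0 mul0r.
Qed.

Lemma alg_in_expM (S : pzRingType) (A : algebra S) c c' q (x : A) i :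
  c * q%:R ^+ i = c' -> alg_in A c * (q%:R * x) ^+ i = alg_in A c' * x ^+ i.
Proof.
move=> <-; rewrite exprMn_comm; last exact/commr_sym/commr_nat.
by rewrite mulrA rmorphM rmorphXn rmorph_nat.
Qed.

Section ExtendedScalars.
Variables (p : nat) (p_pr : prime p) (K : fieldExtType (padic_num p_pr)).
Variable v : padic_valuation K.
Local Notation R := (valuation_ring v).

HB.instance Definition _ (A : algebra R) :=
  GRing.RMorphism.copy (@ext_in p p_pr K v A) (@base_change_in R K (val : {rmorphism R -> K}) A).

Lemma ext_in_scalar (A : algebra R) c : ext_in (alg_in A c) = alg_in (ext_scalars A) (val c).
Proof. exact: base_change_in_scalar. Qed.

Let p_neq0 : (p%:R : K) != 0.
Proof. by apply: ext_natr_neq0; apply: prime_gt0. Qed.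

Lemma ext_in_eq0 (A : algebra R) (x : A) : ext_in x = 0 -> exists N, x *+ p ^ N = 0.
Proof. by apply: base_change_in_eq0; [apply: p_neq0 | apply: base_change_val_inj | apply: ext_den]. Qed.

Lemma ext_scalars_den (A : algebra R) (y : ext_scalars A) : exists N x, y *+ p ^ N = ext_in x.
Proof. by apply: base_change_den; apply: ext_den. Qed.

Lemma ext_scalars_tf (A : algebra R) (y : ext_scalars A) N : y *+ p ^ N = 0 -> y = 0.
Proof. exact: base_change_tf. Qed.

Section Balls.
Variable A : algebra R.
Implicit Types y z : ext_scalars A.

Lemma ballE k y : in_padic_ball k y <-> exists x : A, y = ext_in x *+ p ^ k.
Proof.
split=> -[x ->]; exists x; first by rewrite rmorphM rmorphXn rmorph_nat -natrX mulr_natl.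
by rewrite rmorphM rmorphXn rmorph_nat -natrX mulr_natl.
Qed.

Lemma ball0 k : in_padic_ball k (0 : ext_scalars A).
Proof. by apply/ballE; exists 0; rewrite rmorph0 mul0rn. Qed.
Lemma ballD k y z : in_padic_ball k y -> in_padic_ball k z -> in_padic_ball k (y + z).
Proof. by move=> /ballE[a ->] /ballE[b ->]; apply/ballE; exists (a + b); rewrite rmorphD mulrnDl. Qed.
Lemma ballN k y : in_padic_ball k y -> in_padic_ball k (- y).
Proof. by move=> /ballE[a ->]; apply/ballE; exists (- a); rewrite rmorphN mulNrn. Qed.
Lemma ballM k y z : in_padic_ball k y -> in_padic_ball 0 z -> in_padic_ball k (y * z).
Proof. by move=> /ballE[a ->] /ballE[b ->]; apply/ballE; exists (a * b); rewrite rmorphM mulrnAl. Qed.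
Lemma ballMl k y z : in_padic_ball 0 y -> in_padic_ball k z -> in_padic_ball k (y * z).
Proof. by move=> /ballE[a ->] /ballE[b ->]; apply/ballE; exists (a * b); rewrite rmorphM mulrnAr. Qed.
Lemma ball_ext x : in_padic_ball 0 (ext_in x : ext_scalars A).
Proof. by apply/ballE; exists x. Qed.

Definition ball_tends (u : nat -> ext_scalars A) (l : ext_scalars A) : Prop :=
  forall k, exists m0, forall m, (m0 <= m)%N -> in_padic_ball k (u m - l).

Lemma ball_tendsM u u' l l' : (forall m, in_padic_ball 0 (u m)) -> (forall m, in_padic_ball 0 (u' m)) ->
  ball_tends u l -> ball_tends u' l' -> ball_tends (fun m => u m * u' m) (l * l').
Proof.
move=> hu hu' h h' k; have [m0 hm] := h k; have [m1 hm'] := h' k.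
have l_int : in_padic_ball 0 l.
  have [m2 h2] := h 0%N; have := ballD (ballN (h2 m2 (leqnn _))) (hu m2).
  by rewrite opprB subrK.
exists (maxn m0 m1) => m; rewrite geq_max => /andP[/hm a /hm' b].
rewrite -(subrKA (l * u' m)) -mulrBl -mulrBr.
by apply: ballD; [apply: ballM | apply: ballMl].
Qed.

End Balls.
End ExtendedScalars.

(** * The composite on exponentials of Lie algebra elements *)

Section Representation.
Variables (p : nat) (p_pr : prime p) (K : fieldExtType (padic_num p_pr)).
Variables (v : padic_valuation K) (n : nat).
Local Notation Zp := (padic_int p_pr).
Local Notation R := (valuation_ring v).
Local Notation G := (congr_sp p_pr n).
Local Notation W := (weyl_alg R n).
Local Notation toR := (padic_to_vring v).
Local Notation toRmx := (map_mx (padic_to_vring v)).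

Definition weyl_ext (w : W) : completed_weyl v n := ext_in (ilim_cst _ w : weyl_hat v n).
HB.instance Definition _ := GRing.RMorphism.copy weyl_ext
  (@ext_in p p_pr K v (weyl_hat v n) \o ilim_cst (padic_ideal p W)).

Lemma weyl_ext_in r : weyl_ext (alg_in W r) = alg_in _ (val r).
Proof. exact: (@ext_in_scalar p p_pr K v (weyl_hat v n) r). Qed.

Lemma weyl_extM a b : weyl_ext (a * b) = weyl_ext a * weyl_ext b.
Proof. exact: rmorphM. Qed.

Lemma weyl_extX a k : weyl_ext (a ^+ k) = weyl_ext a ^+ k.
Proof. exact: rmorphXn. Qed.

Lemma weyl_ext_int w : in_padic_ball 0 (weyl_ext w).
Proof. exact: ball_ext. Qed.

(** Divisibility in the completed algebra is known only up to p-power torsion; an additive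
    functional with values in R forgets the torsion. This is how numerical information is extracted
    from the Weyl algebra. *)
Lemma weyl_ext_ball (f : {additive W -> R}) k w : in_padic_ball k (weyl_ext w) -> pdvd p k (f w).
Proof.
move=> /ballE[x hx].
have : ext_in ((ilim_cst _ w : weyl_hat v n) - x *+ p ^ k) = 0.
  by rewrite rmorphB rmorphMn -hx subrr.
(* The relation is read modulo p^(k+N), so that p^k remains after p^N has been cancelled in R. *)
move=> /ext_in_eq0[N /(congr1 (fun y : ilim (padic_ideal p W) => y (k + N)%N)) hN].
pose xl := generic_quotient.repr (ilim_val x (k + N)).
have compMn (y : weyl_hat v n) l d : ilim_val (y *+ d) l = ilim_val y l *+ d.
  by elim: d => [|d IHd]; rewrite ?mulr0n //= ?rmorph0 // !mulrS -IHd.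
have : qpi (padic_ideal p W (k + N)) ((w - xl *+ p ^ k) *+ p ^ N) = qpi _ 0.
  move: hN; rewrite compMn /= rmorph0 => <-.
  rewrite rmorphMn rmorphB rmorphMn /= qpi_repr; congr ((_ - _) *+ _).
  by rewrite -compMn.
move/qpi_eqP; rewrite subr0 => /padic_idealE /(pdvd_additive f).
rewrite raddfMn raddfB raddfMn => /vring_pdvd_muln_inj h.
by apply: (pdvd_transr h); exists (f xl).
Qed.

Variables (iota : alg_hom (iwasawa_alg v n) (affinoid_env v n)).
Variables (rho : alg_hom (affinoid_env v n) (completed_weyl v n)).
Hypothesis hiota : is_iwasawa_embedding iota.
Hypothesis hrho : is_metaplectic rho.
Variables (e : nat -> Zp) (half : Zp).
Hypothesis eE : forall j, e j *+ j`! = p%:R ^+ j.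
Hypothesis he : dpow p e.
Hypothesis half2 : half *+ 2 = 1.

Local Notation phi g := (rho (iota (iwasawa_in v g))).
Let be j : W := alg_in W (toR (e j)).

(** The metaplectic formula in the uncompleted Weyl algebra over R, where polynomials are acted
    upon; it makes sense there because [half] is integral. *)
Definition weyl_of_sp (X : sp Zp n) : W :=
  meta_l (weyl_X R (n := n)) (weyl_D R (n := n)) (toR half) (toRmx (ulsubmx (sp_val X)))
  + meta_u (weyl_D R (n := n)) (toR half) (toRmx (ursubmx (sp_val X)))
  + meta_d (weyl_X R (n := n)) (toR half) (toRmx (dlsubmx (sp_val X))).

Lemma val_half : val (toR half) = 2%:R^-1.
Proof.
have two : (2%:R : K) != 0 by apply: ext_natr_neq0.
apply: (mulIf two); rewrite mulVf //= mulr_natr.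
by rewrite -[LHS](rmorphMn (@padic_to_ext p p_pr K)) half2 rmorph1.
Qed.

Lemma rho_affinoid X : rho (affinoid_in v X) = weyl_ext (weyl_of_sp X).
Proof.
rewrite (metaplectic_lie hrho) /metaplectic_formula /weyl_of_sp.
apply/esym; apply: (meta_morph (J := weyl_ext)) => [i|i|||i j|i j|i j].
- by [].
- by [].
- by apply: (etrans (weyl_ext_in _)); rewrite val_half.
- by apply: (etrans (weyl_ext_in _)); rewrite trace_map_mx.
- by apply: (etrans (weyl_ext_in _)); rewrite mxE.
- by apply: (etrans (weyl_ext_in _)); rewrite mxE.
- by apply: (etrans (weyl_ext_in _)); rewrite mxE.
Qed.

(** The embedding sends g to the sum of the exponential series, and continuity of [rho] carries the
    partial sums to those of the Weyl operator. *)
Lemma phi_exp X g : exp_mx (sp_val X) (cs_val g) ->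
  ball_tends (fun m => weyl_ext (exps be (fun j => weyl_of_sp X ^+ j) m)) (phi g).
Proof.
move=> hX k; have [j hj] := metaplectic_continuous hrho k.
have [m0 hm] := iwasawa_embedding_exp hiota hX j.
exists m0 => m /hm[b /ballE[x bE] h].
have : in_padic_ball k (rho (p%:R ^+ j * b)).
  by apply: hj; apply/ballE; exists x; rewrite bE -natrX mulr_natl.
rewrite -h rmorphB rmorph_sum; congr (in_padic_ball k (_ - _)).
rewrite /exps rmorph_sum; apply: eq_bigr => i _.
rewrite rmorphM alg_fun_in rmorphXn rmorphM rmorph_nat rho_affinoid.
apply: etrans _ (esym (weyl_extM (be i) _)); rewrite weyl_ext_in weyl_extX.
apply: alg_in_expM.
have i0 : (i`!%:R : K) != 0 by apply: ext_natr_neq0; apply: fact_gt0.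
apply: (mulfI i0); rewrite mulrA mulfV // mul1r /= mulr_natl.
by rewrite -[RHS](rmorphMn (@padic_to_ext p p_pr K)) eE rmorphXn rmorph_nat.
Qed.

End Representation.

(** * Group rings *)

Lemma alg_in_swap (S : pzRingType) (A : algebra S) c (x y : A) :
  x * (alg_in A c * y) = alg_in A c * (x * y).
Proof. by rewrite !mulrA alg_comm. Qed.

Section GroupAlgebra.
Variables (S : comNzRingType) (G : groupType).
Local Notation SG := (group_alg S G).

Definition group_sum (l : seq (S * G)) : SG := \sum_(y <- l) alg_in SG y.1 * group_in S y.2.

Lemma group_in1 : group_in S (1%g : G) = 1.
Proof. by rewrite -(rmorph1 (qpi _)); apply/qpi_eqP/ideal_gen_in; constructor. Qed.

Lemma group_inM (g h : G) : group_in S (g * h)%g = group_in S g * group_in S h.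
Proof. by rewrite /group_in -rmorphM; apply/qpi_eqP/ideal_gen_in; constructor. Qed.

Lemma group_sum_cat l l' : group_sum (l ++ l') = group_sum l + group_sum l'.
Proof. exact: big_cat. Qed.

Lemma group_sum_translate g l :
  group_in S g * group_sum l = group_sum [seq (y.1, (g * y.2)%g) | y <- l].
Proof.
rewrite /group_sum big_map [LHS]mulr_sumr; apply: eq_bigr => y _.
by rewrite [in RHS]group_inM; exact: (@alg_in_swap S SG y.1 (group_in S g) (group_in S y.2)).
Qed.

Lemma group_sum_scale c l :
  alg_in SG c * group_sum l = group_sum [seq (c * y.1, y.2) | y <- l].
Proof.
rewrite /group_sum big_map [LHS]mulr_sumr; apply: eq_bigr => y _.
exact: (etrans (mulrA _ _ _) (congr1 (fun z => z * _) (esym (rmorphM (alg_in SG) c y.1)))).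
Qed.

Lemma group_sumP (x : SG) : exists l, x = group_sum l.
Proof.
elim/quot_ind: x; apply: free_alg_ind => [|a b [l1 e1] [l2 e2]|c|g a [l el]|c a [l el]].
- by exists [::]; rewrite /group_sum big_nil; apply: rmorph0.
- exists (l1 ++ l2); rewrite group_sum_cat -e1 -e2; exact: rmorphD.
- exists [:: (c, 1%g)]; rewrite /group_sum big_seq1 group_in1 mulr1; exact: erefl.
- exists [seq (y.1, (g * y.2)%g) | y <- l]; rewrite -group_sum_translate -el.
  exact: (rmorphM (qpi _) (free_gen S g) a).
- exists [seq (c * y.1, y.2) | y <- l]; rewrite -group_sum_scale -el.
  exact: (rmorphM (qpi _) (alg_in _ c) a).
Qed.

Local Notation V := (G -> S^o).

Lemma translate_linear (g : G) : linear (fun (F : V) (h : G) => F (h * g)%g).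
Proof. by move=> c F F'; apply: functional_extensionality_dep. Qed.

Lemma translate_rel_gen (T : {rmorphism free_alg S G -> endo_alg V}) a :
  (forall g, T (free_gen S g) = Endo (translate_linear g)) -> group_rel a -> T a = 0.
Proof.
move=> TE; case=> [|g h].
  rewrite rmorphB rmorph1 TE; apply: endoP => F; apply: functional_extensionality_dep => x.
  by rewrite -[LHS]/(F (x * 1)%g - F x) mulg1; apply: subrr.
rewrite rmorphB [T (_ * _)]rmorphM !TE; apply: endoP => F; apply: functional_extensionality_dep => x.
by rewrite -[LHS]/(F (x * (g * h))%g - F (x * g * h)%g) mulgA; apply: subrr.
Qed.

Lemma translate_rel a : group_rel a -> fev (fun g => Endo (translate_linear g) : endo_alg V) a = 0.
Proof. by apply: translate_rel_gen => g; apply: fev_gen. Qed.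

(** Right translation of functions lets an element of the group algebra, given only by generators
    and relations, be paired with functions on the group. *)
Definition translate : SG -> endo_alg V := quot_lift (fev (fun g => Endo (translate_linear g) : endo_alg V)).
Lemma translate_zmod : zmod_morphism translate.
Proof. exact: quot_lift_zmod translate_rel. Qed.
Lemma translate_monoid : monoid_morphism translate.
Proof. exact: quot_lift_monoid translate_rel. Qed.
HB.instance Definition _ := GRing.isZmodMorphism.Build _ _ translate translate_zmod.
HB.instance Definition _ := GRing.isMonoidMorphism.Build _ _ translate translate_monoid.

Lemma translate_in c : translate (alg_in SG c) = alg_in (endo_alg V) c.
Proof. exact: (etrans (quot_liftE translate_rel (alg_in _ c)) (fev_in _ c)). Qed.
Lemma translate_gen g F h : translate (group_in S g) F h = F (h * g)%g.
Proof.
have -> : translate (group_in S g) = Endo (translate_linear g) by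
  exact: (etrans (quot_liftE translate_rel (free_gen S g)) (fev_gen _ g)).
by [].
Qed.

Lemma translateM a b : translate (a * b) = translate a * translate b.
Proof. exact: rmorphM. Qed.
Lemma translateD a b F z : translate (a + b) F z = translate a F z + translate b F z.
Proof. by rewrite rmorphD. Qed.
Lemma translateB a b F z : translate (a - b) F z = translate a F z - translate b F z.
Proof. by rewrite rmorphB. Qed.
Lemma translate_scale c a F z : translate (alg_in SG c * a) F z = c * translate a F z.
Proof. by rewrite translateM translate_in. Qed.

Lemma translate_sum l F z : translate (group_sum l) F z = \sum_(y <- l) y.1 * F (z * y.2)%g.
Proof.
elim: l => [|y l IHl]; first by rewrite /group_sum !big_nil rmorph0.
rewrite /group_sum !big_cons -/(group_sum l) translateD IHl; congr (_ + _).
by rewrite translate_scale translate_gen.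
Qed.

(** The generators [group_in S g - 1] with [N g] annihilate the functions invariant under insertion
    of [g], and translations preserve that invariance; so the whole ideal annihilates such
    functions. Evaluating at 1 gives the sums. *)
Lemma coset_sum_wd (N : G -> Prop) l l' (F : G -> S) :
  (forall g, N g -> forall h k, F (h * g * k)%g = F (h * k)%g) ->
  ideal_gen (fun a : SG => exists2 g, N g & a = group_in S g - 1) (group_sum l - group_sum l') ->
  \sum_(y <- l) y.1 * F y.2 = \sum_(y <- l') y.1 * F y.2.
Proof.
move=> hF hI; pose inv (F : V) := forall g, N g -> forall h k, F (h * g * k)%g = F (h * k)%g.
have invT a F' : inv F' -> inv (translate a F').
  move=> hF'; have [la ->] := group_sumP a => g Ng h k; rewrite !translate_sum.
  by apply: eq_bigr => y _; rewrite -!mulgA [(h * (g * _))%g]mulgA (hF' g Ng).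
suff H F' : inv F' -> translate (group_sum l - group_sum l') F' = 0.
  have := congr1 (fun F' : V => F' 1%g) (H F hF); rewrite translateB !translate_sum => /eqP.
  rewrite subr_eq0 => /eqP.
  rewrite (eq_bigr (fun y => y.1 * F y.2)) => [|y _]; last by rewrite mul1g.
  by rewrite [RHS](eq_bigr (fun y => y.1 * F y.2)) => [|y _]; last by rewrite mul1g.
elim: hI F' => [|b [g Ng ->]|b c _ hb _ hc|c b _ hb|b c _ hb] F' hF'.
- by rewrite rmorph0.
- apply: functional_extensionality_dep => x; rewrite translateB translate_gen rmorph1 endo_oneE.
  by have := hF' g Ng x 1%g; rewrite !mulg1 => ->; apply: subrr.
- by apply: functional_extensionality_dep => x; rewrite translateD hb // hc // addr0.
- by rewrite translateM endo_mulE hb // raddf0.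
- by rewrite translateM endo_mulE hb //; apply: invT.
Qed.

End GroupAlgebra.

Section SpElements.
Variables (p : nat) (p_pr : prime p) (n : nat).
Local Notation Zp := (padic_int p_pr).
Local Notation M := 'M[Zp]_n.

Lemma sp_upper_mem (b : M) : b^T = b -> block_mx 0 b 0 0 \in @sp_mem Zp n.
Proof.
move=> hb; rewrite unfold_in block_mxKul block_mxKur block_mxKdl block_mxKdr.
by rewrite hb !trmx0 oppr0 !eqxx.
Qed.
Lemma sp_lower_mem (c : M) : c^T = c -> block_mx 0 0 c 0 \in @sp_mem Zp n.
Proof.
move=> hc; rewrite unfold_in block_mxKul block_mxKur block_mxKdl block_mxKdr.
by rewrite hc !trmx0 oppr0 !eqxx.
Qed.
Lemma sp_levi_mem (a : M) : block_mx a 0 0 (- a^T) \in @sp_mem Zp n.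
Proof.
rewrite unfold_in block_mxKul block_mxKur block_mxKdl block_mxKdr.
by rewrite !trmx0 !eqxx.
Qed.
End SpElements.

Lemma block_bigcell (S : pzRingType) (n : nat) (a b c h : 'M[S]_n) :
  a *m h = 1%:M -> h *m a = 1%:M ->
  block_mx 1%:M 0 (c *m h) 1%:M *m block_mx a 0 0 h^T *m block_mx 1%:M (h *m b) 0 1%:M =
  block_mx a b c (h^T + c *m h *m b).
Proof.
move=> ah ha; rewrite !mulmx_block !mul1mx !mul0mx !mulmx0 !addr0 !add0r !mulmx1.
rewrite -[c *m h *m a]mulmxA ha mulmx1 !mulmxA ah mul1mx.
by congr block_mx; [exact: addr0 | exact: addrC].
Qed.

(** * The Gaussian symbol of a group element *)

Section Integral.
Variables (p : nat) (p_pr : prime p) (K : fieldExtType (padic_num p_pr)).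
Variables (v : padic_valuation K) (n : nat).
Local Notation Zp := (padic_int p_pr).
Local Notation R := (valuation_ring v).
Local Notation G := (congr_sp p_pr n).
Local Notation W := (weyl_alg R n).
Local Notation toR := (padic_to_vring v).
Local Notation toRmx := (map_mx (padic_to_vring v)).
Variables (iota : alg_hom (iwasawa_alg v n) (affinoid_env v n)).
Variables (rho : alg_hom (affinoid_env v n) (completed_weyl v n)).
Hypothesis hiota : is_iwasawa_embedding iota.
Hypothesis hrho : is_metaplectic rho.
Variables (e : nat -> Zp) (half : Zp).
Hypothesis eE : forall j, e j *+ j`! = p%:R ^+ j.
Hypothesis he : dpow p e.
Hypothesis half2 : half *+ 2 = 1.
Local Notation phi g := (rho (iota (iwasawa_in v g))).
Let be j : W := alg_in W (toR (e j)).

Definition zexp : Zp -> Zp := pexp (@padic_complete p p_pr) he.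
(** This is det(a)^(-1/2): as a = e^(p L) with L = [lev_log he g], it is e^(- p tr(L) / 2). *)
Definition gauss_coef (g : G) : Zp := zexp (- (half * \tr (lev_log he g))).
Definition gauss_form (x u : 'cV[Zp]_n) (g : G) : Zp :=
  (x^T *m ((lev_inv he g)^T *m u)) 0 0 - half * quadval (dlsubmx (g : 'M_(n + n)) *m lev_inv he g) x
  + half * quadval (lev_inv he g *m ursubmx (g : 'M_(n + n))) u.

Lemma bigcell (g : G) : exists (b c : 'M[Zp]_n) (hb : b^T = b) (hc : c^T = c),
  [/\ lev_inv he g *m ursubmx (g : 'M_(n + n)) = b *+ p, dlsubmx (g : 'M_(n + n)) *m lev_inv he g = c *+ p &
    g = (CongrSp (nlow_mem hc) * CongrSp (lev_mem he (lev_log he g)) * CongrSp (nup_mem hb))%g].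
Proof.
have [_ /pdvd1P[b' hb'] /pdvd1P[c' hc']] := congr_sp_blocks g.
have hB : lev_inv he g *m ursubmx (g : 'M_(n + n)) = (lev_inv he g *m b') *+ p.
  by rewrite hb' -scaler_nat -scalemxAr scaler_nat.
have hC : dlsubmx (g : 'M_(n + n)) *m lev_inv he g = (c' *m lev_inv he g) *+ p.
  by rewrite hc' -scaler_nat -scalemxAl scaler_nat.
have sB := symmetric_quotient hB (nup_sym he g); have sC := symmetric_quotient hC (nlow_sym he g).
exists _, _, sB, sC; split=> //; apply: val_inj => /=.
rewrite -hB -hC lev_logE -/(lev_inv he g) (block_bigcell _ _ (mul_lev_inv he g) (lev_invM he g)).
by rewrite -drsubmx_lev submxK.
Qed.

Lemma dpow_vring : dpow p (fun j => toR (e j)).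
Proof.
split=> [j x||||].
- exact: mulrC.
- by rewrite (dpow0 he) rmorph1.
- by rewrite (dpow1 he) rmorph_nat.
- by move=> i j; rewrite -rmorphM (dpowM he) rmorphMn.
- by move=> j j0; apply/pdvd_additive/(dpow_dvd he).
Qed.

Lemma lev_inv_tends (g : G) :
  tends p (exps (fun j => (toR (e j))%:M) (fun j => (- toRmx (lev_log he g)) ^+ j)) (toRmx (lev_inv he g)).
Proof.
pose f : {additive 'M[Zp]_n -> 'M[R]_n} := map_mx toR.
have fM a b : f (a * b) = f a * f b by exact: map_mxM.
move=> k; have [m0 hm] := mexpP he (- lev_log he g) k; exists m0 => m /hm.
move/(pdvd_additive f); rewrite raddfB; congr (pdvd p k (_ - _)).
rewrite raddf_sum; apply: eq_bigr => j _; rewrite fM; congr (_ * _).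
  exact: map_scalar_mx.
elim: (nat_of_ord j) => [|i IHi]; first exact: map_mx1.
by rewrite !exprS fM IHi raddfN.
Qed.

Lemma gauss_coef_tends (g : G) :
  tends p (exps (fun j => toR (e j)) (fun j => (- (toR half * \tr (toRmx (lev_log he g)))) ^+ j))
    (toR (gauss_coef g)).
Proof.
have := tends_morph (padic_to_vring v) (pexpP (@padic_complete p p_pr) he (- (half * \tr (lev_log he g)))).
apply: tends_ext => m; rewrite rmorph_exps; apply: eq_bigr => j _; congr (_ * _).
by rewrite rmorphXn rmorphN rmorphM trace_map_mx.
Qed.

Lemma quadval_map (A : 'M[Zp]_n) (x : 'cV[Zp]_n) : quadval (toRmx A) (toRmx x) = toR (quadval A x).
Proof. by rewrite /quadval map_trmx -!map_mxM mxE. Qed.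

Lemma quadvalMn (A : 'M[Zp]_n) (x : 'cV[Zp]_n) d : quadval (A *+ d) x = quadval A x *+ d.
Proof. by rewrite /quadval -[A *+ d]scaler_nat -scalemxAr -scalemxAl mxE mulr_natl. Qed.

Lemma iwasawa_inM (g1 g2 : G) : iwasawa_in v (g1 * g2)%g = iwasawa_in v g1 * iwasawa_in v g2.
Proof. by rewrite /iwasawa_in group_inM rmorphM; exact: rmorphM. Qed.

(** The approximants are products of three truncated exponentials, so they lie in the Weyl algebra
    itself, where [theta] applies. The limit is described through d! and (2d)!, without a division
    in R. *)
Lemma weyl_approx (g : G) : exists D : nat -> W,
  ball_tends (fun m => weyl_ext (D m)) (phi g) /\
  forall d x u, exists t,
    tends p (fun m => theta (@weyl_act R n) d (toRmx x) (toRmx u) (D m)) t /\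
    d`!%:R * t = (d.*2)`!%:R * (toR (gauss_coef g) * toR (gauss_form x u g) ^+ d).
Proof.
have [b [c [sb [sc [hb hc gE]]]]] := bigcell g.
set a := lev_log he g in gE *.
pose D1 m := exps be (fun j => meta_d (weyl_X R (n := n)) (toR half) (toRmx c) ^+ j) m.
pose D2 m := exps be (fun j => meta_l (weyl_X R (n := n)) (weyl_D R (n := n)) (toR half) (toRmx a) ^+ j) m.
pose D3 m := exps be (fun j => meta_u (weyl_D R (n := n)) (toR half) (toRmx b) ^+ j) m.
exists (fun m => D1 m * D2 m * D3 m); split.
  have -> : phi g = phi (CongrSp (nlow_mem sc)) * phi (CongrSp (lev_mem he a)) * phi (CongrSp (nup_mem sb)).
    by rewrite [in LHS]gE !iwasawa_inM !rmorphM.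
  have P1 := @phi_exp _ _ _ _ _ _ _ hiota hrho e half eE half2 (Sp (sp_lower_mem sc)) _ (exps_sp_nlow eE he c : exp_mx _ (cs_val (CongrSp (nlow_mem sc)))).
  have P2 := @phi_exp _ _ _ _ _ _ _ hiota hrho e half eE half2 (Sp (sp_levi_mem a)) _ (exps_sp_lev eE he a : exp_mx _ (cs_val (CongrSp (lev_mem he a)))).
  have P3 := @phi_exp _ _ _ _ _ _ _ hiota hrho e half eE half2 (Sp (sp_upper_mem sb)) _ (exps_sp_nup eE he b : exp_mx _ (cs_val (CongrSp (nup_mem sb)))).
  have E1 : weyl_of_sp v half (Sp (sp_lower_mem sc)) = meta_d (weyl_X R (n := n)) (toR half) (toRmx c).
    by rewrite /weyl_of_sp block_mxKul block_mxKur block_mxKdl !map_mx0 meta_l0 meta_u0 !add0r.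
  have E2 : weyl_of_sp v half (Sp (sp_levi_mem a)) = meta_l (weyl_X R (n := n)) (weyl_D R (n := n)) (toR half) (toRmx a).
    by rewrite /weyl_of_sp block_mxKul block_mxKur block_mxKdl !map_mx0 meta_u0 meta_d0 !addr0.
  have E3 : weyl_of_sp v half (Sp (sp_upper_mem sb)) = meta_u (weyl_D R (n := n)) (toR half) (toRmx b).
    by rewrite /weyl_of_sp block_mxKul block_mxKur block_mxKdl !map_mx0 meta_l0 meta_d0 add0r addr0.
  rewrite E1 in P1; rewrite E2 in P2; rewrite E3 in P3.
  have P12 := ball_tendsM (fun m => weyl_ext_int _) (fun m => weyl_ext_int _) P1 P2.
  have P123 := ball_tendsM _ (fun m => weyl_ext_int _) P12 P3.
  move=> k; have [m|m0 hm] := P123 _ k; first by rewrite -weyl_extM; apply: weyl_ext_int.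
  by exists m0 => m /hm; rewrite /D1 /D2 /D3 !weyl_extM.
move=> d x u.
have := theta_tends (@weyl_act_X R n) (@weyl_act_D R n) (@weyl_act_in R n) dpow_vring (toRmx b) (toRmx c) (lev_inv_tends g) (gauss_coef_tends g) d (toRmx x) (toRmx u).
set t := (_ * _) => ht; exists t; split; first exact: ht.
have toRE j : toR (e j) *+ j`! = p%:R ^+ j by rewrite -rmorphMn eE rmorphXn rmorph_nat.
rewrite /t mulrCA (theta_sumE toRE) mulrCA; congr (_ * (_ * _ ^+ _)).
rewrite !quadval_map map_trmx map_trmx -!map_mxM mxE /gauss_form hb hc !quadvalMn.
rewrite rmorphD rmorphB !rmorphM !rmorphMn.
by rewrite !mulNr mulrN !mulr_natl -!mulrnAr.
Qed.

End Integral.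

(** * Functions annihilated by an element of the kernel *)

Section BallSums.
Variables (p : nat) (p_pr : prime p) (K : fieldExtType (padic_num p_pr)).
Variables (v : padic_valuation K) (A : algebra (valuation_ring v)).
Lemma ball_tends_sum I (r : seq I) (u : I -> nat -> ext_scalars A) (l : I -> ext_scalars A) :
  (forall i, ball_tends (u i) (l i)) ->
  ball_tends (fun m => \sum_(i <- r) u i m) (\sum_(i <- r) l i).
Proof.
move=> h; elim: r => [|i r IHr] k.
  by exists 0%N => m _; rewrite !big_nil subrr; apply: ball0.
have [m hm] := h i k; have [m' hm'] := IHr k.
exists (maxn m m') => j; rewrite geq_max => /andP[/hm h1 /hm' h2].
by rewrite !big_cons opprD addrACA; apply: ballD.
Qed.
Lemma ball_tendsZ (c : valuation_ring v) (u : nat -> ext_scalars A) l : ball_tends u l ->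
  ball_tends (fun m => alg_in (ext_scalars A) (val c) * u m) (alg_in (ext_scalars A) (val c) * l).
Proof.
move=> h k; have [m hm] := h k; exists m => j /hm; rewrite -mulrBr => hj.
by apply: ballMl hj; rewrite -ext_in_scalar; apply: ball_ext.
Qed.
End BallSums.

(** * Integrals against an element of the Iwasawa algebra *)

Section NullFunctions.
Variables (p : nat) (p_pr : prime p) (K : fieldExtType (padic_num p_pr)).
Variables (v : padic_valuation K) (n : nat).
Local Notation Zp := (padic_int p_pr).
Local Notation R := (valuation_ring v).
Local Notation G := (congr_sp p_pr n).

Variable s : iwasawa_RG v n.

Definition lifts (N : open_normal p_pr n) (l : seq (R * G)) : Prop :=
  ilim_val s N = qpi _ (group_sum l).

Lemma lifts_exists N : exists l, lifts N l.
Proof.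
have [l hl] := group_sumP (generic_quotient.repr (ilim_val s N)).
by exists l; rewrite /lifts -hl qpi_repr.
Qed.

Lemma lifts_sub (N N' : open_normal p_pr n) l : (forall g, N g -> N' g) -> lifts N l -> lifts N' l.
Proof.
move=> NN'; apply: ilim_compat => a; elim=> [|b [g Ng ->]|b c _ hb _ hc|c b _ hb|b c _ hb].
- exact: ideal_gen0.
- by apply: ideal_gen_in; exists g => //; apply: NN'.
- exact: ideal_genD.
- exact: ideal_genMl.
- exact: ideal_genMr.
Qed.

Lemma open_normalI (N N' : open_normal p_pr n) :
  exists M : open_normal p_pr n, (forall g, M g -> N g) /\ (forall g, M g -> N' g).
Proof.
pose T g := N g /\ N' g.
have T1 : T 1%g by split; apply: on1.
have TM g h : T g -> T h -> T (g * h)%g by move=> [a b] [c d]; split; apply: onM.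
have TV g : T g -> T (g^-1)%g by move=> [a b]; split; apply: onV.
have TJ g h : T g -> T (h^-1 * g * h)%g by move=> [a b]; split; apply: onJ.
have TO : exists k, forall g : G, congr1_mx k g -> T g.
  have [k hk] := on_open N; have [k' hk'] := on_open N'; exists (maxn k k') => g /congr1_mxP hg.
  split; [apply: hk | apply: hk']; apply/congr1_mxP/(pdvdW _ hg);
  by rewrite ?leq_maxl ?leq_maxr.
by exists (OpenNormal T1 TM TV TJ TO); split=> g [].
Qed.

(* "The measure [s] of [F] is divisible by [p ^ k]", [F] being a bounded but *)
(* possibly discontinuous function: [F] is summed over arbitrary lifts of [s]. *)
Definition nullM (k : nat) (F : G -> R) : Prop :=
  exists N, forall l, lifts N l -> pdvd p k (\sum_(y <- l) y.1 * F y.2).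
Definition null (F : G -> R) : Prop := forall k, nullM k F.

Lemma nullM_approx k (F F' : G -> R) : (forall g, pdvd p k (F g - F' g)) ->
  nullM k F' -> nullM k F.
Proof.
move=> h [N hN]; exists N => l /hN; apply: pdvd_transr.
by rewrite -sumrB; apply: pdvd_sum => y _; rewrite -mulrBr; apply: pdvdMl.
Qed.

Lemma nullM_ext k (F F' : G -> R) : (forall g, F g = F' g) -> nullM k F' -> nullM k F.
Proof. by move=> h; apply: nullM_approx => g; rewrite h subrr; apply: pdvd0. Qed.

Lemma null_ext (F F' : G -> R) : (forall g, F g = F' g) -> null F' -> null F.
Proof. by move=> h hF k; apply: nullM_ext h (hF k). Qed.

Lemma nullM0 k : nullM k (fun=> 0).
Proof.
have [N _] : exists N : open_normal p_pr n, True.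
  by unshelve eexists (@OpenNormal p p_pr n (fun=> True) _ _ _ _ _) => //; exists 0%N.
exists N => l _; rewrite big1 => [|y _]; first exact: pdvd0.
by rewrite mulr0.
Qed.

Lemma nullMD k F F' : nullM k F -> nullM k F' -> nullM k (fun g => F g + F' g).
Proof.
move=> [N hN] [N' hN']; have [M [MN MN']] := open_normalI N N'.
exists M => l hl; under eq_bigr do rewrite mulrDr.
by rewrite big_split; apply: pdvdD; [apply/hN/(lifts_sub MN) | apply/hN'/(lifts_sub MN')].
Qed.

Lemma nullMZ k r F : nullM k F -> nullM k (fun g => r * F g).
Proof.
move=> [N hN]; exists N => l /hN h; under eq_bigr do rewrite mulrCA.
by rewrite -mulr_sumr; apply: pdvdMl.
Qed.

Lemma nullM_sum k I (r : seq I) (F : I -> G -> R) :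
  (forall i, nullM k (F i)) -> nullM k (fun g => \sum_(i <- r) F i g).
Proof.
move=> h; elim: r => [|i r IHr].
  by apply: nullM_ext (nullM0 k) => g; rewrite big_nil.
by apply: nullM_ext (nullMD (h i) IHr) => g; rewrite big_cons.
Qed.

Lemma nullM_saturated k l F : nullM (k + l) (fun g => F g *+ p ^ l) -> nullM k F.
Proof.
move=> [N hN]; exists N => a /hN h; apply: (vring_pdvd_muln_inj (l := l)).
by move: h; under eq_bigr do rewrite mulrnAr; rewrite sumrMnl.
Qed.

Lemma nullD F F' : null F -> null F' -> null (fun g => F g + F' g).
Proof. by move=> h h' k; apply: nullMD. Qed.
Lemma nullZ r F : null F -> null (fun g => r * F g).
Proof. by move=> h k; apply: nullMZ. Qed.
Lemma null_sum I (r : seq I) (F : I -> G -> R) :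
  (forall i, null (F i)) -> null (fun g => \sum_(i <- r) F i g).
Proof. by move=> h k; apply: nullM_sum => i; apply: h. Qed.
Lemma null_saturated l F : null (fun g => F g *+ p ^ l) -> null F.
Proof. by move=> h k; apply: nullM_saturated (h (k + l)%N). Qed.

Variables (iota : alg_hom (iwasawa_alg v n) (affinoid_env v n)).
Variables (rho : alg_hom (affinoid_env v n) (completed_weyl v n)).
Hypothesis hiota : is_iwasawa_embedding iota.
Hypothesis hrho : is_metaplectic rho.
Variables (e : nat -> Zp) (half : Zp).
Hypothesis eE : forall j, e j *+ j`! = p%:R ^+ j.
Hypothesis he : dpow p e.
Hypothesis half2 : half *+ 2 = 1.
Local Notation toR := (padic_to_vring v).
Local Notation phi g := (rho (iota (iwasawa_in v g))).

Definition iwasawa_sum (l : seq (R * G)) : iwasawa_alg v n :=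
  ext_in (ilim_cst _ (group_sum l) : iwasawa_RG v n).

Lemma phi_sum l :
  rho (iota (iwasawa_sum l)) = \sum_(y <- l) alg_in (completed_weyl v n) (val y.1) * phi y.2.
Proof.
have J : iwasawa_sum l = \sum_(y <- l) alg_in (iwasawa_alg v n) (val y.1) * iwasawa_in v y.2.
  rewrite /iwasawa_sum /group_sum rmorph_sum rmorph_sum; apply: eq_bigr => y _.
  have E1 : ilim_cst (fun (N : open_normal p_pr n) a => exists2 g, N g & a = group_in R g - 1)
     (alg_in (group_alg R G) y.1 * group_in R y.2) =
     alg_in (iwasawa_RG v n) y.1 * ilim_cst _ (group_in R y.2) by exact: rmorphM.
  apply: (etrans (congr1 (fun z : iwasawa_RG v n => ext_in z) E1)).
  have E2 (a b : iwasawa_RG v n) : ext_in (a * b) = ext_in a * ext_in b by exact: rmorphM.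
  apply: (etrans (E2 _ _)).
  exact: (congr1 (fun z : iwasawa_alg v n => z * iwasawa_in v y.2)
    (@ext_in_scalar p p_pr K v (iwasawa_RG v n) y.1)).
rewrite J rmorph_sum rmorph_sum; apply: eq_bigr => y _.
have M1 (a b : iwasawa_alg v n) : rho (iota (a * b)) = rho (iota a) * rho (iota b).
  by rewrite !rmorphM.
by apply: etrans (M1 _ _) _; rewrite !alg_fun_in.
Qed.

(** Each group element is replaced by its Weyl approximants; applying [theta] to the combination
    gives a number divisible by p^k, and it tends to the combination of the limits. Multiplying by
    d! turns these limits into Gaussian moments. *)
Lemma integral_theta l k : in_padic_ball k (rho (iota (iwasawa_sum l))) -> forall d x u,
  pdvd p k ((d.*2)`!%:R * \sum_(y <- l) y.1 * (toR (gauss_coef half he y.2) * toR (gauss_form half he x u y.2) ^+ d)).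
Proof.
move=> hb d x u; have [D hD] := choice (weyl_approx hiota hrho eE he half2).
have [t ht] := choice (fun g => (hD g).2 d x u).
pose th : {additive weyl_alg R n -> R} := theta (@weyl_act R n) d (map_mx toR x) (map_mx toR u).
have thZ a b : th (alg_in (weyl_alg R n) a * b) = a * th b by apply: thetaZ; apply: weyl_act_in.
pose Dl m := \sum_(y <- l) alg_in (weyl_alg R n) y.1 * D y.2 m.
have hDl : ball_tends (fun m => weyl_ext (Dl m)) (rho (iota (iwasawa_sum l))).
  rewrite phi_sum.
  have := ball_tends_sum l (fun y : R * G => ball_tendsZ y.1 (hD y.2).1).
  move=> h k'; have [m0 hm] := h k'; exists m0 => m /hm; congr (in_padic_ball k' (_ - _)).
  rewrite /Dl; apply/esym; apply: etrans (rmorph_sum _ _ _ _) _; apply: eq_bigr => y _.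
  by apply: etrans (weyl_extM _ _) _; rewrite weyl_ext_in.
have tl : tends p (fun m => th (Dl m)) (\sum_(y <- l) y.1 * t y.2).
  have := tends_sum l (fun y : R * G => tendsMl y.1 (ht y.2).1).
  apply: tends_ext => m; apply/esym; rewrite /Dl raddf_sum; apply: eq_bigr => y _.
  exact: thZ.
have hk : pdvd p k (\sum_(y <- l) y.1 * t y.2).
  have [m1 h1] := hDl k; have [m2 h2] := tl k.
  have := h1 _ (leq_maxl m1 m2) => /ballD /(_ hb); rewrite subrK.
  move=> /(weyl_ext_ball th) h3; apply: pdvd_transr h3.
  exact: pdvdBC (h2 _ (leq_maxr m1 m2)).
have := pdvdMl (d`!%:R) hk; congr (pdvd p k _); rewrite !mulr_sumr.
by apply: eq_bigr => y _; rewrite mulrCA (ht y.2).2 mulrCA.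
Qed.

Hypothesis phi_s : rho (iota (ext_in s)) = 0.

(** Both maps are continuous, so the image of a fine enough lift of [s] is as close to 0 as desired;
    the extra precision [a] pays for dividing by (2d)!. *)
Lemma null_gauss x u d :
  null (fun g => toR (gauss_coef half he g) * toR (gauss_form half he x u g) ^+ d).
Proof.
move=> k; have [a ha] := vring_pdvd_saturated v (fact_gt0 d.*2).
have [jj hjj] := metaplectic_continuous hrho (k + a).
have [j [N hN]] := iwasawa_embedding_continuous hiota jj.
exists N => l hl; apply: ha.
have := @integral_theta l (k + a) _ d x u; rewrite mulr_natl; apply.
have : in_padic_ball jj (iota (ext_in (s - (ilim_cst _ (group_sum l) : iwasawa_RG v n)))).
  apply: hN; exists 0; rewrite mulr0.
  have -> : ilim_val (s - (ilim_cst _ (group_sum l) : iwasawa_RG v n)) N =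
    ilim_val s N - qpi _ (group_sum l) by [].
  by rewrite -hl subrr.
move/hjj; rewrite rmorphB rmorphB rmorphB phi_s sub0r => /ballN.
by rewrite opprK.
Qed.

End NullFunctions.

(** * Approximation of indicator functions by polynomials *)

Lemma pdvdE p (A : pzRingType) k (x : A) : pdvd p k x <-> exists y, x = p%:R ^+ k * y.
Proof. by split=> -[y ->]; exists y; rewrite -natrX mulr_natl. Qed.

Section IndicatorPolynomials.
Variables (p : nat) (p_pr : prime p).
Local Notation Zp := (padic_int p_pr).

(** For a unit this is Euler's theorem modulo p^(M+1), applied to a residue; otherwise the exponent
    is at least M + 1. *)
Lemma padic_euler (u : Zp) M :
  pdvd p M.+1 (u ^+ (p.-1 * p ^ M) - (~~ `[< pdvd p 1 u >])%:R).
Proof.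
case: asboolP => [hu|hu] /=.
  rewrite subr0; apply: (pdvdW _ (pdvdX _ hu)); rewrite mul1n.
  have p1 := prime_gt1 p_pr; apply: leq_trans (ltn_expl M p1) _.
  by rewrite -{1}[(p ^ M)%N]mul1n leq_mul2r; lia.
have [a _ ha] := padic_residue u M.+1.
have cap : coprime a (p ^ M.+1).
  rewrite coprime_sym coprimeXl // prime_coprime //; apply/negP => /dvdnP[b bE].
  apply: hu; apply: (pdvd_transr (y := a%:R)); first by apply: pdvdW ha.
  by rewrite bE; apply/pdvd1P; exists b%:R; rewrite natrM mulr_natr.
apply: (@pdvd_trans p _ _ _ (a%:R ^+ (p.-1 * p ^ M))); first exact: pdvd_subX.
have := Euler_exp_totient cap; rewrite totient_pfactor //= -natrX.
set b := (a ^ _)%N => hb.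
have b0 : (0 < b)%N.
  rewrite lt0n; apply/eqP => b0; move: hb; rewrite b0 mod0n modn_small //.
  by rewrite -{1}(expn0 p) ltn_exp2l // prime_gt1.
have : (p ^ M.+1 %| b - 1)%N by rewrite -eqn_mod_dvd // hb.
case/dvdnP => d dE; exists d%:R.
by rewrite -natrB // dE natrM mulr_natr.
Qed.

(* The recursion refines a polynomial approximating the indicator function I of *)
(* [a + p^k Z_p]: [I (t - a) / p^k] is then integral and is divisible by [p] on the *)
(* coset [a + p^k.+1 Z_p] and off [a + p^k Z_p]. *)
Lemma padic_indicator_poly (a : Zp) k M : exists N (f : {poly Zp}), forall t,
  pdvd p (N + M) (f.[t] - (`[< pdvd p k (t - a) >])%:R *+ p ^ N).
Proof.
elim: k M => [|k IHk] M.
  exists 0%N, 1 => t; rewrite hornerC asboolT ?expn0 ?subrr; first exact: pdvd0.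
  exact: pdvd00.
(* The additional k + 1 digits make [f.[t] * (t - a)] divisible by p^(N+k) off the coset as well. *)
have [N [f hf]] := IHk (M + k.+1)%N.
pose L := (p.-1 * p ^ M)%N; pose N' := ((N + k) * L)%N.
(* On the coset modulo p^k the second factor is p^N' (1 - u^L) with u congruent to (t - a) / p^k
   modulo p, and u^L approximates the indicator of u being a unit. *)
exists (N + N')%N, (f * ((p%:R ^+ N')%:P - (f * ('X - a%:P)) ^+ L)) => t.
rewrite hornerM hornerD hornerN hornerC horner_exp hornerM hornerXsubC.
have /pdvdE[y hy] := hf t.
have {hy} fE : f.[t] = p%:R ^+ N * (`[< pdvd p k (t - a) >]%:R + p%:R ^+ (M + k.+1) * y).
  apply/eqP; rewrite mulrDr mulrA -exprD -subr_eq0; apply/eqP.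
  by rewrite opprD addrA -hy -natrX mulr_natl subrr.
set I := `[< _ >] in fE; have [hI|hI] := boolP I; last first.
  rewrite asboolF ?mul0rn ?subr0; last first.
    by move: hI => /asboolPn hI /(pdvdW (leqnSn k)).
  rewrite fE (negPf hI) add0r; apply/pdvdE.
  exists (p%:R ^+ k.+1 * y * (1 - (p%:R ^+ (M + 1) * y * (t - a)) ^+ L)).
  have -> : p%:R ^+ (M + k.+1) = p%:R ^+ M * p%:R ^+ k.+1 :> Zp by rewrite exprD.
  have -> : p%:R ^+ N * (p%:R ^+ M * p%:R ^+ k.+1 * y) * (t - a) =
      p%:R ^+ (N + k) * (p%:R ^+ (M + 1) * y * (t - a)).
    by rewrite !exprD exprS expr1; ring.
  by rewrite exprMn -exprM -/N' !exprD; ring.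
have /pdvdE[b bE] : pdvd p k (t - a) by apply/asboolP.
pose u := b * (1 + p%:R ^+ (M + k.+1) * y).
have uI : `[< pdvd p 1 u >] = `[< pdvd p k.+1 (t - a) >].
  have hu : pdvd p 1 (u - b).
    rewrite /u mulrDr mulr1 addrC addKr; apply/pdvdMl/pdvdMr/pdvdE.
    by exists (p%:R ^+ (M + k)); rewrite -exprD; congr (_ ^+ _); lia.
  apply/asboolP/asboolP => [h|].
    have /pdvdE[b' b'E] : pdvd p 1 b by apply: pdvd_transr h; apply: pdvdBC.
    by apply/pdvdE; exists b'; rewrite bE b'E mulrA -exprD addn1.
  move=> h; apply: (pdvd_transr hu).
  have := h; rewrite bE -natrX mulr_natl -addn1 addnC => -[z].
  rewrite expnD mulrnA => hz.
  exists z; apply/eqP; rewrite -subr_eq0; apply/eqP.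
  apply: (@padic_mulrn_inj p p_pr _ (p ^ k)); first by rewrite expn_gt0 prime_gt0.
  by rewrite mulrnBl hz subrr.
have -> : f.[t] * (t - a) = p%:R ^+ (N + k) * u.
  by rewrite fE hI bE /u !exprD /=; ring.
rewrite exprMn -exprM -/N'.
have /pdvdE[z hz] := padic_euler u M.
have uL : u ^+ L = (~~ `[< pdvd p k.+1 (t - a) >])%:R + p%:R ^+ M.+1 * z.
  by rewrite -uI -hz addrC subrK.
rewrite uL fE hI /=; apply/pdvdE.
set J := `[< _ >].
exists (p%:R ^+ k.+1 * y * J%:R - p%:R * z * (1 + p%:R ^+ (M + k.+1) * y)).
rewrite -[J%:R *+ _]mulr_natl natrX !exprD !exprS; case: J => /=; ring.
Qed.

End IndicatorPolynomials.

Lemma coef_exp_quadratic (A : comNzRingType) (f : {poly A}) d : (size f <= 3)%N ->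
  (f ^+ d)`_(d.*2) = f`_2 ^+ d.
Proof.
move=> sf; elim: d => [|d IHd]; first by rewrite !expr0 coef1.
have sfd : (size (f ^+ d) <= d.*2.+1)%N.
  apply: leq_trans (size_poly_exp_leq _ _) _; rewrite ltnS.
  by rewrite -mul2n leq_mul2r; apply/orP; right; rewrite -subn1 leq_subLR.
rewrite exprS coefM (bigD1 (inord 2)) //= inordK ?ltnS // big1 => [|i /eqP ni].
  by rewrite addr0 doubleS subSS subSS subn0 IHd exprS.
have [i2|i2] := ltnP 2 i; first by rewrite [f`_i]nth_default ?mul0r // (leq_trans sf).
rewrite [(f ^+ d)`_ _]nth_default ?mulr0 // (leq_trans sfd) //.
have : (i : nat) != 2 by apply/eqP => h; apply: ni; apply: val_inj; rewrite /= inordK.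
by lia.
Qed.

Section Forms.
Variables (S : comNzRingType) (n : nat).
Lemma quadval_line (A : 'M[S]_n) x y : exists b, forall t,
  quadval A (x + t *: y) = quadval A x + t * b + t ^+ 2 * quadval A y.
Proof.
exists ((x^T *m A *m y) 0 0 + (y^T *m A *m x) 0 0) => t.
have trE : (x + t *: y)^T = x^T + t *: y^T by rewrite raddfD /= linearZ.
rewrite /quadval trE !mulmxDl !mulmxDr -!scalemxAl -!scalemxAr !mxE; ring.
Qed.
Lemma bilin_line (A : 'M[S]_n) (x x' u u' : 'cV[S]_n) : exists b, forall t,
  ((x + t *: x')^T *m (A *m (u + t *: u'))) 0 0 =
  (x^T *m (A *m u)) 0 0 + t * b + t ^+ 2 * (x'^T *m (A *m u')) 0 0.
Proof.
exists ((x^T *m (A *m u')) 0 0 + (x'^T *m (A *m u)) 0 0) => t.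
have trE : (x + t *: x')^T = x^T + t *: x'^T by rewrite raddfD /= linearZ.
rewrite trE !mulmxDl !mulmxDr -!scalemxAl -!scalemxAr !mxE; ring.
Qed.
End Forms.

(** * Localization to congruence conditions on the quadratic forms *)

Section Density.
Variables (p : nat) (p_pr : prime p) (K : fieldExtType (padic_num p_pr)).
Variables (v : padic_valuation K) (n : nat).
Local Notation Zp := (padic_int p_pr).
Local Notation R := (valuation_ring v).
Local Notation G := (congr_sp p_pr n).
Local Notation toR := (padic_to_vring v).
Variable s : iwasawa_RG v n.
Variables (e : nat -> Zp) (half : Zp) (he : dpow p e).
Local Notation gc g := (toR (@gauss_coef p p_pr n e half he g)).
Local Notation q := (@gauss_form p p_pr n e half he).

(** For large i the whole sum is congruent to its constant term, which is therefore null; remove it,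
    divide by p^(k+i), which saturation permits, and repeat. *)
Lemma null_poly (F : nat -> G -> R) k m :
  (forall i, null s (fun g => \sum_(j < m) F j g *+ (p ^ (k + i)) ^ j)) ->
  forall j, (j < m)%N -> null s (F j).
Proof.
elim: m F => [|m IHm] F h // j jm.
have h0 : null s (F 0%N).
  move=> M; apply: nullM_approx (h M M) => g; rewrite big_ord_recl expn0 mulr1n opprD addrA subrr sub0r.
  apply/pdvdN/pdvd_sum => i _; exists (F (lift ord0 i) g *+ (p ^ k * (p ^ (k + M)) ^ i)).
  by rewrite -mulrnA lift0 expnS expnD; congr (_ *+ _); rewrite mulnAC.
case: j jm => [//|j]; rewrite ltnS => jm.
apply: (IHm (fun j => F j.+1)) jm => i; apply: (null_saturated (l := (k + i)%N)).
apply: null_ext (nullD (h i) (nullZ (-1) h0)) => g.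
rewrite big_ord_recl expn0 mulr1n mulN1r addrAC subrr add0r -sumrMnl.
by apply: eq_bigr => l _; rewrite -mulrnA lift0 expnSr.
Qed.

Lemma gauss_form_line x u x' u' g : exists b, forall t,
  q (x + t *: x') (u + t *: u') g = q x u g + t * b + t ^+ 2 * q x' u' g.
Proof.
have [b1 h1] := bilin_line (lev_inv he g)^T x x' u u'.
have [b2 h2] := quadval_line (dlsubmx (g : 'M_(n + n)) *m lev_inv he g) x x'.
have [b3 h3] := quadval_line (lev_inv he g *m ursubmx (g : 'M_(n + n))) u u'.
exists (b1 - half * b2 + half * b3) => t; rewrite /gauss_form h1 h2 h3; ring.
Qed.

(** All points are quantified at once, so that a restriction imposed at one point can be followed by
    a restriction at another. *)
Definition null_on (T : G -> bool) : Prop :=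
  forall x u d, null s (fun g => gc g * (T g)%:R * toR (q x u g) ^+ d).

Lemma null_on_horner T x u (f : {poly Zp}) : null_on T ->
  null s (fun g => gc g * (T g)%:R * toR f.[q x u g]).
Proof.
move=> hT; apply: (null_ext (F' := fun g => \sum_(j < size f) toR f`_j * (gc g * (T g)%:R * toR (q x u g) ^+ j))).
  move=> g; rewrite horner_coef rmorph_sum mulr_sumr; apply: eq_bigr => j _.
  by rewrite rmorphM rmorphXn; apply: mulrCA.
by apply: null_sum => j; apply/nullZ/hT.
Qed.

(** The indicator is replaced by a polynomial in the same value of [q], so only moments at one point
    are needed. The denominator p^N of the approximation is removed by saturation. *)
Lemma null_on_same T x u a k d : null_on T ->
  null s (fun g => gc g * (T g && `[< pdvd p k (q x u g - a) >])%:R * toR (q x u g) ^+ d).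
Proof.
move=> hT M; have [N [f hf]] := padic_indicator_poly a k M.
apply: (nullM_saturated (l := N)).
apply: nullM_approx (null_on_horner x u (f * 'X^d) hT (M + N)%N) => g.
rewrite hornerM hornerXn rmorphM rmorphXn; case: (T g) => /=; last first.
  by rewrite !mulr0 !mul0r mul0rn subrr; apply: pdvd0.
have := pdvdBC (hf (q x u g)) => /(pdvd_additive toR); rewrite addnC raddfB raddfMn/=.
move=> /(pdvdMl (gc g * toR (q x u g) ^+ d)); congr (pdvd p _ _).
rewrite mulrBr mulr1 (mulrnAr (gc g * toR (q x u g) ^+ d)) rmorph_nat [X in X *+ _ - _]mulrAC; congr (_ - _).
by rewrite -!mulrA; congr (_ * _); apply: mulrC.
Qed.

(** Move the point along (x0, u0) + t (x, u). For t divisible by p^k the condition is the one at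
    (x0, u0), while the d-th power of the form is a polynomial in t of degree at most 2d whose
    coefficient in degree 2d is [q x u g ^+ d]; letting t run through p^(k+i) isolates it. *)
Lemma null_restrict T x0 u0 a k : null_on T ->
  null_on (fun g => T g && `[< pdvd p k (q x0 u0 g - a) >]).
Proof.
move=> hT x u d; pose I g := T g && `[< pdvd p k (q x0 u0 g - a) >].
have [b hb] := choice (gauss_form_line x0 u0 x u).
pose f g : {poly Zp} := (q x0 u0 g)%:P + (b g)%:P * 'X + (q x u g)%:P * 'X^2.
have fE g t : (f g).[t] = q (x0 + t *: x) (u0 + t *: u) g.
  by rewrite hb /f !hornerD !hornerM !hornerC hornerX; ring.
have szf g : (size (f g) <= 3)%N.
  apply: leq_trans (size_polyD _ _) _; rewrite geq_max; apply/andP; split.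
    apply: leq_trans (size_polyD _ _) _; rewrite geq_max; apply/andP; split.
      by apply: leq_trans (size_polyC_leq1 _) _.
    by rewrite mul_polyC; apply: leq_trans (size_scale_leq _ _) _; rewrite size_polyX.
  by rewrite mul_polyC; apply: leq_trans (size_scale_leq _ _) _; rewrite size_polyXn.
have f2 g : (f g)`_2 = q x u g.
  by rewrite /f !mul_polyC !coefD coefC !coefZ coefX coefXn /= mulr0 mulr1 !add0r.
have := @null_poly (fun j g => gc g * (I g)%:R * toR ((f g ^+ d)`_j)) k d.*2.+1 _ d.*2 (ltnSn _).
move=> H; have {}H := H _.
apply: (null_ext (F' := fun g => gc g * (I g)%:R * toR ((f g ^+ d)`_(d.*2)))).
  by move=> g; rewrite coef_exp_quadratic // f2 rmorphXn.
apply: H => i; pose t : Zp := (p ^ (k + i))%:R.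
apply: null_ext (null_on_same (x0 + t *: x) (u0 + t *: u) a k d hT) => g.
rewrite -fE -rmorphXn -horner_exp.
(* The values at the two points differ by a multiple of t, hence of p^k. *)
have -> : `[< pdvd p k ((f g).[t] - a) >] = `[< pdvd p k (q x0 u0 g - a) >].
  have ht : pdvd p k ((f g).[t] - q x0 u0 g).
    rewrite fE hb (_ : _ - _ = t * (b g + t * q x u g)); last by ring.
    apply/pdvdMr.
    by apply: pdvdW (pdvd_natX _ _ _); rewrite leq_addr.
  by apply/asboolP/asboolP => h; [apply: pdvd_trans (pdvdBC ht) h | apply: pdvd_trans ht h].
rewrite -/(I g) (@horner_coef_wide _ d.*2.+1); last first.
  apply: leq_trans (size_poly_exp_leq _ _) _; rewrite ltnS -mul2n leq_mul2r.
  by apply/orP; right; rewrite -subn1 leq_subLR.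
rewrite rmorph_sum mulr_sumr; apply: eq_bigr => j _.
by rewrite /t -natrX [_`_j * _]mulr_natr raddfMn (mulrnAr (gc g * (I g)%:R)).
Qed.

(** Each point of [zs] splits [T] into p^k pieces according to the residue of the form there. Once
    all points are used, [F] and the Gaussian coefficient are constant modulo p^M on each piece. *)
Lemma null_classes (zs : seq ('cV[Zp]_n * 'cV[Zp]_n)) k M (F : G -> R) T :
  null_on T -> (forall g, exists c, c * gc g = 1) ->
  (forall g g', T g -> T g' ->
    (forall z, z \in zs -> pdvd p k (q z.1 z.2 g - q z.1 z.2 g')) ->
    pdvd p M (F g - F g') /\ pdvd p M (gc g - gc g')) ->
  nullM s M (fun g => (T g)%:R * F g).
Proof.
move=> + hc; elim: zs T => [|z zs IHz] T hT hF.
  have [[g0 Tg0]|T0] := pselect (exists g0, T g0); last first.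
    apply: nullM_ext (nullM0 s M) => g; case E: (T g); last by rewrite mul0r.
    by case: T0; exists g.
  have [c0 c0E] := hc g0.
  (* [F] is approximated on [T] by a constant multiple of the Gaussian coefficient, whose integral
     is the moment with d = 0. *)
  apply: nullM_approx (nullMZ (F g0 * c0) (hT 0 0 0%N M)) => g; rewrite expr0 mulr1.
  case E: (T g); last by rewrite !mul0r !mulr0 subr0; apply: pdvd0.
  have [h1 h2] := hF g g0 E Tg0 (fun z hz => False_ind _ (eq_ind false (fun b => if b then False else True) I true hz)).
  rewrite mul1r mulr1; apply: (pdvd_trans h1).
  have -> : F g0 - F g0 * c0 * gc g = - (F g0 * c0) * (gc g - gc g0).
    by rewrite mulrBr !mulNr -!mulrA c0E mulr1 opprK addrC.
  exact: pdvdMl.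
apply: (nullM_ext (F' := fun g => \sum_(a < p ^ k)
    ((T g && `[< pdvd p k (q z.1 z.2 g - (a : nat)%:R) >])%:R * F g))).
  move=> g; rewrite -mulr_suml; congr (_ * _); case: (T g); last by rewrite big1.
  have [a ak ha] := padic_residue (q z.1 z.2 g) k.
  rewrite (bigD1 (Ordinal ak)) //= asboolT // big1 ?addr0 // => b /eqP nb.
  rewrite asboolF // => hb; apply: nb; apply: val_inj => /=.
  exact: padic_residue_unique hb ha.
apply: nullM_sum => a; apply: IHz; first exact: null_restrict.
move=> g g' /andP[Tg /asboolP ha] /andP[Tg' /asboolP ha'] h; apply: hF => // z'.
rewrite inE => /orP[/eqP ->|/h//].
exact: pdvd_trans ha (pdvdBC ha').
Qed.

End Density.

(** * From Gaussian symbols to congruence classes *)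

Lemma pdvd_congrD p (V : zmodType) k (x x' y y' : V) :
  pdvd p k (x - x') -> pdvd p k (y - y') -> pdvd p k (x + y - (x' + y')).
Proof. by move=> hx hy; rewrite opprD addrACA; apply: pdvdD. Qed.

Lemma pdvd_congrB p (V : zmodType) k (x x' y y' : V) :
  pdvd p k (x - x') -> pdvd p k (y - y') -> pdvd p k (x - y - (x' - y')).
Proof. by move=> hx hy; apply: pdvd_congrD => //; rewrite -opprD; apply: pdvdN. Qed.

Lemma pdvd_mx_congr p (A : pzRingType) r k (a a' : 'M[A]_r) (f f' : 'I_r -> 'I_r -> A) :
  (forall i j, a i j = f i j) -> (forall i j, a' i j = f' i j) ->
  (forall i j, pdvd p k (f i j - f' i j)) -> pdvd p k (a - a').
Proof. by move=> ha ha' h; apply: pdvd_mx => i j; rewrite !mxE ha ha'. Qed.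

Lemma mulmx_sub_inv (S : comPzRingType) r (a a' h h' : 'M[S]_r) :
  a *m h = 1%:M -> h' *m a' = 1%:M -> a - a' = - (a *m ((h - h') *m a')).
Proof. by move=> ah ha'; rewrite mulmxBl mulmxBr ha' mulmx1 mulmxA ah mul1mx opprB. Qed.

Lemma ideal_gen_sum (A : pzRingType) (P : A -> Prop) (I : eqType) (r : seq I) (F : I -> A) :
  (forall i, i \in r -> ideal_gen P (F i)) -> ideal_gen P (\sum_(i <- r) F i).
Proof.
elim: r => [|i r IHr] h; first by rewrite big_nil; apply: ideal_gen0.
rewrite big_cons; apply: ideal_genD; first by apply: h; rewrite inE eqxx.
by apply: IHr => j jr; apply: h; rewrite inE jr orbT.
Qed.

Lemma ideal_gen_lincomb (S : pzRingType) (A : algebra S) (P : A -> Prop) (I : eqType) (r : seq I)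
    (c : I -> S) (u : I -> A) (w : A) :
  (forall i, i \in r -> ideal_gen P (u i - w)) -> \sum_(i <- r) c i = 0 ->
  ideal_gen P (\sum_(i <- r) alg_in A (c i) * u i).
Proof.
move=> hu hc.
have -> : \sum_(i <- r) alg_in A (c i) * u i = \sum_(i <- r) alg_in A (c i) * (u i - w).
  under [RHS]eq_bigr do rewrite mulrBr.
  by rewrite sumrB -mulr_suml -rmorph_sum hc rmorph0 mul0r subr0.
by apply: ideal_gen_sum => i ir; apply/ideal_genMl/hu.
Qed.

(** * Coset sums and the ideal of a subgroup *)

Section CosetSums.
Variables (S : comNzRingType) (G : groupType) (N : G -> Prop).
Hypotheses (N1 : N 1%g) (NM : forall g h, N g -> N h -> N (g * h)%g).
Hypothesis NV : forall g, N g -> N (g^-1)%g.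
Local Notation P := (fun a : group_alg S G => exists2 g, N g & a = group_in S g - 1).

Definition coset_ind (g h : G) : S := (`[< N (g^-1 * h)%g >])%:R.

Lemma group_in_coset g h : N (g^-1 * h)%g -> ideal_gen P (group_in S h - group_in S g).
Proof.
move=> gh; have -> : group_in S h - group_in S g = group_in S g * (group_in S (g^-1 * h)%g - 1).
  by rewrite mulrBr mulr1 -group_inM mulVKg.
by apply/ideal_genMl/ideal_gen_in; exists (g^-1 * h)%g.
Qed.

(** Split off the coset of the first element: its members are congruent modulo the ideal and their
    coefficients add up to 0, so that part lies in the ideal. The rest is shorter and keeps
    vanishing coset sums. *)
Lemma coset_sums_ideal (l : seq (S * G)) :
  (forall g, \sum_(y <- l) y.1 * coset_ind g y.2 = 0) -> ideal_gen P (group_sum l).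
Proof.
have [m] := ubnP (size l); elim: m l => // m IHm [|y0 l] sl hl.
  by rewrite /group_sum big_nil; apply: ideal_gen0.
pose Q (y : S * G) := `[< N (y0.2^-1 * y.2)%g >]; set l0 := y0 :: l in hl *.
have Q0 : Q y0 by apply/asboolP; rewrite mulVg.
have -> : group_sum l0 = group_sum [seq y <- l0 | Q y] + group_sum [seq y <- l0 | ~~ Q y].
  by rewrite /group_sum !big_filter; apply: (bigID Q).
apply: ideal_genD.
  apply: (@ideal_gen_lincomb S (group_alg S G) P _ _ fst (fun y => group_in S y.2) (group_in S y0.2)).
    by move=> y; rewrite mem_filter => /andP[/asboolP Qy _]; apply: group_in_coset.
  rewrite big_filter big_mkcond; apply: etrans (hl y0.2); apply: eq_bigr => y _.
  by rewrite /coset_ind -/(Q y); case: (Q y); rewrite ?mulr1 ?mulr0.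
apply: IHm => [|g].
  rewrite /l0 /= Q0 size_filter; apply: leq_ltn_trans (count_size _ _) _.
  exact: sl.
have [/asboolP h|/asboolPn h] := boolP `[< N (y0.2^-1 * g)%g >].
  rewrite big_filter big1 // => y /asboolPn nQ; rewrite /coset_ind asboolF ?mulr0 // => hy.
  by apply: nQ; have := NM h hy; rewrite -mulgA mulVKg.
rewrite big_filter big_mkcond; apply: etrans (hl g); apply: eq_bigr => y _.
case: ifP => // /negbFE /asboolP Qy; rewrite /coset_ind asboolF ?mulr0 // => hy.
by apply: h; have := NM Qy (NV hy); rewrite invgM invgK -mulgA mulVKg.
Qed.

End CosetSums.

(** * Recovering a group element from finitely many values of its form *)

Section GaussPoints.
Variables (p : nat) (p_pr : prime p) (n : nat).
Local Notation Zp := (padic_int p_pr).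
Local Notation M := 'M[Zp]_n.
Local Notation G := (congr_sp p_pr n).
Variables (e : nat -> Zp) (half : Zp) (he : dpow p e).
Hypothesis half2 : half *+ 2 = 1.
Local Notation d i := (delta_mx i 0 : 'cV[Zp]_n).
Local Notation q := (@gauss_form p p_pr n e half he).
Local Notation low g := (dlsubmx (g : 'M_(n + n)) *m lev_inv he g).
Local Notation upp g := (lev_inv he g *m ursubmx (g : 'M_(n + n))).

Lemma bilin_delta (A : M) i j : ((d i)^T *m (A *m d j)) 0 0 = A i j.
Proof. by rewrite trmx_delta -colE -rowE !mxE. Qed.

Lemma quadval0 (A : M) : quadval A 0 = 0.
Proof. by rewrite /quadval mulmx0 mxE. Qed.

Lemma quadval_polar (A : M) i j : A^T = A ->
  half * quadval A (d i + d j) = A i j + half * quadval A (d i) + half * quadval A (d j).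
Proof.
move=> sA; have Aji : A j i = A i j by rewrite -[in LHS]sA mxE.
have qd l : quadval A (d l) = A l l by rewrite /quadval -mulmxA bilin_delta.
have trD : (d i + d j)^T = (d i)^T + (d j)^T by rewrite raddfD.
have -> : quadval A (d i + d j) = A i i + A i j + (A j i + A j j).
  rewrite /quadval -mulmxA trD mulmxDl mulmxDr mulmxDr mulmxDr.
  rewrite [LHS]mxE [X in X + _]mxE [X in _ + X]mxE.
  by rewrite !bilin_delta.
have h2 x : x = half * x + half * x by rewrite -mulrDl -mulr2n half2 mul1r.
rewrite !qd Aji [A i j in RHS]h2; ring.
Qed.

Lemma lev_inv_gauss (g : G) i j : lev_inv he g i j = q (d j) (d i) g - q (d j) 0 g - q 0 (d i) g.
Proof.
rewrite /gauss_form !quadval0 bilin_delta !mulmx0 trmx0 !mul0mx !mxE; ring.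
Qed.
Lemma low_gauss (g : G) i j : low g i j = q (d i) 0 g + q (d j) 0 g - q (d i + d j) 0 g.
Proof.
rewrite /gauss_form !quadval0 !mulmx0 [(0 : 'M_1) 0 0]mxE.
rewrite (quadval_polar _ _ (nlow_sym he g)); ring.
Qed.
Lemma upp_gauss (g : G) i j : upp g i j = q 0 (d i + d j) g - q 0 (d i) g - q 0 (d j) g.
Proof.
rewrite /gauss_form !quadval0 !trmx0 !mul0mx [(0 : 'M_1) 0 0]mxE.
rewrite (quadval_polar _ _ (nup_sym he g)); ring.
Qed.

(** Zero, the basis vectors and their pairwise sums, in both variables: what polarization
    requires. *)
Definition gauss_points : seq ('cV[Zp]_n * 'cV[Zp]_n) :=
  let xs := 0 :: codom (fun i : 'I_n => d i) ++ codom (fun ij : 'I_n * 'I_n => d ij.1 + d ij.2) in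
  [seq (x, u) | x <- xs, u <- xs].

(** Polarization expresses the entries of h, c h and h b through these values. The blocks a, b, c
    and d are then recovered by operations that preserve congruences, inversion included. *)
Lemma gauss_points_congr k (g g' : G) :
  (forall z, z \in gauss_points -> pdvd p k (q z.1 z.2 g - q z.1 z.2 g')) ->
  pdvd p k ((g : 'M_(n + n)) - (g' : 'M_(n + n))) /\
  pdvd p k (ulsubmx (g : 'M_(n + n)) - ulsubmx (g' : 'M_(n + n))).
Proof.
move=> hz; pose xs : seq 'cV[Zp]_n :=
  0 :: codom (fun i : 'I_n => d i) ++ codom (fun ij : 'I_n * 'I_n => d ij.1 + d ij.2).
have x0 : 0 \in xs by rewrite inE eqxx.
have x1 i : d i \in xs by rewrite inE mem_cat (codom_f (fun i : 'I_n => d i) i) orbT.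
have x2 i j : d i + d j \in xs.
  by rewrite inE mem_cat (codom_f (fun ij : 'I_n * 'I_n => d ij.1 + d ij.2) (i, j)) !orbT.
have hq x u : x \in xs -> u \in xs -> pdvd p k (q x u g - q x u g').
  by move=> hx hu; apply: (hz (x, u)); apply: allpairs_f.
have hh : pdvd p k (lev_inv he g - lev_inv he g').
  apply: (pdvd_mx_congr (lev_inv_gauss g) (lev_inv_gauss g')) => j i.
  by apply: pdvd_congrB; [apply: pdvd_congrB|]; apply: hq.
have hl : pdvd p k (low g - low g').
  apply: (pdvd_mx_congr (low_gauss g) (low_gauss g')) => i j.
  by apply: pdvd_congrB; [apply: pdvd_congrD|]; apply: hq.
have hu : pdvd p k (upp g - upp g').
  apply: (pdvd_mx_congr (upp_gauss g) (upp_gauss g')) => i j.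
  by apply: pdvd_congrB; [apply: pdvd_congrB|]; apply: hq.
pose a g : M := ulsubmx (g : 'M_(n + n)).
have ha : pdvd p k (a g - a g').
  rewrite (mulmx_sub_inv (mul_lev_inv he g) (lev_invM he g')).
  exact/pdvdN/pdvdMl/pdvdMr.
have hb : pdvd p k (ursubmx (g : 'M_(n + n)) - ursubmx (g' : 'M_(n + n)) : M).
  have bE (g0 : G) : ursubmx (g0 : 'M_(n + n)) = a g0 * upp g0.
    by rewrite mulrA (mul_lev_inv he g0 : _ * _ = 1) mul1r.
  by rewrite (bE g) (bE g'); apply: pdvd_subM.
have hc : pdvd p k (dlsubmx (g : 'M_(n + n)) - dlsubmx (g' : 'M_(n + n)) : M).
  have cE (g0 : G) : dlsubmx (g0 : 'M_(n + n)) = low g0 * a g0.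
    by rewrite -mulrA (lev_invM he g0 : _ * _ = 1) mulr1.
  by rewrite (cE g) (cE g'); apply: pdvd_subM.
split=> //; rewrite -[g : 'M_(n + n)]submxK -[g' : 'M_(n + n)]submxK opp_block_mx add_block_mx.
apply: pdvd_block => //; rewrite !(drsubmx_lev he) opprD addrACA; apply: pdvdD.
  by rewrite -raddfB; apply: pdvd_tr.
exact: (pdvd_subM hl hb).
Qed.

(** Passing from the block a to its logarithm costs one factor of p, hence the [k.+1]. *)
Lemma gauss_coef_congr k (g g' : G) :
  pdvd p k.+1 (ulsubmx (g : 'M_(n + n)) - ulsubmx (g' : 'M_(n + n))) ->
  pdvd p k (gauss_coef half he g - gauss_coef half he g').
Proof.
rewrite -!(lev_logE he) => /mexp_cont_inv h; apply: (pdvdW (leqnSn k)); apply: pexp_cont.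
rewrite opprK addrC -mulrBr -raddfB; apply/pdvdMl/(pdvd_additive (@mxtrace _ _)).
exact: pdvdBC.
Qed.

Lemma gauss_coef_unit (g : G) : exists c, c * gauss_coef half he g = 1.
Proof.
exists (zexp he (half * \tr (lev_log he g))); rewrite /gauss_coef.
exact: (pexpN (@padic_sep p p_pr)).
Qed.

Lemma congr_on (N : open_normal p_pr n) k (g h : G) :
  (forall x : G, congr1_mx k x -> N x) -> pdvd p k ((g : 'M_(n + n)) - (h : 'M_(n + n))) -> N (g^-1 * h)%g.
Proof.
move=> hN hgh; apply/hN/congr1_mxP.
have V : (cs_val (g^-1)%g) *m (g : 'M_(n + n)) = 1%:M by exact: congr_sp_invmxl.
have -> : cs_val (g^-1 * h)%g - 1%:M = cs_val (g^-1)%g *m ((h : 'M_(n + n)) - (g : 'M_(n + n))).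
  by rewrite mulmxBr V.
exact/pdvdMl/pdvdBC.
Qed.

End GaussPoints.

(** * Triviality of the kernel *)

Section Kernel.
Variables (p : nat) (p_pr : prime p) (p_odd : odd p) (K : fieldExtType (padic_num p_pr)).
Variables (v : padic_valuation K) (n : nat).
Local Notation Zp := (padic_int p_pr).
Local Notation R := (valuation_ring v).
Local Notation G := (congr_sp p_pr n).
Local Notation toR := (padic_to_vring v).
Variables (iota : alg_hom (iwasawa_alg v n) (affinoid_env v n)).
Variables (rho : alg_hom (affinoid_env v n) (completed_weyl v n)).
Hypothesis hiota : is_iwasawa_embedding iota.
Hypothesis hrho : is_metaplectic rho.

Lemma kernel_coset_sum (s : iwasawa_RG v n) (N : open_normal p_pr n) (g0 : G) M :
  rho (iota (ext_in s)) = 0 -> nullM s M (coset_ind R N g0).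
Proof.
move=> phi_s; have [e [eE he]] := padic_dpow_exists p_pr p_odd.
have [half half2] : exists half : Zp, half *+ 2 = 1.
  have [|y hy] := @padic_coprime_unit p p_pr 2; first by rewrite coprime2n.
  by exists y; rewrite -mulr_natl.
have [k0 hN] := on_open N.
(* k0 makes congruent elements lie in the same coset of [N], M controls the Gaussian coefficient;
   the classes are taken modulo p^(k+1) because of the logarithm. *)
pose k := maxn k0 M.
suff [N' hN'] : nullM s M (fun g => (true : bool)%:R * coset_ind R N g0 g).
  by exists N' => l /hN'; congr (pdvd p M _); apply: eq_bigr => y _; rewrite mul1r.
apply: (@null_classes _ _ _ _ _ s e half he (gauss_points p_pr n) k.+1 M (coset_ind R N g0) (fun=> true)).
- move=> x u d; apply: null_ext (null_gauss hiota hrho eE he half2 phi_s x u d) => g.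
  by rewrite mulr1.
- by move=> g; have [c hc] := gauss_coef_unit half he g; exists (toR c); rewrite -rmorphM hc rmorph1.
- move=> g g' _ _ /(gauss_points_congr half2)[h1 h2]; split.
    have hgg : N (g^-1 * g')%g.
      by apply: (congr_on (k := k.+1)) => // x /congr1_mxP hx; apply/hN/congr1_mxP/(pdvdW _ hx)/ltnW/leq_maxl.
    rewrite (_ : coset_ind R N g0 g = coset_ind R N g0 g') ?subrr; first exact: pdvd0.
    rewrite /coset_ind; congr ((nat_of_bool _)%:R); apply/asboolP/asboolP => h.
      by have := onM h hgg; rewrite -mulgA mulVKg.
    by have := onM h (onV hgg); rewrite invgM invgK -mulgA mulVKg.
  rewrite -raddfB; apply: pdvd_additive; apply: (pdvdW (leq_maxr k0 M)).
  exact: gauss_coef_congr.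
Qed.

(** For each [N], every coset sum of a lift is divisible by all powers of p, hence is zero, and the
    lift lies in the ideal of [N]. *)
Lemma kernel_integral (s : iwasawa_RG v n) : rho (iota (ext_in s)) = 0 -> s = 0.
Proof.
move=> phi_s; apply: ilimP => N.
have [l hl] := lifts_exists s N.
have z0 : ilim_val (0 : iwasawa_RG v n) N = qpi _ 0 by [].
apply: (etrans hl); apply: etrans (esym z0); apply/qpi_eqP; rewrite subr0.
apply: (coset_sums_ideal (@on1 _ _ _ N) (@onM _ _ _ N) (@onV _ _ _ N)) => g.
apply: vring_sep => M.
have [N' hN'] := kernel_coset_sum N g M phi_s.
(* The divisibility is known for lifts at a level depending on M. A lift at a common refinement has
   it too, and its coset sums for [N] agree with those of [l]. *)
have [N2 [N2N N2N']] := open_normalI N N'.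
have [l2 hl2] := lifts_exists s N2.
have := hN' _ (lifts_sub N2N' hl2); congr (pdvd p M _).
apply: (@coset_sum_wd _ _ N).
  move=> x Nx y z; rewrite /coset_ind; congr ((nat_of_bool _)%:R).
  (* Normality: inserting [x] in the middle amounts to multiplying on the right by a conjugate of
     [x]. *)
  have Nx' : N ((y * z)^-1 * (y * x * z))%g.
    by have := onJ z Nx; rewrite invgM -!mulgA mulKg.
  apply/asboolP/asboolP => h.
    by have := onM h (onV Nx'); rewrite invgM invgK -mulgA mulVKg.
  by have := onM h Nx'; rewrite -mulgA mulVKg.
by apply/qpi_eqP; rewrite -(lifts_sub N2N hl2).
Qed.

End Kernel.

Theorem theorem1p2 (p : nat) (p_pr : prime p) (p_odd : odd p)
    (K : fieldExtType (padic_num p_pr)) (v : padic_valuation K)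
    (n : nat) (n_ge2 : (2 <= n)%N)
    (iota : alg_hom (iwasawa_alg v n) (affinoid_env v n))
    (rho : alg_hom (affinoid_env v n) (completed_weyl v n)) :
  is_iwasawa_embedding iota -> is_metaplectic rho ->
  injective (fun f : iwasawa_alg v n => rho (iota f)).
Proof.
move=> hiota hrho f f' ff'.
(* A power of p brings the difference into the image of RG; since p is invertible in K, it can be
   cancelled at the end. *)
have [N [s hs]] := ext_scalars_den (f - f').
have s0 : s = 0.
  apply: (kernel_integral p_odd hiota hrho).
  have B (a b : iwasawa_alg v n) : rho (iota (a - b)) = rho (iota a) - rho (iota b).
    by rewrite !rmorphB.
  have Mn (a : iwasawa_alg v n) j : rho (iota (a *+ j)) = rho (iota a) *+ j.
    by rewrite !rmorphMn.
  by apply: (etrans (congr1 (fun z => rho (iota z)) (esym hs))); rewrite Mn B ff' subrr mul0rn.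
apply/eqP; rewrite -subr_eq0; apply/eqP; apply: (ext_scalars_tf (N := N)).
by rewrite hs s0; apply: rmorph0.
Qed.
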